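(* Let $(X_0,X_1)$ and $(Y_0,Y_1)$ be compatible pairs of quasi-Banach lattices and let $\varphi\in\mathcal P$. There is a constant $C>0$, depending only on $X_0,X_1,Y_0,Y_1$ and $\varphi$, such that for every linear operator $T:X_0+X_1\to Y_0+Y_1$ for which $T|_{X_j}$ maps $X_j$ into $Y_j$ and $T|_{X_j}:X_j\to Y_j$ is $(\infty,1)$-regular for $j=0,1$, the operator $T$ maps $\varphi^0(X_0,X_1)$ into $\varphi^0(Y_0,Y_1)$, the operator $T:\varphi^0(X_0,X_1)\to\varphi^0(Y_0,Y_1)$ is $(\infty,1)$-regular, and $$\rho_{\infty,1}(T|_{\varphi^0(X_0,X_1)})\le C\max\{\rho_{\infty,1}(T|_{X_0}),\rho_{\infty,1}(T|_{X_1})\}.$$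
   Context: All spaces are real. A quasi-norm satisfies the norm axioms except that the triangle inequality is replaced by $\|x+y\|\le C(\|x\|+\|y\|)$ for some constant $C\ge1$. A quasi-Banach lattice is a vector lattice with a complete quasi-norm such that $\|x\|\le\|y\|$ whenever $|x|\le|y|$. Compatible pair: $(X_0,X_1)$ is a compatible pair of quasi-Banach lattices if there are a Hausdorff locally solid topological vector lattice $X$ and injective, continuous, interval preserving lattice homomorphisms $j_i:X_i\hookrightarrow X$ ($i=0,1$), where interval preserving means $j_i([0,x])=[0,j_i(x)]$ for $x\ge0$. One identifies $X_i$ with its image. Then $X_0+X_1=\{x_0+x_1: x_i\in X_i\}\subset X$ is a quasi-Banach lattice with quasi-norm $\|x\|=\inf\{\|x_0\|_{X_0}+\|x_1\|_{X_1}:x=x_0+x_1\}$, containing $X_0,X_1$ as (not necessarily closed) ideals. The class $\mathcal P$: all functions $\varphi:(0,\infty)\times(0,\infty)\to[0,\infty)$ with $\varphi(\lambda s,\lambda t)=\lambda\varphi(s,t)$ for $s,t,\lambda>0$ and non-decreasing in each variable, normalized by $\varphi(1,1)=1$. Such $\varphi$ extends uniquely to a continuous function on $[0,\infty)^2$, still denoted $\varphi$. Functional calculus: for positive $x_0,x_1$ in a quasi-Banach lattice, $\varphi(x_0,x_1)$ is defined by Krivine's functional calculus; concretely, the (non-closed) ideal generated by $e=x_0\vee x_1$ is lattice isomorphic to some $C(\Omega)$, $\Omega$ compact Hausdorff, with $e$ corresponding to $1_\Omega$, and $\varphi(x_0,x_1)$ corresponds to the function $\omega\mapsto\varphi(\hat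 x_0(\omega),\hat x_1(\omega))$. Calderón–Lozanovskii space: $\varphi(X_0,X_1)=\{x\in X_0+X_1:|x|\le\varphi(x_0,x_1)\text{ for some }x_0\in X_0^+,x_1\in X_1^+\}$, a quasi-Banach lattice with quasi-norm $\|x\|_{\varphi(X_0,X_1)}=\inf\{\lambda>0:|x|\le\lambda\varphi(x_0,x_1),\ x_i\in X_i^+,\ \|x_0\|_{X_0}\le1,\ \|x_1\|_{X_1}\le1\}$. $\varphi^0(X_0,X_1)$ is the closure of $X_0\cap X_1$ in $\varphi(X_0,X_1)$, with the quasi-norm of $\varphi(X_0,X_1)$. A linear operator $T:E\to F$ between quasi-Banach lattices is $(\infty,1)$-regular if there is $K>0$ with $\big\|\bigvee_{i=1}^n|Tx_i|\big\|\le K\big\|\sum_{i=1}^n|x_i|\big\|$ for all finite families $(x_i)_{i=1}^n\subset E$; $\rho_{\infty,1}(T)$ denotes the smallest such $K$. *)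

(* Defs.v *)
From HB Require Import structures.
From mathcomp Require Import all_boot all_order all_algebra.
From mathcomp Require Import all_classical all_reals all_analysis.

Set Implicit Arguments.
Unset Strict Implicit.
Unset Printing Implicit Defensive.

Import Order.TTheory GRing.Theory Num.Theory.
Import numFieldNormedType.Exports.

Local Open Scope classical_set_scope.
Local Open Scope ring_scope.

(* The lattice operations are new fields rather than those of [Order.Lattice]:
   Hierarchy Builder rejects the join of [Order.Lattice] and [GRing.Zmodule],
   which has [Num.RealDomain] already declared below it. *)
HB.mixin Record POrderedLmodule_isVectorLattice (R : numDomainType) V
    & GRing.Lmodule R V & Num.POrderedZmodule V := {
  vjoin : V -> V -> V ;
  vmeet : V -> V -> V ;
  vl_leD : forall z x y : V, x <= y -> x + z <= y + z ;
  vl_leZ : forall (a : R) (x y : V), 0 <= a -> x <= y -> a *: x <= a *: y ;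
  vjoin_le : forall x y z : V, (vjoin x y <= z) = (x <= z) && (y <= z) ;
  le_vmeet : forall x y z : V, (z <= vmeet x y) = (z <= x) && (z <= y)
}.

#[short(type="vectorLatticeType")]
HB.structure Definition VectorLattice (R : numDomainType) :=
  {V of GRing.Lmodule R V & Num.POrderedZmodule V
      & POrderedLmodule_isVectorLattice R V}.

Definition vabs (R : numDomainType) (V : vectorLatticeType R) (x : V) : V :=
  vjoin x (- x).

Definition solid (R : numDomainType) (V : vectorLatticeType R) (B : set V) :=
  forall x y : V, B y -> vabs x <= vabs y -> B x.

HB.mixin Record isLocallySolid (R : numDomainType) V
    & VectorLattice R V & TopologicalLmodule R V := {
  locally_solid : forall U : set V, nbhs (0 : V) U ->
    exists B : set V, [/\ nbhs (0 : V) B, solid B & B `<=` U]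
}.

#[short(type="locallySolidType")]
HB.structure Definition LocallySolid (R : numDomainType) :=
  {V of VectorLattice R V & TopologicalLmodule R V & isLocallySolid R V}.

(* Completeness is sequential, which is the same thing here: the topology of a
   quasi-norm is metrizable. *)
HB.mixin Record VectorLattice_isQuasiBanach (R : realType) V
    & VectorLattice R V := {
  qnorm : V -> R ;
  qnorm_ge0 : forall x, 0 <= qnorm x ;
  qnorm_eq0 : forall x, qnorm x = 0 -> x = 0 ;
  qnormZ : forall (a : R) x, qnorm (a *: x) = `|a| * qnorm x ;
  qnormD : exists2 C : R, 1 <= C &
    forall x y, qnorm (x + y) <= C * (qnorm x + qnorm y) ;
  le_qnorm : forall x y : V, vabs x <= vabs y -> qnorm x <= qnorm y ;
  qnorm_complete : forall u : nat -> V,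
    (forall e : R, 0 < e -> exists N : nat, forall m n : nat,
       (N <= m)%N -> (N <= n)%N -> qnorm (u m - u n) < e) ->
    exists l : V, (qnorm (u n - l) @[n --> \oo] --> (0 : R))
}.

#[short(type="quasiBanachLatticeType")]
HB.structure Definition QuasiBanachLattice (R : realType) :=
  {V of VectorLattice R V & VectorLattice_isQuasiBanach R V}.

Definition qcontinuous (R : realType) (E : quasiBanachLatticeType R)
    (X : locallySolidType R) (j : E -> X) :=
  forall (x : E) (U : set X), nbhs (j x) U ->
    exists2 d : R, 0 < d & forall y : E, qnorm (y - x) < d -> U (j y).

Record lattice_embedding (R : realType) (E : quasiBanachLatticeType R)
    (X : locallySolidType R) (j : {linear E -> X}) : Prop := {
  emb_join : {morph j : x y / vjoin x y} ;
  emb_meet : {morph j : x y / vmeet x y} ;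
  emb_inj : injective j ;
  emb_cont : qcontinuous j ;
  emb_interval : forall x : E, 0 <= x ->
    j @` [set y | 0 <= y <= x] = [set y | 0 <= y <= j x]
}.

Record compatible_pair (R : realType) (X0 X1 : quasiBanachLatticeType R)
    (X : locallySolidType R) (j0 : {linear X0 -> X}) (j1 : {linear X1 -> X})
    : Prop := {
  compatible_hausdorff : hausdorff_space X ;
  compatible_emb0 : lattice_embedding j0 ;
  compatible_emb1 : lattice_embedding j1
}.

Definition sum_space (R : realType) (X0 X1 : quasiBanachLatticeType R)
    (X : locallySolidType R) (j0 : X0 -> X) (j1 : X1 -> X) : set X :=
  [set x | exists (x0 : X0) (x1 : X1), x = j0 x0 + j1 x1].

Definition cap_space (R : realType) (X0 X1 : quasiBanachLatticeType R)
    (X : locallySolidType R) (j0 : X0 -> X) (j1 : X1 -> X) : set X :=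
  range j0 `&` range j1.

(* Only the values of [phi] on the open quadrant matter. *)
Record class_P (R : realType) (phi : R -> R -> R) : Prop := {
  class_P_ge0 : forall s t, 0 < s -> 0 < t -> 0 <= phi s t ;
  class_P_homog : forall l s t, 0 < l -> 0 < s -> 0 < t ->
    phi (l * s) (l * t) = l * phi s t ;
  class_P_ndecrl : forall s s' t, 0 < s -> s <= s' -> 0 < t ->
    phi s t <= phi s' t ;
  class_P_ndecrr : forall s t t', 0 < s -> 0 < t -> t <= t' ->
    phi s t <= phi s t' ;
  class_P_norm : phi 1 1 = 1
}.

(* The continuous extension of [phi] to the closed quadrant: for s, t >= 0, the
   points (s + e, t + e), e > 0, lie in the open quadrant and tend to (s, t). *)
Definition quadrant_ext (R : realType) (phi : R -> R -> R) (s t : R) : R :=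
  lim (phi (s + e) (t + e) @[e --> (0 : R)^'+]).

Definition principal_ideal (R : realType) (V : vectorLatticeType R) (S : set V)
    (e : V) : set V :=
  [set x | S x /\ exists c : R, vabs x <= c *: e].

Record CK_representation (R : realType) (V : vectorLatticeType R) (I : set V)
    (e : V) (Omega : topologicalType) (h : V -> Omega -> R) : Prop := {
  CK_bij : set_bij I [set f : Omega -> R | continuous f] h ;
  CK_linear : forall (a : R) x y w, I x -> I y ->
    h (a *: x + y) w = a * h x w + h y w ;
  CK_join : forall x y w, I x -> I y ->
    h (vjoin x y) w = Num.max (h x w) (h y w) ;
  CK_meet : forall x y w, I x -> I y ->
    h (vmeet x y) w = Num.min (h x w) (h y w) ;
  CK_unit : forall w, h e w = 1
}.

(* [krivine S phi x0 x1 z] means z = phi(x0, x1), computed in the vector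
   sublattice [S]. *)
Definition krivine (R : realType) (V : vectorLatticeType R) (S : set V)
    (phi : R -> R -> R) (x0 x1 z : V) : Prop :=
  let e := vjoin x0 x1 in
  let I := principal_ideal S e in
  exists (Omega : topologicalType) (h : V -> Omega -> R),
    [/\ compact [set: Omega], hausdorff_space Omega,
        CK_representation I e h,
        I z
      & forall w, h z w = quadrant_ext phi (h x0 w) (h x1 w)].

Definition CL_space (R : realType) (X0 X1 : quasiBanachLatticeType R)
    (X : locallySolidType R) (j0 : X0 -> X) (j1 : X1 -> X)
    (phi : R -> R -> R) : set X :=
  [set x | sum_space j0 j1 x /\ exists (x0 : X0) (x1 : X1) (z : X),
     [/\ 0 <= x0, 0 <= x1,
         krivine (sum_space j0 j1) phi (j0 x0) (j1 x1) z & vabs x <= z]].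

Definition CL_qnorm (R : realType) (X0 X1 : quasiBanachLatticeType R)
    (X : locallySolidType R) (j0 : X0 -> X) (j1 : X1 -> X)
    (phi : R -> R -> R) (x : X) : R :=
  inf [set l : R | 0 < l /\ exists (x0 : X0) (x1 : X1) (z : X),
     [/\ 0 <= x0 /\ 0 <= x1, qnorm x0 <= 1, qnorm x1 <= 1,
         krivine (sum_space j0 j1) phi (j0 x0) (j1 x1) z
       & vabs x <= l *: z]].

Definition CL0_space (R : realType) (X0 X1 : quasiBanachLatticeType R)
    (X : locallySolidType R) (j0 : X0 -> X) (j1 : X1 -> X)
    (phi : R -> R -> R) : set X :=
  [set x | CL_space j0 j1 phi x /\ forall e : R, 0 < e ->
     exists2 y, cap_space j0 j1 y & CL_qnorm j0 j1 phi (x - y) < e].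

Definition linear_on (R : realType) (V W : lmodType R) (S : set V)
    (T : V -> W) : Prop :=
  forall (a : R) x y, S x -> S y -> T (a *: x + y) = a *: T x + T y.

(* An operator between quasi-normed lattices is given by a function on larger
   vector lattices [V] and [W], by the domain [S], and by functions [nV] and
   [nW] whose values on the domain and codomain are the quasi-norms.  All the
   joined elements are >= 0, so starting the join at 0 only fixes its value for
   the empty family. *)
Definition regular_bound (R : realType) (V W : vectorLatticeType R)
    (S : set V) (nV : V -> R) (nW : W -> R) (T : V -> W) (K : R) : Prop :=
  forall (n : nat) (x : 'I_n -> V), (forall i, S (x i)) ->
    nW (\big[@vjoin R W/0]_(i < n) vabs (T (x i)))
      <= K * nV (\sum_(i < n) vabs (x i)).

Definition regular (R : realType) (V W : vectorLatticeType R)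
    (S : set V) (nV : V -> R) (nW : W -> R) (T : V -> W) : Prop :=
  exists2 K : R, 0 < K & regular_bound S nV nW T K.

Definition rho (R : realType) (V W : vectorLatticeType R)
    (S : set V) (nV : V -> R) (nW : W -> R) (T : V -> W) : R :=
  inf [set K : R | 0 < K /\ regular_bound S nV nW T K].

(* Main.v *)
(** Rescale a finite family in [X0 `&` X1] so that the sum of its moduli is at
    most phi(a, b), with a and b enlarged to dominate a multiple of that sum.
    Then only the truncation min(phi, L s, L t) matters, and it is equivalent to
    a maximum of finitely many functions min(alpha_k s, beta_k t), the nodes,
    where the alpha_k are distinct dyadic multiples of L and so are the beta_k.
    By Riesz decomposition, the family splits into pieces, each localized where
    one node dominates.  Dividing the k-th pieces by alpha_k (by beta_k) gives a
    family whose sum of moduli is at most 4 a (at most 4 b), so the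
    (infty,1)-regularity of T on X0 (on X1) bounds its image by one element A
    (one element B).  Hence |T x_i| is at most the sum over k of
    min(alpha_k A, beta_k B), which is at most 4 phi(A, B) as the nodes are
    lacunary.  The estimate passes to the closure of [X0 `&` X1] by
    telescoping.

    Inequalities involving phi(a, b) are checked pointwise on the real lattice
    characters of a principal ideal, which separate points by a Hahn-Banach
    argument; Kakutani's representation theorem, built on the same characters,
    provides phi(A, B). *)

Require Import Defs.
From mathcomp Require Import all_boot all_order all_algebra.
From mathcomp Require Import all_classical all_reals all_analysis.
From mathcomp Require Import ring lra zify.

Set Implicit Arguments.
Unset Strict Implicit.
Unset Printing Implicit Defensive.

Import Order.TTheory GRing.Theory Num.Theory.
Import numFieldNormedType.Exports.
Local Open Scope classical_set_scope.
Local Open Scope ring_scope.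

(** * Vector lattices *)

(** Three obstacles shape the proof. A quasi-Banach lattice offers neither convexity nor duality, so
    inequalities cannot be tested against functionals on the spaces; the characters live on
    principal ideals of the ambient lattice instead, where only the order and the Archimedean
    property enter. For the same reason countably many elements phi(a_n, b_n) are dominated by a
    single phi(A, B) only at the price of factors (2 C)^n, with C a common quasi-triangle constant;
    approximations that improve geometrically pay for this loss, and most powers of C in the final
    constant come from there. Finally, the bound must not depend on the number of nodes: regularity
    is applied once to all pieces of all members of the family together, which mere boundedness of T
    would not permit. The truncation level L depends on the family and exists only because the
    family lies in the intersection; the node estimates hold with the same constants for every L, so
    L disappears from the result. *)

Section VectorLattice.
Context {R : realType} {V : vectorLatticeType R}.
Implicit Types (x y z w : V) (a c : R).

Lemma vleZ a x y : 0 <= a -> x <= y -> a *: x <= a *: y.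
Proof. exact: vl_leZ. Qed.

Lemma vleD2r z x y : (x + z <= y + z) = (x <= y).
Proof.
apply/idP/idP => [|/(vl_leD z)//] /(vl_leD (- z)).
by rewrite !addrK.
Qed.

Lemma vleD2l z x y : (z + x <= z + y) = (x <= y).
Proof. by rewrite ![z + _]addrC vleD2r. Qed.

Lemma vsubr_ge0 x y : (0 <= y - x) = (x <= y).
Proof. by rewrite -(vleD2r x 0) add0r subrK. Qed.

Lemma vlerBlDr x y z : (x - y <= z) = (x <= z + y).
Proof. by rewrite -(vleD2r y (x - y)) subrK. Qed.

Lemma vlerBrDr x y z : (x <= y - z) = (x + z <= y).
Proof. by rewrite -(vleD2r z x) subrK. Qed.

Lemma vleD x y z w : x <= y -> z <= w -> x + z <= y + w.
Proof.
by move=> xy zw; apply: (@le_trans _ _ (y + z)); rewrite ?vleD2r ?vleD2l.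
Qed.

Lemma vleN x y : (- x <= - y) = (y <= x).
Proof. by rewrite -(vleD2r (x + y) (- x)) addKr addrC addrK. Qed.

Lemma vaddr_ge0 x y : 0 <= x -> 0 <= y -> 0 <= x + y.
Proof. by move=> ? ?; rewrite -[0]addr0; apply: vleD. Qed.

Lemma vscale_ge0 a x : 0 <= a -> 0 <= x -> 0 <= a *: x.
Proof. by move=> a0 /(vleZ a0); rewrite scaler0. Qed.

Lemma vleZ2l a x y : 0 < a -> (a *: x <= a *: y) = (x <= y).
Proof.
move=> a0; apply/idP/idP => [|]; last exact: vleZ (ltW a0).
by move/(@vleZ a^-1); rewrite !scalerK ?gt_eqF// => -> //; rewrite invr_ge0 ltW.
Qed.

Lemma vleZr a c x : 0 <= x -> a <= c -> a *: x <= c *: x.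
Proof. by move=> x0 ac; rewrite -vsubr_ge0 -scalerBl vscale_ge0// subr_ge0. Qed.

Lemma vsumr_ge0 (I : Type) (r : seq I) (P : pred I) (F : I -> V) :
  (forall i, P i -> 0 <= F i) -> 0 <= \sum_(i <- r | P i) F i.
Proof. by move=> h; elim/big_ind: _ => // x y; apply: vaddr_ge0. Qed.

Lemma vler_sum (I : Type) (r : seq I) (P : pred I) (F G : I -> V) :
  (forall i, P i -> F i <= G i) ->
  \sum_(i <- r | P i) F i <= \sum_(i <- r | P i) G i.
Proof. by move=> h; elim/big_ind2: _ => // x y z w; apply: vleD. Qed.

Lemma vle_sum1 n (F : 'I_n -> V) i :
  (forall j, 0 <= F j) -> F i <= \sum_(j < n) F j.
Proof.
by move=> h; rewrite (bigD1 i)//= -[leLHS]addr0 vleD2l vsumr_ge0.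
Qed.

Lemma vjoinl x y : x <= vjoin x y.
Proof. by have := lexx (vjoin x y); rewrite vjoin_le => /andP[]. Qed.
Lemma vjoinr x y : y <= vjoin x y.
Proof. by have := lexx (vjoin x y); rewrite vjoin_le => /andP[]. Qed.
Lemma vmeetl x y : vmeet x y <= x.
Proof. by have := lexx (vmeet x y); rewrite le_vmeet => /andP[]. Qed.
Lemma vmeetr x y : vmeet x y <= y.
Proof. by have := lexx (vmeet x y); rewrite le_vmeet => /andP[]. Qed.

Lemma vjoin_max x y : x <= y -> vjoin x y = y.
Proof. by move=> xy; apply/le_anti; rewrite vjoinr vjoin_le xy lexx. Qed.

Lemma vjoinD x y z : vjoin (x + z) (y + z) = vjoin x y + z.
Proof.
apply/le_anti; rewrite vjoin_le !vleD2r vjoinl vjoinr/=.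
by rewrite -vlerBrDr vjoin_le !vlerBrDr vjoinl vjoinr.
Qed.

Lemma vjoinZ a x y : 0 <= a -> vjoin (a *: x) (a *: y) = a *: vjoin x y.
Proof.
rewrite le_eqVlt => /orP[/eqP<-|a0]; first by rewrite !scale0r vjoin_max.
apply/le_anti; rewrite vjoin_le !vleZ2l// vjoinl vjoinr/=.
rewrite -(@vleZ2l a^-1) ?invr_gt0// scalerK ?gt_eqF// vjoin_le.
by apply/andP; split; rewrite -(@vleZ2l a)// scalerKV ?gt_eqF// ?vjoinl ?vjoinr.
Qed.

Lemma vmeetE x y : vmeet x y = - vjoin (- x) (- y).
Proof.
apply/le_anti/andP; split; first by rewrite -vleN opprK vjoin_le !vleN vmeetl vmeetr.
by rewrite le_vmeet; apply/andP; split; rewrite -vleN opprK ?vjoinl ?vjoinr.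
Qed.

Lemma vabs_le x y : (vabs x <= y) = (x <= y) && (- x <= y).
Proof. by rewrite vjoin_le. Qed.

Lemma vabs_ler x : x <= vabs x. Proof. exact: vjoinl. Qed.
Lemma vabs_leN x : - x <= vabs x. Proof. exact: vjoinr. Qed.

Lemma vabs_ge0 x : 0 <= vabs x.
Proof.
rewrite -(@vleZ2l 2)// scaler0 (_ : 2 *: vabs x = vabs x + vabs x).
  by rewrite -(subrr x) vleD// ?vabs_ler ?vabs_leN.
by rewrite scaler_nat mulr2n.
Qed.

Lemma vabs_pos x : 0 <= x -> vabs x = x.
Proof.
by move=> x0; apply/le_anti; rewrite vabs_ler vabs_le lexx (le_trans _ x0)// -oppr0 vleN.
Qed.

Lemma vabs_id x : vabs (vabs x) = vabs x.
Proof. by rewrite vabs_pos// vabs_ge0. Qed.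

Lemma vabs0 : vabs (0 : V) = 0. Proof. by rewrite vabs_pos. Qed.

Lemma vabsN x : vabs (- x) = vabs x.
Proof.
by rewrite /vabs opprK; apply/le_anti; rewrite !vjoin_le !vjoinl !vjoinr.
Qed.

Lemma vabsD x y : vabs (x + y) <= vabs x + vabs y.
Proof. by rewrite vabs_le opprD !vleD// ?vabs_ler ?vabs_leN. Qed.

Lemma vabsB x y : vabs (x - y) <= vabs x + vabs y.
Proof. by rewrite -[vabs y]vabsN vabsD. Qed.

Lemma vabsZ a x : vabs (a *: x) = `|a| *: vabs x.
Proof.
wlog a0 : a / 0 <= a => [hw|]; last by rewrite /vabs -scalerN vjoinZ ?ger0_norm.
have [/hw//|/ltW a0] := leP 0 a.
by rewrite -vabsN -scaleNr hw ?oppr_ge0// normrN.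
Qed.

Lemma vabs_sum (I : Type) (r : seq I) (P : pred I) (F : I -> V) :
  vabs (\sum_(i <- r | P i) F i) <= \sum_(i <- r | P i) vabs (F i).
Proof.
elim/big_ind2: _ => [|x y z w xy zw|//]; first by rewrite vabs0.
by rewrite (le_trans (vabsD _ _))// vleD.
Qed.

Definition vpos x := vjoin x 0.

Lemma vpos_ge0 x : 0 <= vpos x. Proof. exact: vjoinr. Qed.

Lemma vposB x : x = vpos x - vpos (- x).
Proof.
apply/eqP; rewrite eq_sym subr_eq; apply/eqP.
by rewrite addrC /vpos -vjoinD addNr add0r -{1}[x]add0r; apply/le_anti; rewrite !vjoin_le ?add0r !vjoinl !vjoinr.
Qed.

Lemma vabs_vpos x : vabs x = vpos x + vpos (- x).
Proof.
have : vabs x + x = vpos x + vpos x.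
  have h v : v + v = 2 *: v :> V by rewrite scaler_nat mulr2n.
  by rewrite -vjoinD addNr !h -vjoinZ// scaler0.
move=> h; apply: (addIr x); rewrite h -addrA; congr (_ + _).
by have /eqP := vposB x; rewrite eq_sym subr_eq addrC => /eqP.
Qed.

(** Cut off [vmeet x (w ord0)] and recurse: the remainder is the positive part of x - w 0, which the
    sum of the other w k dominates. *)
Lemma riesz_pos m (w : 'I_m -> V) x :
  0 <= x -> (forall k, 0 <= w k) -> x <= \sum_(k < m) w k ->
  exists p : 'I_m -> V, [/\ forall k, 0 <= p k, forall k, p k <= w k
    & x = \sum_(k < m) p k].
Proof.
elim: m w x => [|m IH] w x x0 w0.
  rewrite big_ord0 => x1; exists (fun=> 0); split => //.
  by rewrite big_ord0; apply/le_anti; rewrite x0 x1.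
rewrite big_ord_recl => xw.
pose p0 := vmeet x (w ord0).
have [||| p [pge ple pE]] := IH (fun k => w (lift ord0 k)) (x - p0) => //.
- by rewrite vsubr_ge0 vmeetl.
- rewrite /p0 vmeetE opprK addrC -vjoinD vjoin_le addNr vsumr_ge0//= addrC.
  by rewrite vlerBlDr addrC.
exists (fun k => if unlift ord0 k is Some l then p l else p0); split => [k|k|].
- case: unliftP => [l _|_]; first exact: pge.
  by rewrite le_vmeet x0 w0.
- by case: unliftP => [l ->|->]; [exact: ple|rewrite vmeetr].
- rewrite big_ord_recl unlift_none (eq_bigr p) => [|k _]; last by rewrite liftK.
  by rewrite -pE addrC subrK.
Qed.

(** Splitting each x i separately would bound only single pieces. Here the positive and then the
    negative part of the first element are charged to the budgets w k, and the other elements share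
    what is left, w k - p k - q k. *)
Lemma riesz_family n m (x : 'I_n -> V) (w : 'I_m -> V) :
  (forall k, 0 <= w k) -> \sum_(i < n) vabs (x i) <= \sum_(k < m) w k ->
  exists y : 'I_n -> 'I_m -> V, (forall i, x i = \sum_(k < m) y i k) /\
    forall k, \sum_(i < n) vabs (y i k) <= w k.
Proof.
elim: n x w => [|n IH] x w w0 xw.
  exists (fun _ _ => 0); split=> [[]//|k]; by rewrite big_ord0.
rewrite big_ord_recl vabs_vpos in xw.
set S := \sum_(i < n) _ in xw.
have S0 : 0 <= S by apply: vsumr_ge0 => i _; exact: vabs_ge0.
have [|p [p0 pw pE]] := riesz_pos (vpos_ge0 (x ord0)) w0.
  by rewrite (le_trans _ xw)// -addrA -[leLHS]addr0 vleD2l vaddr_ge0 ?vpos_ge0.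
have [k||q [q0 qw qE]] := riesz_pos (w := fun k => w k - p k) (vpos_ge0 (- x ord0)).
- by rewrite vsubr_ge0.
- rewrite big_split/= sumrN -pE vlerBrDr (le_trans _ xw)// [vpos _ + vpos _]addrC.
  by rewrite -[leLHS]addr0 vleD2l.
have [k||y [xE yw]] := IH (fun i => x (lift ord0 i)) (fun k => w k - p k - q k).
- by rewrite vsubr_ge0.
- by rewrite !big_split/= !sumrN -pE -qE !vlerBrDr -addrA addrC [vpos _ + vpos _]addrC.
exists (fun i k => if unlift ord0 i is Some l then y l k else p k - q k); split.
- move=> i; case: unliftP => [l ->|->]; first exact: xE.
  by rewrite big_split/= sumrN -pE -qE -vposB.
- move=> k; rewrite big_ord_recl unlift_none.
  under eq_bigr do rewrite liftK.
  have -> : w k = p k + q k + (w k - p k - q k) by rewrite -[_ - q k]addrA -opprD [RHS]addrC subrK.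
  apply: vleD; last exact: yw.
  by rewrite (le_trans (vabsB _ _))// !vabs_pos.
Qed.

Lemma vle_bigjoin n (F : 'I_n -> V) z :
  (\big[@vjoin R V/0]_(i < n) F i <= z) <-> (0 <= z /\ forall i, F i <= z).
Proof.
elim: n F => [|n IH] F; first by rewrite big_ord0; split=> [z0|[]//]; split=> // -[].
rewrite big_ord_recl vjoin_le; split=> [/andP[F0 /IH[z0 h]]|[z0 h]].
  by split=> // i; case: (unliftP ord0 i) => [j ->|->].
by apply/andP; split; [|apply/IH; split].
Qed.

Lemma bigjoin_ge0 n (F : 'I_n -> V) : 0 <= \big[@vjoin R V/0]_(i < n) F i.
Proof. by have /vle_bigjoin[] := lexx (\big[@vjoin R V/0]_(i < n) F i). Qed.

Lemma le_bigjoin n (F : 'I_n -> V) i : F i <= \big[@vjoin R V/0]_(j < n) F j.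
Proof. by have /vle_bigjoin[] := lexx (\big[@vjoin R V/0]_(i < n) F i). Qed.

(** The order ideal in the whole lattice; for e >= 0 in the sum space it agrees with
    [principal_ideal], by [sum_principal]. *)
Definition ideal (e : V) : set V := [set x | exists c : R, vabs x <= c *: e].

Lemma ideal_pos (e x : V) : 0 <= e -> ideal e x ->
  exists2 c : R, 0 < c & vabs x <= c *: e.
Proof.
move=> e0 [c xc]; exists (Num.max c 1); first by rewrite lt_max ltr01 orbT.
by rewrite (le_trans xc)// vleZr// le_max lexx.
Qed.

Lemma ideal_le (e x y : V) : vabs x <= vabs y -> ideal e y -> ideal e x.
Proof. by move=> xy [c yc]; exists c; exact: le_trans yc. Qed.

Lemma ideal_self (e : V) : 0 <= e -> ideal e e.
Proof. by move=> e0; exists 1; rewrite scale1r vabs_pos. Qed.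

Lemma ideal0 (e : V) : ideal e 0.
Proof. by exists 0; rewrite scale0r vabs0. Qed.

Lemma idealD (e x y : V) : ideal e x -> ideal e y -> ideal e (x + y).
Proof.
move=> [c xc] [d yd]; exists (c + d).
by rewrite scalerDl (le_trans (vabsD _ _))// vleD.
Qed.

Lemma idealZ (e : V) a x : ideal e x -> ideal e (a *: x).
Proof.
move=> [c xc]; exists (`|a| * c).
by rewrite vabsZ -scalerA; apply: vleZ.
Qed.

Lemma idealN (e x : V) : ideal e x -> ideal e (- x).
Proof. by apply: ideal_le; rewrite vabsN. Qed.

Lemma idealB (e x y : V) : ideal e x -> ideal e y -> ideal e (x - y).
Proof. by move=> ? /idealN; apply: idealD. Qed.

Lemma ideal_join (e x y : V) : ideal e x -> ideal e y -> ideal e (vjoin x y).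
Proof.
move=> ix iy; apply: (@ideal_le _ _ (vabs x + vabs y)); last first.
  by apply: idealD; [apply: ideal_le ix|apply: ideal_le iy]; rewrite vabs_id.
rewrite [leRHS]vabs_pos ?vaddr_ge0 ?vabs_ge0// vabs_le vjoin_le.
rewrite -!andbA; apply/and3P; split.
- by rewrite -[leLHS]addr0 vleD ?vabs_ler ?vabs_ge0.
- by rewrite -[leLHS]add0r vleD ?vabs_ler ?vabs_ge0.
- by rewrite (@le_trans _ _ (- x)) ?vleN ?vjoinl// -[leLHS]addr0 vleD ?vabs_leN ?vabs_ge0.
Qed.

Lemma ideal_meet (e x y : V) : ideal e x -> ideal e y -> ideal e (vmeet x y).
Proof. by move=> ? ?; rewrite vmeetE; apply/idealN/ideal_join; apply: idealN. Qed.

Lemma ideal_abs (e x : V) : ideal e x -> ideal e (vabs x).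
Proof. by apply: ideal_le; rewrite vabs_id. Qed.

Lemma ideal_sum (e : V) (I : Type) (r : seq I) (P : pred I) (F : I -> V) :
  (forall i, P i -> ideal e (F i)) -> ideal e (\sum_(i <- r | P i) F i).
Proof. by move=> h; elim/big_ind: _ => //; [exact: ideal0|exact: idealD]. Qed.

Lemma ideal_bigjoin (e : V) n (F : 'I_n -> V) :
  (forall i, ideal e (F i)) -> ideal e (\big[@vjoin R V/0]_(i < n) F i).
Proof. by move=> h; elim/big_ind: _ => //; [exact: ideal0|exact: ideal_join]. Qed.

Lemma ideal_between (e x y : V) : 0 <= x -> x <= y -> ideal e y -> ideal e x.
Proof. by move=> x0 xy; apply: ideal_le; rewrite !vabs_pos// (le_trans x0). Qed.

Lemma ideal_trans (e e' x : V) : 0 <= e -> ideal e' e -> ideal e x -> ideal e' x.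
Proof.
move=> e0 ie /(ideal_pos e0) [c c0 xc]; apply: (@ideal_le _ _ (c *: e)).
  by rewrite (le_trans xc)// vabs_ler.
exact: idealZ.
Qed.

End VectorLattice.

#[export] Hint Resolve ideal0 ideal_self idealD idealN idealB idealZ ideal_join
  ideal_meet ideal_abs : ideal.

(** * Characters of principal ideals *)

Definition archimedean (R : realType) (V : vectorLatticeType R) :=
  forall x e : V, (forall d : R, 0 < d -> x <= d *: e) -> x <= 0.

(** A function on all of V, so that the characters form a subset of a product of copies of R; the
    value 0 off the ideal makes a character determined by its restriction to the ideal. *)
Record character (R : realType) (V : vectorLatticeType R) (e : V) (w : V -> R)
    : Prop := {
  char_lin : forall a x y, ideal e x -> ideal e y ->
    w (a *: x + y) = a * w x + w y ;
  char_join : forall x y, ideal e x -> ideal e y ->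
    w (vjoin x y) = Num.max (w x) (w y) ;
  char_unit : w e = 1 ;
  char_out : forall x, ~ ideal e x -> w x = 0
}.

Section CharacterTheory.
Context {R : realType} {V : vectorLatticeType R} {e : V} {w : V -> R}.
Hypothesis hw : character e w.
Implicit Types (x y : V) (a : R).

Lemma char0 : w 0 = 0.
Proof.
have := char_lin hw 1 (ideal0 e) (ideal0 e).
by rewrite scaler0 addr0 mul1r => /eqP; rewrite -subr_eq subrr => /eqP.
Qed.

Lemma charD x y : ideal e x -> ideal e y -> w (x + y) = w x + w y.
Proof. by move=> ix iy; rewrite -[x]scale1r (char_lin hw)// mul1r scale1r. Qed.

Lemma charZ a x : ideal e x -> w (a *: x) = a * w x.
Proof. by move=> ix; rewrite -[a *: x]addr0 (char_lin hw) ?char0 ?addr0//; exact: ideal0. Qed.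

Lemma charN x : ideal e x -> w (- x) = - w x.
Proof. by move=> ix; rewrite -scaleN1r charZ// mulN1r. Qed.

Lemma charB x y : ideal e x -> ideal e y -> w (x - y) = w x - w y.
Proof. by move=> ix iy; rewrite charD ?charN//; exact: idealN. Qed.

Lemma char_meet x y : ideal e x -> ideal e y -> w (vmeet x y) = Num.min (w x) (w y).
Proof.
move=> ix iy; rewrite vmeetE charN ?(char_join hw) ?charN//; auto with ideal.
by rewrite oppr_max !opprK.
Qed.

Lemma char_abs x : ideal e x -> w (vabs x) = `|w x|.
Proof. by move=> ix; rewrite (char_join hw) ?charN ?maxrN//; exact: idealN. Qed.

Lemma char_ge0 x : 0 <= x -> ideal e x -> 0 <= w x.
Proof. by move=> x0 ix; rewrite -(vabs_pos x0) char_abs. Qed.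

Lemma char_le x y : ideal e x -> ideal e y -> x <= y -> w x <= w y.
Proof.
move=> ix iy; rewrite -vsubr_ge0 => /char_ge0; rewrite charB// subr_ge0.
by apply; exact: idealB.
Qed.

Lemma char_sum (I : Type) (r : seq I) (F : I -> V) :
  (forall i, ideal e (F i)) -> w (\sum_(i <- r) F i) = \sum_(i <- r) w (F i).
Proof.
move=> h; elim: r => [|i r IH]; first by rewrite !big_nil char0.
by rewrite !big_cons charD ?IH//; apply: ideal_sum.
Qed.

Lemma char_bigjoin n (F : 'I_n -> V) : (forall i, ideal e (F i)) ->
  w (\big[@vjoin R V/0]_(i < n) F i) = \big[Num.max/0]_(i < n) w (F i).
Proof.
elim: n F => [|n IH] F h; first by rewrite !big_ord0 char0.
by rewrite !big_ord_recl (char_join hw) ?IH//; apply: ideal_bigjoin.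
Qed.

End CharacterTheory.

(** * Hahn-Banach separation by lattice characters *)

Section Separation.
Context {R : realType} {V : vectorLatticeType R} {e : V}.
Hypothesis e0 : 0 <= e.
Implicit Types (x y z : V) (p q : V -> R).

(** Sublinear functionals that preserve finite joins, so that a linear one is a lattice
    homomorphism. The conditions at e and - e force the value 1 at e once the functional is linear;
    the value 0 off the ideal makes comparison on the ideal antisymmetric. *)
Record gauge p : Prop := {
  gauge_sub : forall x y, ideal e x -> ideal e y -> p (x + y) <= p x + p y ;
  gauge_hom : forall a x, 0 < a -> ideal e x -> p (a *: x) <= a * p x ;
  gauge_join : forall x y, ideal e x -> ideal e y ->
    p (vjoin x y) = Num.max (p x) (p y) ;
  gauge_unit : p e <= 1 ;
  gauge_unitN : p (- e) <= -1 ;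
  gauge_out : forall x, ~ ideal e x -> p x = 0
}.

Lemma gauge_homE p a x : gauge p -> 0 < a -> ideal e x -> p (a *: x) = a * p x.
Proof.
move=> gp a0 ix; apply/le_anti; rewrite (gauge_hom gp)//=.
rewrite -ler_pdivlMl//; have := gauge_hom gp (a := a^-1) (x := a *: x).
by rewrite scalerK ?gt_eqF// invr_gt0; apply=> //; exact: idealZ.
Qed.

Lemma gauge0 p : gauge p -> p 0 = 0.
Proof.
move=> gp; have := gauge_homE gp (ltr0Sn R 1) (ideal0 e).
by rewrite scaler0; lra.
Qed.

Lemma gauge_oppr p x : gauge p -> ideal e x -> - p (- x) <= p x.
Proof.
move=> gp ix; have := gauge_sub gp ix (idealN ix).
by rewrite subrr gauge0//; lra.
Qed.

Definition infimum (F : set (V -> R)) x : R :=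
  if `[< ideal e x >] then inf [set f x | f in F] else 0.

Section Infimum.
Variable F : set (V -> R).
Hypothesis F0 : F !=set0.
Hypothesis F_lb : forall x, ideal e x -> exists m, forall f, F f -> m <= f x.

Lemma infimumE x : ideal e x -> infimum F x = inf [set f x | f in F].
Proof. by move=> ix; rewrite /infimum asboolT. Qed.

Lemma infimum_le f x : F f -> ideal e x -> infimum F x <= f x.
Proof.
move=> Ff ix; rewrite infimumE//; apply: ge_inf; last by exists f.
by have [m mF] := F_lb ix; exists m => _ [g Fg <-]; exact: mF.
Qed.

Lemma le_infimum m x : ideal e x -> (forall f, F f -> m <= f x) ->
  m <= infimum F x.
Proof.
move=> ix h; rewrite infimumE//; apply: lb_le_inf.
  by have [f Ff] := F0; exists (f x), f.
by move=> _ [f Ff <-]; exact: h.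
Qed.

Lemma infimum_adherent d x : ideal e x -> 0 < d ->
  exists2 f, F f & f x < infimum F x + d.
Proof.
move=> ix d0; apply/exists2P; apply: contrapT => /forallNP h.
suff : infimum F x + d <= infimum F x by lra.
apply: le_infimum => // f Ff; rewrite leNgt; apply/negP => hf.
exact: (h f).
Qed.

Hypothesis F_dir : forall f g, F f -> F g -> exists2 h, F h &
  forall x, ideal e x -> h x <= f x /\ h x <= g x.
Hypothesis F_sub : forall f g, F f -> F g -> exists2 h, F h &
  forall x y, ideal e x -> ideal e y -> h (x + y) <= f x + g y.
Hypothesis F_hom : forall f a, F f -> 0 < a -> exists2 h, F h &
  forall x, ideal e x -> h (a *: x) <= a * f x.
Hypothesis F_join : forall f x y, F f -> ideal e x -> ideal e y ->
  f (vjoin x y) = Num.max (f x) (f y).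
Hypothesis F_unit : exists2 f, F f & f e <= 1.
Hypothesis F_unitN : exists2 f, F f & f (- e) <= -1.

(** Infima need not commute with joins. Directedness repairs this: if f nearly attains the infimum
    at x and g at y, some h in F lies below both, and h (vjoin x y) <= max (f x, g y). *)
Lemma gauge_infimum : gauge (infimum F).
Proof.
split.
- move=> x y ix iy; apply/ler_addgt0Pr => d d0.
  have d2 : 0 < d / 2 by lra.
  have [f Ff fx] := infimum_adherent ix d2.
  have [g Fg gy] := infimum_adherent iy d2.
  have [h Fh hxy] := F_sub Ff Fg.
  by have := infimum_le Fh (idealD ix iy); have := hxy x y ix iy; lra.
- move=> a x a0 ix; rewrite -ler_pdivrMl//; apply: le_infimum => // f Ff.
  rewrite ler_pdivrMl//; have [h Fh hf] := F_hom Ff a0.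
  exact: le_trans (infimum_le Fh (idealZ a ix)) (hf x ix).
- move=> x y ix iy; have ij := ideal_join ix iy; apply/le_anti/andP; split.
    apply/ler_addgt0Pr => d d0.
    have [f Ff fx] := infimum_adherent ix d0.
    have [g Fg gy] := infimum_adherent iy d0.
    have [h Fh hfg] := F_dir Ff Fg.
    apply: (le_trans (infimum_le Fh ij)); rewrite F_join// ge_max.
    have [hx _] := hfg x ix; have [_ hy] := hfg y iy.
    have := le_max (infimum F x) (infimum F x) (infimum F y); rewrite lexx /= => h1.
    have := le_max (infimum F y) (infimum F x) (infimum F y); rewrite lexx orbT => h2.
    by apply/andP; split; lra.
  rewrite ge_max; apply/andP; split; apply: le_infimum => // f Ff; rewrite F_join//.
    by rewrite (le_trans (infimum_le Ff ix))// le_max lexx.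
  by rewrite (le_trans (infimum_le Ff iy))// le_max lexx orbT.
- by have [f Ff] := F_unit; apply: le_trans; exact: infimum_le (ideal_self e0).
- by have [f Ff] := F_unitN; apply: le_trans; exact: infimum_le (idealN (ideal_self e0)).
- by move=> x nix; rewrite /infimum asboolF.
Qed.

End Infimum.

(* The step of the Hahn-Banach theorem; it also preserves finite joins because
   [t |-> p (y + t x) - t p x] is non-increasing, so that the infimum over [t]
   is a directed one. *)
Lemma gauge_step p x : gauge p -> ideal e x -> exists q,
  [/\ gauge q, forall y, ideal e y -> q y <= p y & q (- x) <= - p x].
Proof.
move=> gp ix.
pose f (t : R) y := p (y + t *: x) - t * p x.
pose F : set (V -> R) := [set f t | t in [set t | 0 <= t]].
have ixt t : ideal e (t *: x) by exact: idealZ.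
have fS t s y z : ideal e y -> ideal e z -> f (t + s) (y + z) <= f t y + f s z.
  move=> iy iz; rewrite /f scalerDl addrACA mulrDl.
  by have := gauge_sub gp (idealD iy (ixt t)) (idealD iz (ixt s)); lra.
have ft0 t : 0 <= t -> f t 0 <= 0.
  rewrite /f add0r le_eqVlt => /orP[/eqP<-|t0].
    by rewrite scale0r gauge0// mul0r subrr.
  by rewrite gauge_homE// subrr.
have fle t s y : ideal e y -> 0 <= s -> f (t + s) y <= f t y.
  move=> iy s0; have := fS t s y 0 iy (ideal0 e); have := ft0 s s0.
  by rewrite addr0; lra.
have F_lb y : ideal e y -> exists m, forall g, F g -> m <= g y.
  move=> iy; exists (- p (- y)) => _ [t /= t0 <-].
  have := fS 0 t (- y) y (idealN iy) iy; rewrite addNr add0r.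
  have -> : f 0 (- y) = p (- y) by rewrite /f scale0r addr0 mul0r subr0.
  have : 0 <= f t 0.
    rewrite /f add0r; move: t0; rewrite le_eqVlt => /orP[/eqP<-|t0].
      by rewrite scale0r gauge0// mul0r subrr.
    by rewrite gauge_homE// subrr.
  by lra.
have Ff t : 0 <= t -> F (f t) by move=> t0; exists t.
have f0E y : f 0 y = p y by rewrite /f scale0r addr0 mul0r subr0.
exists (infimum F); split.
- apply: gauge_infimum => //.
  + by exists (f 0); apply: Ff.
  + move=> _ _ [t t0 <-] [s s0 <-]; exists (f (t + s)); first exact/Ff/addr_ge0.
    by move=> y iy; rewrite fle// addrC fle.
  + move=> _ _ [t t0 <-] [s s0 <-]; exists (f (t + s)); first exact/Ff/addr_ge0.
    by move=> y z iy iz; exact: fS.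
  + move=> _ a [t t0 <-] a0; exists (f (a * t)); first exact/Ff/mulr_ge0/t0/ltW.
    move=> y iy; rewrite /f -scalerA -scalerDr -mulrA mulrBr lerD2r.
    by apply: (gauge_hom gp) => //; exact: idealD.
  + move=> _ y z [t t0 <-] iy iz; rewrite /f -vjoinD (gauge_join gp); auto with ideal.
    by rewrite addr_maxl.
  + by exists (f 0); [exact: Ff|rewrite f0E (gauge_unit gp)].
  + by exists (f 0); [exact: Ff|rewrite f0E (gauge_unitN gp)].
- by move=> y iy; rewrite -f0E; apply: infimum_le => //; exact: Ff.
- apply: (@le_trans _ _ (f 1 (- x))); last by rewrite /f scale1r addNr gauge0// mul1r sub0r.
  by apply: infimum_le; [exact: F_lb|exact: Ff|exact: idealN].
Qed.

(** Zorn's lemma for the reversed pointwise order; a nonempty chain is directed, so its pointwise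
    infimum is again a gauge. *)
Lemma gauge_minimal q : gauge q -> exists p,
  [/\ gauge p, forall x, ideal e x -> p x <= q x &
      forall r, gauge r -> (forall x, ideal e x -> r x <= p x) -> r = p].
Proof.
move=> gq; pose T := {p | gauge p /\ forall x, ideal e x -> p x <= q x}.
pose rle (s t : T) := `[< forall x, ideal e x -> sval t x <= sval s x >].
have [||| A totA|[p [gp pq]] pmin] := @Zorn T rle.
- by move=> t; apply/asboolP.
- by move=> r s t /asboolP rs /asboolP st; apply/asboolP => x ix; exact: le_trans (st _ ix) (rs _ ix).
- move=> [s [gs sq]] [t [gt tq]] /asboolP/= st /asboolP/= ts; apply: eq_exist; apply/funext => x.
  have [ix|ix] := pselect (ideal e x); first by apply/le_anti; rewrite st ?ts.
  by rewrite (gauge_out gs) ?(gauge_out gt).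
- have [[t0 At0]|A0] := pselect (A !=set0); last first.
    by exists (exist _ q (conj gq (fun x _ => lexx _))) => s As; exfalso; apply: A0; exists s.
  pose F : set (V -> R) := [set sval t | t in A].
  have gF f : F f -> gauge f by move=> [[t [gt tq]] /= _ <-].
  have F_dir f g : F f -> F g -> exists2 h, F h &
      forall x, ideal e x -> h x <= f x /\ h x <= g x.
    move=> [s As <-] [t At <-]; have [/asboolP st|/asboolP ts] := totA _ _ As At.
      by exists (sval t) => [|x ix]; [exists t|split; [exact: st|]].
    by exists (sval s) => [|x ix]; [exists s|split; [|exact: ts]].
  have F_lb x : ideal e x -> exists m, forall f, F f -> m <= f x.
    (* For h below f and t0, sublinearity gives f x >= h x >= - h (- x) >= - t0 (- x). *)
    move=> ix; exists (- sval t0 (- x)) => f Ff.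
    have [h Fh hle] := F_dir _ _ Ff (ex_intro2 _ _ t0 At0 erefl).
    have [_ h1] := hle _ (idealN ix); have [h2 _] := hle _ ix.
    by have := gauge_oppr (gF _ Fh) ix; lra.
  have F0 : F !=set0 by exists (sval t0), t0.
  have Ft0 : F (sval t0) by exists t0.
  have gI : gauge (infimum F).
    apply: gauge_infimum => //.
    + move=> f g Ff Fg; have [h Fh hfg] := F_dir _ _ Ff Fg; exists h => // x y ix iy.
      apply: (le_trans (gauge_sub (gF _ Fh) ix iy)).
      by apply: lerD; [have [] := hfg x ix|have [] := hfg y iy].
    + by move=> f a Ff a0; exists f => // x ix; exact: gauge_hom (gF _ Ff) _ _ a0 ix.
    + by move=> f x y /gF gf ix iy; exact: gauge_join.
    + by exists (sval t0) => //; exact: gauge_unit (gF _ Ft0).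
    + by exists (sval t0) => //; exact: gauge_unitN (gF _ Ft0).
  have Iq x : ideal e x -> infimum F x <= q x.
    move=> ix; apply: (le_trans (infimum_le F_lb Ft0 ix)).
    by case: (t0) => t [gt tq]; exact: tq.
  exists (exist _ (infimum F) (conj gI Iq)) => s As; apply/asboolP => x ix /=.
  by apply: infimum_le => //; exists s.
- exists p; split => // r gr rp.
  have rq x : ideal e x -> r x <= q x by move=> ix; exact: le_trans (rp x ix) (pq x ix).
  have := pmin (exist _ r (conj gr rq)).
  by move=> /(_ (asboolT rp))/(congr1 sval).
Qed.

(** Below a minimal gauge p, [gauge_step] puts another one with value at most - p x at - x; by
    minimality it is p itself. So p is odd, and an odd sublinear functional is linear. *)
Lemma gauge_character q : gauge q -> exists2 p, character e p &
  forall x, ideal e x -> p x <= q x.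
Proof.
move=> gq; have [p [gp pq pmin]] := gauge_minimal gq.
have pN x : ideal e x -> p (- x) = - p x.
  move=> ix; have [r [gr rp rN]] := gauge_step gp ix.
  rewrite (pmin r gr rp) in rN; apply/le_anti; rewrite rN/=.
  by have := gauge_oppr gp ix; lra.
have pD x y : ideal e x -> ideal e y -> p (x + y) = p x + p y.
  move=> ix iy; apply/le_anti; rewrite (gauge_sub gp)//=.
  have := gauge_sub gp (idealN ix) (idealN iy).
  by rewrite -opprD !pN//; [lra|exact: idealD].
have pZ a x : ideal e x -> p (a *: x) = a * p x.
  move=> ix; have [a0|a0|->] := ltrgt0P a; first exact: gauge_homE.
    rewrite -[a]opprK scaleNr pN ?(gauge_homE gp) ?oppr_gt0 ?mulNr//.
    exact: idealZ.
  by rewrite scale0r mul0r gauge0.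
exists p => //; split.
- by move=> a x y ix iy; rewrite pD ?pZ//; exact: idealZ.
- exact: gauge_join.
- apply/le_anti; rewrite (gauge_unit gp)/=.
  by have := gauge_unitN gp; rewrite pN; [lra|exact: ideal_self].
- exact: gauge_out.
Qed.

(** The functional inf {c | x <= c e}. For e = 0 the admissible c have no lower bound. Without the
    Archimedean property the infimum need not be attained, hence the strict inequality in one
    direction. *)
Lemma gauge_top : e != 0 -> exists2 q, gauge q &
  forall x c, ideal e x -> (q x < c -> x <= c *: e) /\ (x <= c *: e -> q x <= c).
Proof.
move=> en0.
pose S x := [set c : R | x <= c *: e].
have S0 x : ideal e x -> S x !=set0.
  by move=> [c xc]; exists c; exact: le_trans (vabs_ler x) xc.
have ecd c d : c *: e <= d *: e -> c <= d.
  move=> cd; rewrite leNgt; apply/negP => dc.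
  suff : e <= 0 by move=> e1; move: en0; rewrite (_ : e = 0) ?eqxx//; apply/le_anti; rewrite e0 e1.
  have h : 0 < c - d by lra.
  by rewrite -(vleZ2l _ _ h) scaler0 scalerBl -(vleD2r (d *: e)) subrK add0r.
have Slb x : ideal e x -> has_lbound (S x).
  move=> [c xc]; exists (- c) => d /= xd; apply: ecd.
  rewrite scaleNr; apply: (le_trans _ xd).
  by rewrite -vleN opprK; exact: le_trans (vabs_leN x) xc.
pose q x := if `[< ideal e x >] then inf (S x) else 0.
have qE x : ideal e x -> q x = inf (S x) by move=> ix; rewrite /q asboolT.
have q1 x c : ideal e x -> x <= c *: e -> q x <= c.
  by move=> ix xc; rewrite qE//; apply: ge_inf => //; exact: Slb.
have q2 x c : ideal e x -> q x < c -> x <= c *: e.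
  move=> ix; rewrite qE// => xc.
  have [d Sd dc] := inf_adherent (eps := c - inf (S x)) (ltac:(lra)) (conj (S0 _ ix) (Slb _ ix)).
  by apply: (le_trans Sd); apply: vleZr => //; lra.
have q3 x m : ideal e x -> (forall c, x <= c *: e -> m <= c) -> m <= q x.
  by move=> ix h; rewrite qE//; apply: lb_le_inf; [exact: S0|move=> c; exact: h].
exists q; last by move=> x c ix; split; [exact: q2|exact: q1].
split.
- move=> x y ix iy; apply/ler_addgt0Pr => d d0; apply: q1; first exact: idealD.
  rewrite (_ : _ + d = (q x + d / 2) + (q y + d / 2)); last by lra.
  by rewrite scalerDl vleD// q2//; lra.
- move=> a x a0 ix; rewrite -ler_pdivrMl//; apply: q3 => // c xc.
  rewrite ler_pdivrMl//; apply: q1; first exact: idealZ.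
  by rewrite -scalerA vleZ2l.
- move=> x y ix iy; have ij := ideal_join ix iy; apply/le_anti/andP; split.
    apply/ler_addgt0Pr => d d0; apply: q1 => //; rewrite vjoin_le.
    by rewrite !q2//= ltr_pwDr// le_max lexx ?orbT.
  rewrite ge_max; apply/andP; split; apply: q3 => // c; rewrite vjoin_le => /andP[? ?]; exact: q1.
- by apply: q1; [exact: ideal_self|rewrite scale1r].
- by apply: q1; [exact/idealN/ideal_self|rewrite scaleN1r].
- by move=> x nix; rewrite /q asboolF.
Qed.

Hypothesis arch : archimedean V.

(** If x - y is not below 0, the Archimedean property makes q (x - y) positive for the q of
    [gauge_top]. A gauge r below q with r (y - x) <= - q (x - y), and then a character w below r,
    give w y < w x. *)
Lemma char_leP x y : ideal e x -> ideal e y ->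
  (forall w, character e w -> w x <= w y) -> x <= y.
Proof.
move=> ix iy h; rewrite -vsubr_ge0 -vleN oppr0 opprB.
have ixy := idealB ix iy; apply: contrapT => nxy.
have en0 : e != 0.
  apply/eqP => ee; apply: nxy; have [c] := ixy; rewrite ee scaler0.
  exact: le_trans (vabs_ler _).
have [q gq qP] := gauge_top en0.
have q0 : 0 < q (x - y).
  rewrite ltNge; apply/negP => q0; apply: nxy; apply: (arch (e := e)) => d d0.
  by have [+ _] := qP (x - y) d ixy; apply; exact: le_lt_trans q0 d0.
have [r [gr rq rN]] := gauge_step gq ixy.
have [w cw wr] := gauge_character gr.
have := wr _ (idealN ixy); rewrite (charN cw)// (charB cw)//.
by have := h w cw; lra.
Qed.

Lemma char_eqP x y : ideal e x -> ideal e y ->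
  (forall w, character e w -> w x = w y) -> x = y.
Proof.
by move=> ix iy h; apply/le_anti; rewrite !char_leP// => w /h ->.
Qed.

End Separation.

(** * The extension of phi to the closed quadrant *)

Section QuadrantExtension.
Context {R : realType} {phi : R -> R -> R}.
Hypothesis hphi : class_P phi.
Implicit Types s t l e : R.

Let phibar := quadrant_ext phi.

Lemma class_P_ndecr s s' t t' : 0 < s -> s <= s' -> 0 < t -> t <= t' ->
  phi s t <= phi s' t'.
Proof.
move=> s0 ss t0 tt; apply: (@le_trans _ _ (phi s' t)).
  exact: (class_P_ndecrl hphi).
by apply: (class_P_ndecrr hphi) => //; exact: lt_le_trans ss.
Qed.

Lemma class_P_min s t : 0 < s -> 0 < t -> Num.min s t <= phi s t.
Proof.
move=> s0 t0; set m := Num.min s t.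
have m0 : 0 < m by rewrite lt_min s0.
rewrite -[leLHS]mulr1 -(class_P_norm hphi) -(class_P_homog hphi)// mulr1.
by apply: class_P_ndecr => //; rewrite /m ge_min lexx ?orbT.
Qed.

(** As phi is monotone, the right limit is an infimum, the form from which the later estimates
    start. *)
Lemma quadrant_extE s t : 0 <= s -> 0 <= t ->
  phibar s t = inf [set phi (s + e) (t + e) | e in [set` `]0, +oo[ ]].
Proof.
move=> s0 t0; apply: cvg_lim => //; apply: nondecreasing_at_right_cvgr => //.
- move=> e e'; rewrite !in_itv/= !andbT => e0 e'0 ee.
  by apply: class_P_ndecr; rewrite ?lerD2l// ltr_wpDl.
- exists 0 => _ [e + <-]; rewrite /= in_itv/= andbT => e0.
  by apply: (class_P_ge0 hphi); rewrite ltr_wpDl.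
Qed.

Lemma quadrant_ext_le s t e : 0 <= s -> 0 <= t -> 0 < e ->
  phibar s t <= phi (s + e) (t + e).
Proof.
move=> s0 t0 e0; rewrite quadrant_extE//; apply: ge_inf.
  exists 0 => _ [e' + <-]; rewrite /= in_itv/= andbT => e'0.
  by apply: (class_P_ge0 hphi); rewrite ltr_wpDl.
by exists e => //=; rewrite in_itv/= andbT.
Qed.

Lemma le_quadrant_ext s t m : 0 <= s -> 0 <= t ->
  (forall e, 0 < e -> m <= phi (s + e) (t + e)) -> m <= phibar s t.
Proof.
move=> s0 t0 h; rewrite quadrant_extE//; apply: lb_le_inf.
  by exists (phi (s + 1) (t + 1)), 1 => //=; rewrite in_itv/= ltr01.
by move=> _ [e + <-]; rewrite /= in_itv/= andbT => e0; exact: h.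
Qed.

Lemma quadrant_ext_adherent s t d : 0 <= s -> 0 <= t -> 0 < d ->
  exists2 e, 0 < e & phi (s + e) (t + e) < phibar s t + d.
Proof.
move=> s0 t0 d0; apply/exists2P; apply: contrapT => /forallNP h.
suff : phibar s t + d <= phibar s t by lra.
apply: le_quadrant_ext => // e e0; rewrite leNgt; apply/negP => he.
exact: (h e).
Qed.

Lemma quadrant_ext_pos s t : 0 < s -> 0 < t -> phibar s t = phi s t.
Proof.
move=> s0 t0; apply/le_anti/andP; split; last first.
  apply: le_quadrant_ext; rewrite ?ltW// => e e0.
  by apply: class_P_ndecr => //; lra.
apply/ler_addgt0Pr => d d0.
(* Homogeneity replaces continuity: adding m * (d / phi s t) to both coordinates stays below
   multiplying both by l, which raises phi by exactly d. *)
set m := Num.min s t; have m0 : 0 < m by rewrite lt_min s0.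
have p0 : 0 < phi s t by rewrite (lt_le_trans m0)// class_P_min.
set l := 1 + d / phi s t.
have l0 : 0 < l by rewrite addr_gt0// divr_gt0.
have e0 : 0 < m * (d / phi s t) by rewrite mulr_gt0// divr_gt0.
apply: (le_trans (quadrant_ext_le (ltW s0) (ltW t0) e0)).
rewrite (_ : _ + d = l * phi s t); last by rewrite mulrDl mul1r divfK// gt_eqF.
rewrite -(class_P_homog hphi)// /l !mulrDl !mul1r.
apply: class_P_ndecr; rewrite ?addr_gt0 ?lerD2l// mulrC ler_pM2l ?divr_gt0//.
  by rewrite ge_min lexx.
by rewrite ge_min lexx orbT.
Qed.

Lemma quadrant_ext00 : phibar 0 0 = 0.
Proof.
apply/le_anti/andP; split.
  apply/ler_addgt0Pr => d d0; apply: (le_trans (quadrant_ext_le _ _ d0)) => //.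
  by rewrite -{1 2}[0 + d]mulr1 (class_P_homog hphi)// ?add0r// (class_P_norm hphi) mulr1.
by apply: le_quadrant_ext => // e e0; apply: (class_P_ge0 hphi); rewrite add0r.
Qed.

Lemma quadrant_ext_ndecr s s' t t' : 0 <= s -> s <= s' -> 0 <= t -> t <= t' ->
  phibar s t <= phibar s' t'.
Proof.
move=> s0 ss t0 tt.
apply: le_quadrant_ext => [||e e0]; [exact: le_trans ss|exact: le_trans tt|].
apply: (le_trans (quadrant_ext_le s0 t0 e0)).
by apply: class_P_ndecr; rewrite ?lerD2r// ltr_wpDl.
Qed.

Lemma quadrant_ext_ge0 s t : 0 <= s -> 0 <= t -> 0 <= phibar s t.
Proof. by move=> s0 t0; rewrite -quadrant_ext00 quadrant_ext_ndecr. Qed.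

Lemma quadrant_ext_homog l s t : 0 <= l -> 0 <= s -> 0 <= t ->
  phibar (l * s) (l * t) = l * phibar s t.
Proof.
rewrite le_eqVlt => /orP[/eqP<-|l0] s0 t0; first by rewrite !mul0r quadrant_ext00.
suff h k u v : 0 < k -> 0 <= u -> 0 <= v -> k * phibar u v <= phibar (k * u) (k * v).
  have k0 : 0 < l^-1 by rewrite invr_gt0.
  apply/le_anti; rewrite h// andbT -ler_pdivrMl//.
  by rewrite (le_trans (h _ _ _ k0 (mulr_ge0 (ltW l0) s0) (mulr_ge0 (ltW l0) t0)))// !mulKf ?gt_eqF.
move=> k0 u0 v0; have k0' := ltW k0.
apply: le_quadrant_ext => [||e e0]; [exact: mulr_ge0|exact: mulr_ge0|].
rewrite -ler_pdivlMl//.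
have ek : 0 < k^-1 * e by rewrite mulr_gt0 ?invr_gt0.
apply: (le_trans (quadrant_ext_le u0 v0 ek)).
rewrite ler_pdivlMl// -(class_P_homog hphi) ?ltr_wpDl//.
by rewrite !mulrDr !mulVKf ?gt_eqF.
Qed.

Lemma quadrant_ext_diag s : 0 <= s -> phibar s s = s.
Proof.
move=> s0; rewrite -[in LHS](mulr1 s) quadrant_ext_homog// quadrant_ext_pos//.
by rewrite (class_P_norm hphi) mulr1.
Qed.

Lemma quadrant_ext_max s t : 0 <= s -> 0 <= t -> phibar s t <= Num.max s t.
Proof.
move=> s0 t0; rewrite -[leRHS]quadrant_ext_diag; last by rewrite le_max s0.
by rewrite quadrant_ext_ndecr// le_max lexx ?orbT.
Qed.

(** The upper estimate is additive: by the infimum formula some shift e of both coordinates costs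
    less than d. The lower one is multiplicative: the factor 1 - r comes out by homogeneity, and at
    a zero of f or g the bound is mere nonnegativity. *)
Lemma quadrant_ext_continuous (T : topologicalType) (f g : T -> R) :
  (forall x, 0 <= f x) -> (forall x, 0 <= g x) ->
  continuous f -> continuous g -> continuous (fun x => phibar (f x) (g x)).
Proof.
move=> f0 g0 cf cg x; apply/cvgrPdist_le => /= d d0.
have [e e0 he] := quadrant_ext_adherent (f0 x) (g0 x) d0.
set P := phibar (f x) (g x) in he *.
have P0 : 0 <= P by exact: quadrant_ext_ge0.
(* Chosen so that r <= 1 and r * P <= d, also when P = 0. *)
set r := d / (P + d).
have r0 : 0 < r by rewrite divr_gt0//; lra.
have r1 : r <= 1 by rewrite ler_pdivrMr; lra.
have rP : P - d <= (1 - r) * P.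
  by rewrite mulrBl mul1r lerD2l lerN2 /r mulrAC ler_pdivrMr; [nra|lra].
have low (k : T -> R) : (forall x, 0 <= k x) -> {for x, continuous k} ->
    \forall y \near x, (1 - r) * k x <= k y <= k x + e.
  move=> k0 ck.
  have up : \forall y \near x, k y <= k x + e.
    by near=> y; apply: ltW; near: y; apply: cvgr_lt; [exact: ck|lra].
  have := k0 x; rewrite le_eqVlt => /orP[/eqP kx|kx].
    by near=> y; rewrite -kx mulr0 k0/= kx; near: y.
  have lo : \forall y \near x, (1 - r) * k x <= k y.
    near=> y; apply: ltW; near: y; apply: cvgr_gt; [exact: ck|].
    by rewrite mulrBl mul1r gtrBl mulr_gt0.
  by near=> y; apply/andP; split; near: y.
have hf := low f f0 (cf x); have hg := low g g0 (cg x).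
near=> y.
have /andP[f1 f2] : (1 - r) * f x <= f y <= f x + e by near: y.
have /andP[g1 g2] : (1 - r) * g x <= g y <= g x + e by near: y.
have h1 : phibar (f y) (g y) <= phi (f x + e) (g x + e).
  by rewrite -quadrant_ext_pos ?quadrant_ext_ndecr// ltr_wpDl.
have h2 : (1 - r) * P <= phibar (f y) (g y).
  rewrite /P -quadrant_ext_homog ?subr_ge0//.
  by rewrite quadrant_ext_ndecr// mulr_ge0 ?subr_ge0.
by rewrite ler_distl -/P; apply/andP; split; lra.
Unshelve. all: by end_near. Qed.

End QuadrantExtension.

(** * Kakutani's representation theorem *)

Lemma compact_subtype (T : topologicalType) (A : set T) :
  compact A -> compact [set: set_type A].
Proof.
move=> cA F FF _.
have GA : (set_val @ F) A.
  by rewrite /fmap /=; apply: filterS filterT => x _; exact: set_valP.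
have [p [Ap clp]] := cA (set_val @ F) _ GA.
exists (SigSub (mem_set Ap)); split=> // B U FB.
rewrite nbhsE => -[W [[W' oW' <-] W'p] WU].
have [||_ [[q Bq <-] W'q]] := clp (set_val @` B) W'.
- by rewrite /fmap /=; apply: filterS FB => x Bx; exists x.
- by apply: open_nbhs_nbhs.
by exists q; split=> //; exact: WU.
Qed.

(** Relative uniform completeness, stated for geometrically decreasing increments; the error 2
    (1/2)^n is the sum of the remaining increments. *)
Definition uniformly_complete (R : realType) (V : vectorLatticeType R) (e : V) :=
  forall f : nat -> V, (forall n, ideal e (f n)) ->
    (forall n, vabs (f n.+1 - f n) <= (1 / 2) ^+ n *: e) ->
  exists2 g, ideal e g & forall n, vabs (g - f n) <= (2 * (1 / 2) ^+ n) *: e.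


(** If every P j fails somewhere, the failure sets generate a proper filter by directedness; at a
    cluster point some P j holds locally, a contradiction. This replaces the two finite subcovers in
    the lattice form of the Stone-Weierstrass theorem. *)
Lemma compact_directed (T : topologicalType) (J : Type) (D : set J)
    (P : J -> T -> Prop) :
  compact [set: T] -> D !=set0 ->
  (forall i j, D i -> D j -> exists2 k, D k & forall t, P i t \/ P j t -> P k t) ->
  (forall t : T, exists2 j, D j & nbhs t (P j)) ->
  exists2 j, D j & forall t, P j t.
Proof.
move=> cT D0 Ddir Dloc; apply: contrapT => /forall2NP nex.
pose F := filter_from D (fun j => [set t | ~ P j t]).
have FF : ProperFilter F.
  apply: filter_from_proper; last first.
    by move=> j Dj; have [//|/existsNP[t nPt]] := nex j; exists t.
  apply: filter_from_filter => // i j Di Dj.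
  have [k Dk Pk] := Ddir i j Di Dj; exists k => // t /= nPk.
  by split=> nP; apply: nPk; apply: Pk; [left|right].
have [t [_ clt]] := cT F FF filterT.
have [j Dj Pj] := Dloc t.
have [|t' [nPt' Pt']] := clt [set t | ~ P j t] [set t | P j t] _ Pj; last exact: nPt'.
by exists j.
Qed.

Section ContinuousFunctions.
Context {R : realType} {T : topologicalType} {f g : T -> R}.
Hypotheses (cf : continuous f) (cg : continuous g).

Lemma continuous_add : continuous (fun t => f t + g t).
Proof. by move=> t; apply: cvgD; [exact: cf|exact: cg]. Qed.

Lemma continuous_sub : continuous (fun t => f t - g t).
Proof. by move=> t; apply: cvgB; [exact: cf|exact: cg]. Qed.

Lemma continuous_scale (a : R) : continuous (fun t => a * f t).
Proof. by move=> t; apply: cvgM; [exact: cvg_cst|exact: cf]. Qed.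

Lemma continuous_maxr : continuous (fun t => Num.max (f t) (g t)).
Proof. by move=> t; apply: (@continuous_max R T f g t); [exact: cf|exact: cg]. Qed.

Lemma continuous_const (a : R) : continuous (fun _ : T => a).
Proof. by move=> t; exact: cvg_cst. Qed.

Lemma closed_zeros : closed [set t | f t = 0].
Proof.
apply: (@preimage_closed T R f [set y | y = 0]); last exact: closed_eq.
by move=> t _; exact: cf.
Qed.

End ContinuousFunctions.

Section Kakutani.
Context {R : realType} {V : vectorLatticeType R} {e : V}.
Hypothesis e0 : 0 <= e.
Hypothesis arch : archimedean V.
Hypothesis ucomp : uniformly_complete e.

Let K := prod_topology (fun _ : V => R).
Let Om : set K := [set w | character e (w : V -> R)].

Let evK (x : V) : continuous (fun f : K => f x).
Proof. exact: (@proj_continuous V (fun _ => R) x). Qed.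

Lemma char_set_closed : closed Om.
Proof.
rewrite (_ : Om = (\bigcap_(p in [set p : R * V * V | ideal e p.1.2 /\ ideal e p.2])
     [set w : K | w (p.1.1 *: p.1.2 + p.2) - (p.1.1 * w p.1.2 + w p.2) = 0]) `&`
   (\bigcap_(p in [set p : V * V | ideal e p.1 /\ ideal e p.2])
     [set w : K | w (vjoin p.1 p.2) - Num.max (w p.1) (w p.2) = 0]) `&`
   [set w : K | w e - 1 = 0] `&`
   (\bigcap_(x in [set x : V | ~ ideal e x]) [set w : K | w x = 0])).
  apply: closedI; [apply: closedI; [apply: closedI|]|].
  - apply: closed_bigI => -[[a x] y] _; apply: closed_zeros.
    apply: (@continuous_sub R K (fun w => w (a *: x + y)) (fun w => a * w x + w y)).
      exact: evK.
    apply: (@continuous_add R K (fun w => a * w x) (fun w => w y)); last exact: evK.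
    exact: (@continuous_scale R K (fun w => w x)).
  - apply: closed_bigI => -[x y] _; apply: closed_zeros.
    apply: (@continuous_sub R K (fun w => w (vjoin x y)) (fun w => Num.max (w x) (w y))).
      exact: evK.
    by apply: (@continuous_maxr R K (fun w => w x) (fun w => w y)); exact: evK.
  - by apply: closed_zeros; apply: (@continuous_sub R K (fun w => w e) (fun=> 1)); [exact: evK|exact: continuous_const].
  - by apply: closed_bigI => x _; apply: closed_zeros; exact: evK.
apply/seteqP; split=> w.
- move=> cw; split; [split; [split|]|].
  + by move=> [[a x] y] /= [ix iy]; rewrite (char_lin cw)// subrr.
  + by move=> [x y] /= [ix iy]; rewrite (char_join cw)// subrr.
  + by rewrite /= (char_unit cw) subrr.
  + by move=> x /=; exact: (char_out cw).
- move=> [[[h1 h2] h3] h4]; split.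
  + by move=> a x y ix iy; have /= /subr0_eq := h1 (a, x, y) (conj ix iy).
  + by move=> x y ix iy; have /= /subr0_eq := h2 (x, y) (conj ix iy).
  + by move/subr0_eq: h3.
  + exact: h4.
Qed.

Lemma char_set_compact : compact Om.
Proof.
have /choice[b bP] : forall x : V, exists c : R, 0 <= c /\ (ideal e x -> vabs x <= c *: e).
  move=> x; have [/(ideal_pos e0)[c c0 xc]|nx] := pselect (ideal e x).
    by exists c; split=> //; exact: ltW.
  by exists 0.
pose B x : set R := [set` `[- b x, b x]].
have cB : compact [set f : K | forall x, B x (f x)].
  by apply: (@tychonoff V (fun=> R) B) => x; exact: segment_compact.
apply: (subclosed_compact char_set_closed cB) => w cw x.
have [b0 bx] := bP x; rewrite /B /= in_itv /=.
have [ix|nix] := pselect (ideal e x); last by rewrite (char_out cw)// oppr_le0 b0.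
rewrite -ler_norml -(char_abs cw)// -[b x]mulr1 -(char_unit cw).
rewrite -(charZ cw); last exact: ideal_self.
apply: (char_le cw) (bx ix); first exact: ideal_abs.
exact/idealZ/ideal_self.
Qed.

Definition spectrum := set_type Om.

Definition spectrum_eval (x : V) (w : spectrum) : R := (set_val w : V -> R) x.

Lemma spectrum_char (w : spectrum) : character e (set_val w : V -> R).
Proof. exact: (set_valP w). Qed.

Lemma spectrum_eval_continuous x : continuous (spectrum_eval x).
Proof.
move=> w; apply: (@continuous_comp _ _ _ (set_val : spectrum -> K) (fun f : K => f x)).
  exact: initial_continuous.
exact: evK.
Qed.

Lemma spectrum_compact : compact [set: spectrum].
Proof. exact/compact_subtype/char_set_compact. Qed.

Lemma spectrum_neq (w1 w2 : spectrum) : w1 <> w2 ->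
  exists2 x, ideal e x & spectrum_eval x w1 != spectrum_eval x w2.
Proof.
move=> ne; apply: contrapT => /forall2NP h; apply: ne; apply/val_inj/funext => x.
have [ix|nix] := pselect (ideal e x).
  by have [//|/negP/negPn/eqP] := h x.
transitivity (0 : R); first exact: (char_out (spectrum_char w1)).
exact/esym/(char_out (spectrum_char w2)).
Qed.

Lemma spectrum_hausdorff : hausdorff_space spectrum.
Proof.
move=> w1 w2 cl; apply: contrapT => /spectrum_neq[x ix xne].
pose d := `|spectrum_eval x w1 - spectrum_eval x w2| / 2.
have d0 : 0 < d by rewrite divr_gt0// normr_gt0 subr_eq0.
have near w : nbhs w [set w' | `|spectrum_eval x w - spectrum_eval x w'| < d].
  by have /cvgrPdist_lt := @spectrum_eval_continuous x w; apply.
have [w [/= h1 h2]] := cl _ _ (near w1) (near w2).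
have := ler_distD (spectrum_eval x w) (spectrum_eval x w1) (spectrum_eval x w2).
by rewrite [X in _ <= _ + X]distrC -/(d * 2) /d in h1 h2 *; lra.
Qed.

Lemma spectrum_interpolate (f : spectrum -> R) w1 w2 : exists2 x, ideal e x &
  spectrum_eval x w1 = f w1 /\ spectrum_eval x w2 = f w2.
Proof.
have ie := ideal_self e0; pose ev := spectrum_eval.
have evL a y b z w : ideal e y -> ideal e z -> ev (a *: y + b *: z) w = a * ev y w + b * ev z w.
  move=> iy iz; rewrite /ev /spectrum_eval (charD (spectrum_char w)); try exact: idealZ.
  by rewrite !(charZ (spectrum_char w)).
have eve w : ev e w = 1 by exact: char_unit (spectrum_char w).
have [->|/spectrum_neq[x ix xne]] := pselect (w1 = w2).
  exists (f w2 *: e + 0 *: e); first by apply: idealD; exact: idealZ.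
  by rewrite -/ev evL// eve !mulr1 addr0.
pose u1 := ev x w1; pose u2 := ev x w2.
have u0 : u1 - u2 != 0 by rewrite subr_eq0.
(* Cramer's rule for the system a * u_i + b = f w_i; the unit e takes the value 1 at both
   characters. *)
exists (((f w1 - f w2) / (u1 - u2)) *: x + ((u1 * f w2 - u2 * f w1) / (u1 - u2)) *: e).
  by apply: idealD; exact: idealZ.
by rewrite -/ev !evL// !eve -/u1 -/u2; split; field.
Qed.

(** Lattice form of Stone-Weierstrass. Finite meets of interpolants through w1 come below f + d
    everywhere and keep the value f w1; they exceed f - d near w1, so finite joins over several w1
    exceed it everywhere. *)
Lemma spectrum_dense (f : spectrum -> R) d : continuous f -> 0 < d ->
  exists2 x, ideal e x & forall w, `|f w - spectrum_eval x w| <= d.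
Proof.
move=> cf d0; pose ev := spectrum_eval.
have evc x : continuous (ev x) by exact: spectrum_eval_continuous.
have step1 w1 : exists2 x, ideal e x /\ ev x w1 = f w1 & forall w, ev x w < f w + d.
  apply: (@compact_directed spectrum V [set x | ideal e x /\ ev x w1 = f w1]
    (fun x w => ev x w < f w + d) spectrum_compact).
  - by have [x ix [xw _]] := spectrum_interpolate f w1 w1; exists x.
  - move=> x y [ix xw] [iy yw]; exists (vmeet x y).
      by split; [exact: ideal_meet|rewrite /ev /spectrum_eval (char_meet (spectrum_char w1))// -!/(spectrum_eval _ _) -/ev xw yw minxx].
    by move=> w h; rewrite /ev /spectrum_eval (char_meet (spectrum_char w))// gt_min; apply/orP.
  - move=> w; have [x ix [xw1 xw]] := spectrum_interpolate f w1 w; exists x => //.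
    have := continuous_sub (evc x) cf; move=> /(_ w)/cvgr_lt/(_ d).
    rewrite /ev xw subrr => /(_ d0); apply: filterS => w'; lra.
have [[w0]|nw] := pselect (exists w0 : spectrum, True); last first.
  by exists 0; [exact: ideal0|move=> w; exfalso; apply: nw; exists w].
move=> _.
have [x [ix xd] xf] : exists2 x, ideal e x /\ (forall w, ev x w < f w + d) & forall w, f w - d < ev x w.
  apply: (@compact_directed spectrum V [set x | ideal e x /\ forall w, ev x w < f w + d]
    (fun x w => f w - d < ev x w) spectrum_compact).
  - by have [x [ix _] xw] := step1 w0; exists x.
  - move=> x y [ix xw] [iy yw]; exists (vjoin x y).
      split; first exact: ideal_join.
      by move=> w; rewrite /ev /spectrum_eval (char_join (spectrum_char w))// gt_max xw yw.
    by move=> w h; rewrite /ev /spectrum_eval (char_join (spectrum_char w))// lt_max; apply/orP.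
  - move=> w; have [x [ix xw] xd] := step1 w; exists x => //.
    have := continuous_sub cf (evc x); move=> /(_ w)/cvgr_lt/(_ d).
    rewrite xw subrr => /(_ d0); apply: filterS => w'; lra.
exists x => // w; rewrite ler_distl; apply/andP; have := xd w; have := xf w.
by rewrite /ev => ? ?; split; lra.
Qed.

Lemma spectrum_surj (f : spectrum -> R) : continuous f ->
  exists2 x, ideal e x & spectrum_eval x = f.
Proof.
move=> cf; have ie := ideal_self e0.
have hp n : 0 < (1 / 2 : R) ^+ n by rewrite exprn_gt0// divr_gt0.
(* On characters, consecutive approximants differ by at most (1/2)^n / 2 + (1/2)^n / 4, within the
   increment (1/2)^n that uniform completeness allows. *)
have /choice[x xP] : forall n, exists x, ideal e x /\
    forall w, `|f w - spectrum_eval x w| <= (1 / 2) ^+ n / 2.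
  move=> n; have [|x ix xf] := @spectrum_dense f ((1 / 2) ^+ n / 2) cf.
    by rewrite divr_gt0.
  by exists x.
have ix n : ideal e (x n) by have [] := xP n.
have xf n w : `|f w - spectrum_eval (x n) w| <= (1 / 2) ^+ n / 2 by have [_] := xP n.
have [n|g ig gx] := ucomp ix.
  apply: (char_leP e0 arch) => [||w cw]; [exact/ideal_abs/idealB|exact: idealZ|].
  rewrite (char_abs cw) ?(charB cw)// ?(charZ cw)//; last exact: idealB.
  rewrite (char_unit cw) mulr1.
  pose w' : spectrum := SigSub (mem_set (cw : Om w)).
  have h0 := hp n; have h1 : `|f w' - w (x n)| <= (1 / 2) ^+ n / 2 := xf n w'.
  have h2 : `|f w' - w (x n.+1)| <= (1 / 2) ^+ n.+1 / 2 := xf n.+1 w'.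
  rewrite exprS in h2; move: h0 h1 h2; generalize ((1 / 2 : R) ^+ n) => h.
  rewrite !ler_distl => ? /andP[? ?] /andP[? ?]; apply/andP; split; lra.
exists g => //; apply/funext => w; apply/eqP; rewrite -subr_eq0 -normr_le0.
have cw := spectrum_char w.
have bnd n : `|spectrum_eval g w - f w| <= 3 * (1 / 2) ^+ n.
  have := char_le cw (ideal_abs (idealB ig (ix n))) (idealZ _ ie) (gx n).
  rewrite (char_abs cw); last exact: idealB.
  rewrite (charB cw)// (charZ cw)// (char_unit cw) mulr1.
  have := xf n w; have := hp n; set h := (1 / 2) ^+ n; rewrite /spectrum_eval !ler_norml => ? /andP[? ?] /andP[? ?].
  by apply/andP; split; lra.
rewrite leNgt; apply/negP => gf.
have [n hn] : exists n, 3 * (1 / 2) ^+ n < `|spectrum_eval g w - f w|.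
  have : (3 * (1 / 2 : R) ^+ n) @[n --> \oo] --> (3 * 0 : R).
    by apply: cvgM; [exact: cvg_cst|apply: cvg_expr; rewrite ger0_norm; lra].
  rewrite mulr0 => /cvgr_lt/(_ _ gf) [N _ hN].
  by exists N; exact: hN (leqnn N).
by have := le_lt_trans (bnd n) hn; rewrite ltxx.
Qed.

Lemma spectrum_representation (I : set V) : I = ideal e ->
  CK_representation I e spectrum_eval.
Proof.
move=> ->; split.
- split.
  + by move=> x ix /=; exact: spectrum_eval_continuous.
  + move=> x y /set_mem ix /set_mem iy xy.
    apply: (char_eqP e0 arch ix iy) => w cw.
    pose w' : spectrum := SigSub (mem_set (cw : Om w)).
    exact: (congr1 (fun k : spectrum -> R => k w') xy).
  + by move=> f /= /spectrum_surj[x ix xf]; exists x.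
- by move=> a x y w ix iy; exact: (char_lin (spectrum_char w)).
- by move=> x y w ix iy; exact: (char_join (spectrum_char w)).
- by move=> x y w ix iy; exact: (char_meet (spectrum_char w)).
- by move=> w; exact: char_unit (spectrum_char w).
Qed.

End Kakutani.

Section Krivine.
Context {R : realType} {V : vectorLatticeType R} {S : set V} {phi : R -> R -> R}.
Hypothesis hphi : class_P phi.

Lemma krivine_exists (a b : V) : 0 <= a -> 0 <= b -> archimedean V ->
  uniformly_complete (vjoin a b) ->
  principal_ideal S (vjoin a b) = ideal (vjoin a b) ->
  exists z, krivine S phi a b z.
Proof.
move=> a0 b0 arch uc SI; set e := vjoin a b in uc SI *.
have e0 : 0 <= e by exact: le_trans (vjoinl a b).
have ia : ideal e a by apply: (ideal_between a0 (vjoinl a b)); exact: ideal_self.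
have ib : ideal e b by apply: (ideal_between b0 (vjoinr a b)); exact: ideal_self.
have pos x w : 0 <= x -> ideal e x -> 0 <= @spectrum_eval R V e x w.
  by move=> x0 ix; exact: (char_ge0 (spectrum_char w)).
have [z iz zE] : exists2 z, ideal e z & spectrum_eval z =
    (fun w : spectrum => quadrant_ext phi (@spectrum_eval R V e a w) (spectrum_eval b w)).
  apply: spectrum_surj => //; apply: (quadrant_ext_continuous hphi).
  - by move=> w; exact: pos.
  - by move=> w; exact: pos.
  - exact: spectrum_eval_continuous.
  - exact: spectrum_eval_continuous.
exists z; exists (@spectrum R V e), (@spectrum_eval R V e); split.
- exact: spectrum_compact.
- exact: spectrum_hausdorff.
- exact: spectrum_representation.
- by rewrite SI.
- by move=> w; rewrite zE.
Qed.

End Krivine.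

(** * Krivine calculus in the sum of a compatible pair *)

Section KrivineCharacter.
Context {R : realType} {V : vectorLatticeType R} {S : set V} {phi : R -> R -> R}.
Hypothesis hphi : class_P phi.

Lemma krivine_ideal (a b z : V) :
  principal_ideal S (vjoin a b) = ideal (vjoin a b) ->
  krivine S phi a b z -> ideal (vjoin a b) z.
Proof. by move=> SI [Om [h [_ _ _ + _]]]; rewrite SI. Qed.

(* A unital character of C(Omega) need only be matched with a point evaluation
   on the three elements a, b, z: otherwise the continuous function [h g] below
   would be strictly positive, and the preimage under [h] of its inverse, being
   dominated by a multiple of the unit, would bound [g] away from zero. *)
Lemma krivine_char (a b z E : V) (w : V -> R) :
  principal_ideal S (vjoin a b) = ideal (vjoin a b) ->
  krivine S phi a b z -> 0 <= a -> 0 <= b -> 0 <= E -> ideal E a -> ideal E b ->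
  character E w -> w z = quadrant_ext phi (w a) (w b).
Proof.
move=> SI kz a0 b0 E0 iEa iEb cw.
have iz := krivine_ideal SI kz.
have [Om [h [_ _ hCK _ hz]]] := kz.
set e := vjoin a b in SI iz hCK *.
rewrite -/e SI in hCK.
have e0 : 0 <= e by exact: le_trans (vjoinl a b).
have ie := ideal_self e0.
have ia : ideal e a := ideal_between a0 (vjoinl a b) ie.
have ib : ideal e b := ideal_between b0 (vjoinr a b) ie.
have iEe : ideal E e by exact: ideal_join.
have iEz := ideal_trans e0 iEe iz.
have wa0 : 0 <= w a by exact: (char_ge0 cw).
have wb0 : 0 <= w b by exact: (char_ge0 cw).
have we : w e = Num.max (w a) (w b) by exact: (char_join cw).
have wz0 : w e = 0 -> w z = 0.
  move=> we0; have [c zc] := iz; apply/eqP; rewrite -normr_le0 -(char_abs cw)//.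
  rewrite (_ : 0 = w (c *: e)); last by rewrite (charZ cw)// we0 mulr0.
  by apply: (char_le cw) => //; [exact: ideal_abs|exact: idealZ].
have := wa0; have := wb0; have : 0 <= w e by rewrite we le_max wa0.
rewrite le_eqVlt => /orP[/eqP we0 _ _|c0 _ _].
  have [-> ->] : w a = 0 /\ w b = 0.
    have : w a <= w e by rewrite we le_max lexx.
    have : w b <= w e by rewrite we le_max lexx orbT.
    by rewrite -we0; split; apply/le_anti/andP.
  by rewrite (quadrant_ext00 hphi) wz0.
set c := w e in c0 *.
have [hfun hinj hsurj] := CK_bij hCK.
have h0 om : h 0 om = 0.
  have := CK_linear hCK 1 om (ideal0 e) (ideal0 e).
  by rewrite scaler0 addr0 mul1r => /eqP; rewrite -subr_eq subrr => /eqP.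
have hZ k x om : ideal e x -> h (k *: x) om = k * h x om.
  move=> ix; have := CK_linear hCK k om ix (ideal0 e).
  by rewrite !addr0 h0 addr0.
have hD x y om : ideal e x -> ideal e y -> h (x + y) om = h x om + h y om.
  by move=> ix iy; have := CK_linear hCK 1 om ix iy; rewrite scale1r mul1r.
have hN x om : ideal e x -> h (- x) om = - h x om.
  by move=> ix; rewrite -scaleN1r hZ// mulN1r.
have habs x om : ideal e x -> h (vabs x) om = `|h x om|.
  by move=> ix; rewrite (CK_join hCK) ?hN ?maxrN//; exact: idealN.
have hle x y : ideal e x -> ideal e y -> (forall om, h x om <= h y om) -> x <= y.
  move=> ix iy hxy; suff <- : vjoin x y = y by exact: vjoinl.
  apply: hinj; rewrite ?inE//; first exact: ideal_join.
  by apply/funext => om; rewrite (CK_join hCK)// max_r.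
have lhe x y om : ideal e x -> ideal e y -> x <= y -> h x om <= h y om.
  move=> ix iy xy; have := CK_join hCK om ix iy.
  by rewrite vjoin_max// => ->; rewrite le_max lexx.
(* w is normalized at E, not at e, so on the ideal of e it is c = w e times a unital character:
   [D x] vanishes at om exactly when h x om = w x / c. *)
pose D x := vabs (c *: x - w x *: e).
have iD x : ideal e x -> ideal e (D x).
  by move=> ix; apply/ideal_abs/idealB; exact: idealZ.
have wD x : ideal e x -> w (D x) = 0.
  move=> ix; have iEx := ideal_trans e0 iEe ix.
  rewrite (char_abs cw); last by apply: idealB; exact: idealZ.
  rewrite (charB cw); try exact: idealZ.
  by rewrite !(charZ cw)// mulrC subrr normr0.
have hDE x om : ideal e x -> h (D x) om = `|c * h x om - w x|.
  move=> ix; rewrite habs; last by apply: idealB; exact: idealZ.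
  by rewrite hD ?hN ?hZ ?(CK_unit hCK) ?mulr1//; auto with ideal.
pose g := D a + D b + D z.
have ig : ideal e g by apply: idealD; [apply: idealD|]; exact: iD.
have wg : w g = 0.
  have iE x : ideal e x -> ideal E (D x) by move=> ix; exact: ideal_trans (iD _ ix).
  by rewrite (charD cw) ?(charD cw) ?wD ?addr0//; try (exact: iE); apply: idealD; exact: iE.
have [om hg] : exists om, h g om <= 0.
  apply: contrapT => /forallNP hg.
  have gpos om : 0 < h g om by rewrite ltNge; apply/negP.
  have cg : continuous (h g) by apply: hfun.
  have [y iy hy] : exists2 y, ideal e y & h y = (fun om => (h g om)^-1).
    have [|y iy hy] := hsurj (fun om => (h g om)^-1).
      by move=> om; apply: cvgV; [rewrite gt_eqF|exact: cg].
    by exists y.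
  have [d d0 yd] := ideal_pos e0 iy.
  suff ed : e <= d *: g.
    have := char_le cw iEe (idealZ d (ideal_trans e0 iEe ig)) ed.
    by rewrite (charZ cw) ?wg ?mulr0 -/c; [lra|exact: ideal_trans ig].
  apply: hle => //; first exact: idealZ.
  move=> om; rewrite hZ// (CK_unit hCK) -ler_pdivrMr// div1r.
  have := lhe _ _ om iy (idealZ d ie) (le_trans (vabs_ler y) yd).
  by rewrite hy hZ// (CK_unit hCK) mulr1.
have hval x : ideal e x -> h (D x) om <= 0 -> h x om = w x / c.
  move=> ix; rewrite hDE// normr_le0 subr_eq0 => /eqP <-.
  by rewrite mulrC mulKf// gt_eqF.
have Dpos x : ideal e x -> 0 <= h (D x) om by move=> ix; rewrite hDE.
have := Dpos a ia; have := Dpos b ib; have := Dpos z iz.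
have iDa := iD a ia; have iDb := iD b ib; have iDz := iD z iz.
rewrite (hD _ _ om (idealD iDa iDb) iDz) (hD _ _ om iDa iDb) in hg.
move=> z1 b1 a1.
have za := hval a ia ltac:(lra); have zb := hval b ib ltac:(lra).
have zz := hval z iz ltac:(lra).
have := hz om; rewrite za zb zz => /(congr1 (fun t => c * t)).
rewrite -(quadrant_ext_homog hphi (ltW c0) (divr_ge0 wa0 (ltW c0)) (divr_ge0 wb0 (ltW c0))).
by rewrite !(mulrCA c) !divff ?gt_eqF// !mulr1.
Qed.

End KrivineCharacter.

(** * Order and topology in a Hausdorff locally solid lattice *)

Section LocallySolidTheory.
Context {R : realType} {X : locallySolidType R}.
Implicit Types x y d : X.

Lemma nbhs0_add (U : set X) : nbhs (0 : X) U ->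
  exists2 W, nbhs (0 : X) W & forall x y, W x -> W y -> U (vabs (x + y)).
Proof.
move=> /locally_solid[B [nB sB BU]].
have nB' : nbhs ((0 : X, 0 : X).1 + (0 : X, 0 : X).2) B by rewrite /= addr0.
have [[A1 A2] /= [nA1 nA2] AB] := @add_continuous X (0, 0) B nB'.
exists (A1 `&` A2); first exact: filterI.
move=> x y [x1 _] [_ y2]; apply/BU/(sB _ (x + y)); last by rewrite vabs_id.
by have := AB (x, y); apply.
Qed.

Lemma nbhs0_scale (U : set X) (e : X) : nbhs (0 : X) U ->
  exists2 d : R, 0 < d & U (d *: e).
Proof.
move=> nU.
have nU' : nbhs ((0 : R^o, e).1 *: (0 : R^o, e).2) U by rewrite /= scale0r.
have [[A1 A2] /= [nA1 nA2] AU] := @scale_continuous R X (0, e) U nU'.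
have [r /= r0 rA] := nA1.
exists (r / 2); first by rewrite divr_gt0.
have := AU (r / 2, e); apply; split => /=; last exact: nbhs_singleton.
apply: rA; rewrite /ball_ /= sub0r normrN gtr0_norm ?divr_gt0//; lra.
Qed.

Hypothesis hX : hausdorff_space X.

(** Closedness of the positive cone: the positive part of x - y is dominated by |d| with d in any
    given neighbourhood, so it lies in every neighbourhood of 0 and vanishes by the Hausdorff
    property. *)
Lemma locally_solid_le x y :
  (forall U, nbhs (0 : X) U -> exists2 d, U d & x <= y + d) -> x <= y.
Proof.
move=> h; rewrite -vsubr_ge0 -vleN oppr0 opprB.
apply: (le_trans (vjoinl _ 0)); rewrite -/(vpos _).
rewrite -(_ : 0 = vpos (x - y))//; apply: hX => A B nA nB.
exists (vpos (x - y)); split; last exact: nbhs_singleton.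
have [C [nC sC CA]] := locally_solid _ nA; have [d Cd xyd] := h _ nC.
apply/CA/(sC _ d) => //; rewrite vabs_pos ?vpos_ge0// vjoin_le vabs_ge0 andbT.
by rewrite vlerBlDr addrC (le_trans xyd)// vleD2l vabs_ler.
Qed.

Lemma locally_solid_archimedean : archimedean X.
Proof.
move=> x e h; apply: locally_solid_le => U /(nbhs0_scale e)[d d0 Ud].
by exists (d *: e) => //; rewrite add0r; exact: h.
Qed.

End LocallySolidTheory.

(** * Order-dominated series in a quasi-Banach lattice *)

Section QuasiNorm.
Context {R : realType} {E : quasiBanachLatticeType R}.
Implicit Types x y : E.

Lemma qnorm0 : qnorm (0 : E) = 0.
Proof. by rewrite -(scale0r 0) qnormZ normr0 mul0r. Qed.

Lemma qnorm_le x y : 0 <= x -> x <= y -> qnorm x <= qnorm y.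
Proof. by move=> x0 xy; apply: le_qnorm; rewrite !vabs_pos// (le_trans x0). Qed.

Lemma qnorm_abs x : qnorm (vabs x) = qnorm x.
Proof. by apply/le_anti; rewrite !le_qnorm// vabs_id. Qed.

Lemma qnorm_abs_le x y : vabs x <= y -> qnorm x <= qnorm y.
Proof. by rewrite -[qnorm x]qnorm_abs; apply: qnorm_le; exact: vabs_ge0. Qed.

Lemma qnormZ_ge0 (a : R) x : 0 <= a -> qnorm (a *: x) = a * qnorm x.
Proof. by move=> a0; rewrite qnormZ ger0_norm. Qed.

End QuasiNorm.

Lemma vabs_sum_geometric (R : realType) (V : vectorLatticeType R) (a : nat -> V) p :
  0 <= p -> (forall n, vabs (a n) <= (1 / 2) ^+ n *: p) ->
  forall m k, vabs (\sum_(m <= i < m + k) a i) <= (2 * (1 / 2) ^+ m) *: p.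
Proof.
move=> p0 ap m k.
suff h : vabs (\sum_(m <= i < m + k) a i) <=
    (2 * (1 / 2) ^+ m - 2 * (1 / 2) ^+ (m + k)) *: p.
  apply: (le_trans h); apply: vleZr => //.
  by rewrite gerBl mulr_ge0// exprn_ge0// divr_ge0.
elim: k => [|k IH]; first by rewrite addn0 big_geq// vabs0 subrr scale0r.
rewrite addnS big_nat_recr ?leq_addr//=.
apply: (le_trans (vabsD _ _)); apply: (le_trans (vleD IH (ap _))).
rewrite -scalerDl; apply: vleZr => //; rewrite exprS.
by move: ((1 / 2) ^+ m) ((1 / 2) ^+ (m + k)) => u v; lra.
Qed.

(** The tails are estimated in the order, by multiples of the single element p, before the
    quasi-norm is taken, so the quasi-triangle constant does not pile up with the number of
    terms. *)
Lemma qnorm_series (R : realType) (E : quasiBanachLatticeType R) (a : nat -> E) p :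
  0 <= p -> (forall n, vabs (a n) <= (1 / 2) ^+ n *: p) ->
  exists l, forall d : R, 0 < d -> exists N : nat, forall n, (N <= n)%N ->
    qnorm (l - \sum_(0 <= i < n) a i) < d.
Proof.
move=> p0 ap; pose s n := \sum_(0 <= i < n) a i.
have smk m k : qnorm (s (m + k)%N - s m) <= 2 * (1 / 2) ^+ m * qnorm p.
  rewrite -qnormZ_ge0 ?mulr_ge0 ?exprn_ge0 ?divr_ge0//; apply: qnorm_abs_le.
  rewrite /s (@big_cat_nat _ _ _ m 0 (m + k))//= ?leq_addr// [X in X - _]addrC addrK.
  exact: vabs_sum_geometric.
have qN x : qnorm (- x) = qnorm x :> R.
  by rewrite -scaleN1r qnormZ normrN normr1 mul1r.
have cvg0 : (2 * (1 / 2 : R) ^+ n * qnorm p) @[n --> \oo] --> (0 : R).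
  have -> : 0 = 2 * 0 * qnorm p :> R by rewrite mulr0 mul0r.
  apply: cvgM; last exact: cvg_cst.
  by apply: cvgM; [exact: cvg_cst|apply: cvg_expr; rewrite ger0_norm; lra].
have [|l hl] := @qnorm_complete R E s.
  move=> d d0; have [N _ hN] := cvgr_lt _ cvg0 d d0.
  have hs m n : (N <= m)%N -> (m <= n)%N -> qnorm (s n - s m) < d.
    by move=> Nm mn; rewrite -(subnKC mn); exact: le_lt_trans (smk _ _) (hN m Nm).
  exists N => m n Nm Nn; have [mn|/ltnW nm] := leqP m n; last exact: hs.
  by rewrite -qN opprB hs.
exists l => d d0; have [N _ hN] := cvgr_lt _ hl d d0.
by exists N => n Nn; rewrite -qN opprB; exact: hN.
Qed.

(** * Embedded lattices as ideals *)

Section Embedding.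
Context {R : realType} {E : quasiBanachLatticeType R} {X : locallySolidType R}
  {j : {linear E -> X}}.
Hypothesis hj : lattice_embedding j.

Lemma emb_le x y : (j x <= j y) = (x <= y).
Proof.
apply/idP/idP => xy; last by rewrite -(vjoin_max xy) (emb_join hj) vjoinl.
suff <- : vjoin x y = y by exact: vjoinl.
by apply: (emb_inj hj); rewrite (emb_join hj) vjoin_max.
Qed.

Lemma emb_ge0 x : (0 <= j x) = (0 <= x).
Proof. by rewrite -(linear0 j) emb_le. Qed.

Lemma emb_abs x : j (vabs x) = vabs (j x).
Proof. by rewrite /vabs (emb_join hj) linearN. Qed.

Lemma emb_solid y p : vabs y <= j p -> exists2 x, y = j x & vabs x <= p.
Proof.
move=> yp; have p0 : 0 <= p by rewrite -emb_ge0 (le_trans (vabs_ge0 _) yp).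
have part v : 0 <= v -> v <= vabs y -> exists x, j x = v.
  move=> v0 vy; have : [set y | 0 <= y <= j p] v by rewrite /= v0 (le_trans vy).
  by rewrite -(emb_interval hj p0) => -[x _ xv]; exists x.
have [|a ja] := part (vpos y) (vpos_ge0 _).
  by rewrite vabs_vpos -[leLHS]addr0 vleD2l vpos_ge0.
have [|b jb] := part (vpos (- y)) (vpos_ge0 _).
  by rewrite vabs_vpos -[leLHS]add0r vleD2r vpos_ge0.
have yE : y = j (a - b) by rewrite linearB ja jb -vposB.
by exists (a - b) => //; rewrite -emb_le emb_abs -yE.
Qed.

Lemma emb_small (U : set X) : nbhs (0 : X) U ->
  exists2 d : R, 0 < d & forall x, qnorm x < d -> U (j x).
Proof.
move=> nU; have [|d d0 dU] := @emb_cont _ _ _ _ hj 0 U; first by rewrite linear0.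
by exists d => // x xd; apply: dU; rewrite subr0.
Qed.

End Embedding.

Lemma riesz2 (R : realType) (V : vectorLatticeType R) (x u v : V) :
  0 <= u -> 0 <= v -> vabs x <= u + v ->
  exists y z, [/\ x = y + z, vabs y <= u & vabs z <= v].
Proof.
move=> u0 v0 xuv.
have [k||f [fx fw]] := @riesz_family R V 1 2 (fun=> x)
    (fun k => if k == ord0 then u else v); first by case: ifP.
  by rewrite big_ord_recl big_ord0 addr0 !big_ord_recl big_ord0 addr0.
exists (f ord0 ord0), (f ord0 (lift ord0 ord0)); split.
- by rewrite (fx ord0) !big_ord_recl big_ord0 addr0.
- by have := fw ord0; rewrite big_ord_recl big_ord0 addr0.
- by have := fw (lift ord0 ord0); rewrite big_ord_recl big_ord0 addr0.
Qed.

(** * The sum of a compatible pair *)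

Section CompatiblePair.
Context {R : realType} {X0 X1 : quasiBanachLatticeType R}
  {X : locallySolidType R} {j0 : {linear X0 -> X}} {j1 : {linear X1 -> X}}.
Hypothesis hc : compatible_pair j0 j1.

Let hX := compatible_hausdorff hc.
Let h0 := compatible_emb0 hc.
Let h1 := compatible_emb1 hc.
Let S := sum_space j0 j1.

Lemma pair_archimedean : archimedean X.
Proof. exact: locally_solid_archimedean. Qed.

Lemma sum_decomp x p q : 0 <= p -> 0 <= q -> vabs x <= j0 p + j1 q ->
  exists a b, [/\ x = j0 a + j1 b, vabs a <= p & vabs b <= q].
Proof.
move=> p0 q0 /riesz2[||y [z [-> yp zq]]]; rewrite ?(emb_ge0 h0) ?(emb_ge0 h1)//.
have [a -> ap] := emb_solid h0 yp; have [b -> bq] := emb_solid h1 zq.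
by exists a, b.
Qed.

Lemma sum_bound x : S x -> exists p q, [/\ 0 <= p, 0 <= q & vabs x <= j0 p + j1 q].
Proof.
move=> [a [b ->]]; exists (vabs a), (vabs b); split; rewrite ?vabs_ge0//.
by rewrite (emb_abs h0) (emb_abs h1) vabsD.
Qed.

Lemma sum_solid x y : S y -> vabs x <= vabs y -> S x.
Proof.
move=> /sum_bound[p [q [p0 q0 yb]]] xy.
have [a [b [-> _ _]]] := sum_decomp p0 q0 (le_trans xy yb).
by exists a, b.
Qed.

Lemma sumZ (c : R) x : S x -> S (c *: x).
Proof. by move=> [a [b ->]]; exists (c *: a), (c *: b); rewrite scalerDr !linearZ. Qed.

Lemma sumD x y : S x -> S y -> S (x + y).
Proof.
move=> [a [b ->]] [a' [b' ->]]; exists (a + a'), (b + b').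
by rewrite !linearD addrACA.
Qed.

Lemma sumN x : S x -> S (- x).
Proof. by rewrite -scaleN1r; exact: sumZ. Qed.

Lemma sum_inl a : S (j0 a).
Proof. by exists a, 0; rewrite linear0 addr0. Qed.

Lemma sum_inr b : S (j1 b).
Proof. by exists 0, b; rewrite linear0 add0r. Qed.

Lemma sum_abs x : S x -> S (vabs x).
Proof. by move=> Sx; apply: sum_solid Sx _; rewrite vabs_id. Qed.

Lemma sum_principal e : S e -> 0 <= e -> principal_ideal S e = ideal e.
Proof.
move=> Se e0; apply/seteqP; split=> x; first by move=> [].
move=> [c xc]; split; last by exists c.
by apply: (sum_solid (sumZ c Se)); exact: le_trans (vabs_ler _).
Qed.

(** With e <= j0 p + j1 q, each increment splits into parts dominated by (1/2)^n p and (1/2)^n q,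
    and the two series converge in X0 and X1. These limits do not carry the bound by e with them; it
    is recovered from continuity of the embeddings and closedness of the cone of X. *)
Lemma sum_uniformly_complete e : S e -> 0 <= e -> uniformly_complete e.
Proof.
move=> Se e0 f fi fS.
have [p [q [p0 q0 epq]]] := sum_bound Se.
have /choice[ab abP] : forall n, exists ab : X0 * X1,
    [/\ f n.+1 - f n = j0 ab.1 + j1 ab.2, vabs ab.1 <= (1 / 2) ^+ n *: p
      & vabs ab.2 <= (1 / 2) ^+ n *: q].
  move=> n; have hn : 0 <= (1 / 2 : R) ^+ n by rewrite exprn_ge0// divr_ge0.
  have [|||a [b [fE ap bq]]] := @sum_decomp (f n.+1 - f n) ((1 / 2) ^+ n *: p) ((1 / 2) ^+ n *: q).
  - exact: vscale_ge0.
  - exact: vscale_ge0.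
  - rewrite !linearZ -scalerDr; apply: (le_trans (fS n)); apply: vleZ => //.
    exact: le_trans (vabs_ler _) epq.
  by exists (a, b).
have [A hA] := @qnorm_series R X0 (fun n => (ab n).1) p p0 (fun n => let: And3 _ h _ := abP n in h).
have [B hB] := @qnorm_series R X1 (fun n => (ab n).2) q q0 (fun n => let: And3 _ _ h := abP n in h).
pose g := f 0%N + (j0 A + j1 B).
have fm m : f m = f 0%N + (j0 (\sum_(0 <= i < m) (ab i).1) + j1 (\sum_(0 <= i < m) (ab i).2)).
  rewrite !linear_sum -big_split/= (eq_bigr (fun i => f i.+1 - f i)); last first.
    by move=> i _; have [-> _ _] := abP i.
  by rewrite telescope_sumr// addrC subrK.
have gfm m : g - f m = j0 (A - \sum_(0 <= i < m) (ab i).1) + j1 (B - \sum_(0 <= i < m) (ab i).2).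
  by rewrite fm /g opprD addrACA subrr add0r !linearB opprD addrACA.
have gf n : vabs (g - f n) <= (2 * (1 / 2) ^+ n) *: e.
  apply: (locally_solid_le hX) => U /nbhs0_add[W nW WU].
  have [d0 d0p dW0] := emb_small h0 nW; have [d1 d1p dW1] := emb_small h1 nW.
  have [N0 hN0] := hA d0 d0p; have [N1 hN1] := hB d1 d1p.
  pose m := (n + (N0 + N1))%N.
  exists (vabs (g - f m)).
    rewrite gfm; apply: WU; [apply: dW0; apply: hN0|apply: dW1; apply: hN1].
      by rewrite /m addnCA leq_addr.
    by rewrite /m addnA leq_addl.
  rewrite [leRHS]addrC -[g - f n](subrK (g - f m)) [X in vabs X]addrC.
  apply: (le_trans (vabsD _ _)); rewrite vleD2l opprB [X in vabs X]addrC addrA subrK.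
  have := vabs_sum_geometric e0 fS n (N0 + N1).
  by rewrite telescope_sumr// leq_addr.
exists g => //.
have ig : ideal e (g - f 0%N) by exists (2 * (1 / 2) ^+ 0); exact: gf.
by rewrite -(subrK (f 0%N) g); apply: idealD.
Qed.

Context {phi : R -> R -> R}.
Hypothesis hphi : class_P phi.

Lemma sum_join a b : 0 <= a -> S (vjoin (j0 a) (j1 b)) /\ 0 <= vjoin (j0 a) (j1 b).
Proof.
move=> a0; have ja : 0 <= j0 a by rewrite (emb_ge0 h0).
have e0 : 0 <= vjoin (j0 a) (j1 b) by exact: le_trans (vjoinl _ _).
split=> //; apply: (@sum_solid _ (vabs (j0 a) + vabs (j1 b))).
  by apply: sumD; apply: sum_abs; [exact: sum_inl|exact: sum_inr].
rewrite [leRHS]vabs_pos ?vaddr_ge0 ?vabs_ge0// vabs_pos//.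
rewrite vjoin_le -{1}[j0 a]addr0 -{2}[j1 b]add0r.
by rewrite !vleD ?vabs_ler ?vabs_ge0.
Qed.

Lemma pair_principal a b : 0 <= a ->
  principal_ideal S (vjoin (j0 a) (j1 b)) = ideal (vjoin (j0 a) (j1 b)).
Proof. by move=> /(sum_join b)[]; exact: sum_principal. Qed.

Lemma pair_krivine_exists a b : 0 <= a -> 0 <= b ->
  exists z, krivine S phi (j0 a) (j1 b) z.
Proof.
move=> a0 b0; have ja : 0 <= j0 a by rewrite (emb_ge0 h0).
have jb : 0 <= j1 b by rewrite (emb_ge0 h1).
apply: (krivine_exists hphi ja jb pair_archimedean); last exact: pair_principal.
by have [] := sum_join b a0; exact: sum_uniformly_complete.
Qed.

End CompatiblePair.

(** * Dyadic nodes of a quasi-concave function *)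

Lemma ex_minimum (P : nat -> Prop) : (exists n, P n) ->
  exists2 n, P n & forall m, P m -> (n <= m)%N.
Proof.
move=> [n0 Pn0]; have ex : exists n, `[< P n >] by exists n0; exact/asboolP.
by case: (ex_minnP ex) => n /asboolP Pn nmin; exists n => // m /asboolP; exact: nmin.
Qed.

(** Let a1 be a column containing a point of least height. A point to its right lies no lower than
    the lowest point of column a1, and a point in a column a <= a1 no lower than the lowest point of
    its own column; these finitely many lowest points suffice. *)
Lemma dickson2 (P : nat -> nat -> Prop) : exists D : seq (nat * nat),
  (forall d, d \in D -> P d.1 d.2) /\
  forall a b, P a b -> exists2 d, d \in D & (d.1 <= a)%N /\ (d.2 <= b)%N.
Proof.
have [[b0 [a0 Pab0]]|nP] := pselect (exists b a, P a b); last first.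
  by exists [::]; split=> // a b Pab; exfalso; apply: nP; exists b, a.
have [b1 [a1 Pab1] b1min] := @ex_minimum (fun b => exists a, P a b) (ex_intro _ b0 (ex_intro _ a0 Pab0)).
have /choice[g gP] : forall a, exists b, (exists b', P a b') -> P a b /\ forall b', P a b' -> (b <= b')%N.
  move=> a; have [/ex_minimum[b Pb bmin]|nPa] := pselect (exists b', P a b'); last by exists 0%N.
  by exists b.
exists [seq (a, g a) | a <- iota 0 a1.+1 & `[< exists b, P a b >]]; split.
  by move=> _ /mapP[a + ->]; rewrite mem_filter => /andP[/asboolP Pa _]; have [] := gP a Pa.
move=> a b Pab.
have mem a' : (a' <= a1)%N -> (exists b', P a' b') ->
    (a', g a') \in [seq (a, g a) | a <- iota 0 a1.+1 & `[< exists b, P a b >]].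
  by move=> aa Pa; apply: map_f; rewrite mem_filter mem_iota /= add0n ltnS aa andbT; apply/asboolP.
have [aa|aa] := leqP a a1.
  have Pa : exists b', P a b' by exists b.
  exists (a, g a); first exact: mem.
  by split=> //=; have [_ ->] := gP a Pa.
have Pa1 : exists b', P a1 b' by exists b1.
exists (a1, g a1); first exact: mem.
split=> /=; first exact: ltnW.
have [_ /(_ b1 Pab1)] := gP a1 Pa1; move/leq_trans; apply.
by apply: b1min; exists a.
Qed.

(** A dominating list of least length has no two comparable entries, since the larger one could be
    deleted. Incomparable pairs differ in both coordinates, and this injectivity makes the
    coefficients of the nodes lacunary. *)
Lemma dickson_antichain (P : nat -> nat -> Prop) :
  exists n (c d : 'I_n -> nat), [/\ injective c, injective d,
    forall i, P (c i) (d i) &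
    forall a b, P a b -> exists i, (c i <= a)%N /\ (d i <= b)%N].
Proof.
pose good (D : seq (nat * nat)) := (forall d, d \in D -> P d.1 d.2) /\
  forall a b, P a b -> exists2 d, d \in D & (d.1 <= a)%N /\ (d.2 <= b)%N.
have [D0 gD0] := dickson2 P.
have [n [D [Dn [DP Dc]]] nmin] := @ex_minimum (fun n => exists D, size D = n /\ good D)
  (ex_intro _ (size D0) (ex_intro _ D0 (conj erefl gD0))).
pose e (i : 'I_n) := nth (0%N, 0%N) D i.
have eD i : e i \in D by apply: mem_nth; rewrite Dn.
(* Stated for positions, so that repeated entries are excluded too. *)
have anti i j : ((e i).1 <= (e j).1)%N -> ((e i).2 <= (e j).2)%N -> i = j.
  move=> h1 h2; apply: contrapT => ij.
  have nij : val i != val j by apply/eqP => /val_inj.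
  pose D' := take j D ++ drop j.+1 D.
  have sD' : size D' = n.-1.
    rewrite size_cat size_take size_drop Dn ltn_ord subnS -subn1.
    by have := ltn_ord j; lia.
  have D'D x : x \in D' -> x \in D.
    by rewrite mem_cat => /orP[/mem_take|/mem_drop].
  have DD' x : x \in D -> x = e j \/ x \in D'.
    rewrite -{1}(cat_take_drop j D) (drop_nth (0%N, 0%N)) ?Dn//.
    by rewrite /D' !mem_cat in_cons => /or3P[->|/eqP ->|->]; rewrite ?orbT; [right|left|right].
  have iD' : e i \in D'.
    have [lij|lji] := ltnP i j.
      by rewrite /D' /e mem_cat -(nth_take (0%N, 0%N) lij) mem_nth// size_take Dn ltn_ord.
    rewrite /D' mem_cat; apply/orP; right.
    have ji : (j < i)%N by rewrite ltn_neqAle eq_sym nij.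
    rewrite /e -(subnKC ji) -nth_drop mem_nth// size_drop Dn.
    by rewrite ltn_sub2r// ?(leq_trans _ (ltn_ord i)).
  have := nmin (size D'); rewrite sD' => h.
  have : (n <= n.-1)%N.
    apply: h; exists D'; split=> //; split; first by move=> x /D'D; exact: DP.
    move=> a b /Dc[x /DD'[->|xD'] [xa xb]]; last by exists x.
    by exists (e i) => //; split; [exact: leq_trans xa|exact: leq_trans xb].
  by have := ltn_ord j; lia.
exists n, (fun i => (e i).1), (fun i => (e i).2); split.
- move=> i j /= cij; have [dij|/ltnW dji] := leqP (e i).2 (e j).2.
    by apply: anti; rewrite ?cij.
  by apply/esym/anti; rewrite ?cij.
- move=> i j /= dij; have [cij|/ltnW cji] := leqP (e i).1 (e j).1.
    by apply: anti; rewrite ?dij.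
  by apply/esym/anti; rewrite ?dij.
- by move=> i; exact: DP.
- move=> a b /Dc[x xD [xa xb]].
  have ix : (index x D < n)%N by rewrite -Dn index_mem.
  by exists (Ordinal ix); rewrite /e /= nth_index.
Qed.

(** * Lacunary sums of nodes *)

Section Dyadic.
Context {R : realType}.
Implicit Types L r x s t M : R.

(** L is the largest value and the exponent lowers it, so minimal pairs of exponents belong to
    maximal nodes. *)
Definition dyadic L (c : nat) : R := L * (1 / 2) ^+ c.

Lemma dyadic_gt0 L c : 0 < L -> 0 < dyadic L c.
Proof. by move=> L0; rewrite mulr_gt0// exprn_gt0// divr_gt0. Qed.

Lemma dyadicS L c : dyadic L c.+1 = dyadic L c / 2.
Proof. by rewrite /dyadic exprS; field. Qed.

Lemma dyadic_le L c c' : 0 < L -> (c <= c')%N -> dyadic L c' <= dyadic L c.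
Proof.
by move=> L0 cc; rewrite ler_pM2l// ler_wiXn2l//; lra.
Qed.

Lemma dyadic_lt L c c' : 0 < L -> (c < c')%N -> dyadic L c' <= dyadic L c / 2.
Proof. by move=> L0 cc; rewrite -dyadicS dyadic_le. Qed.

Lemma dyadic_approx L r : 0 < r -> r <= L ->
  exists2 c, dyadic L c <= r & r <= 2 * dyadic L c.
Proof.
move=> r0 rL.
have L0 : 0 < L by exact: lt_le_trans rL.
have : exists c, dyadic L c <= r.
  have : (L * (1 / 2 : R) ^+ n) @[n --> \oo] --> L * 0.
    by apply: cvgM; [exact: cvg_cst|apply: cvg_expr; rewrite ger0_norm; lra].
  rewrite mulr0 => /cvgr_lt/(_ _ r0) [N _ hN]; exists N.
  exact: ltW (hN N (leqnn N)).
move=> /ex_minimum[[|c] hc cmin].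
  by exists 0%N => //; rewrite /dyadic expr0 mulr1; lra.
exists c.+1 => //; rewrite dyadicS mulrC divfK//.
by apply: ltW; rewrite ltNge; apply/negP => /cmin; rewrite ltnn.
Qed.

(** The exponents increase along r, so once the first term is at most M the later ones are at most M
    / 2, and the induction runs with M / 2. *)
Lemma dyadic_sum_sorted L x M (r : seq nat) : 0 < L -> 0 <= x ->
  sorted ltn r -> (forall i, i \in r -> dyadic L i * x <= M) ->
  0 <= M -> \sum_(i <- r) dyadic L i * x <= 2 * M.
Proof.
move=> L0 x0; elim: r M => [|i r IH] M; first by move=> _ _ M0; rewrite big_nil mulr_ge0.
rewrite /= => ir hr M0; rewrite big_cons.
have iM : dyadic L i * x <= M by apply: hr; rewrite mem_head.
have : \sum_(i <- r) dyadic L i * x <= 2 * (M / 2).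
  apply: IH; [exact: path_sorted ir| |exact: divr_ge0].
  move=> k kr; have ik : (i < k)%N by have /allP := order_path_min ltn_trans ir; apply.
  apply: le_trans (ler_wpM2r x0 (dyadic_lt L0 ik)) _.
  by rewrite mulrAC ler_pM2r ?invr_gt0.
lra.
Qed.

Lemma dyadic_sum L x M n (c : 'I_n -> nat) : 0 < L -> 0 <= x -> 0 <= M ->
  injective c ->
  \sum_(k < n | dyadic L (c k) * x <= M) dyadic L (c k) * x <= 2 * M.
Proof.
move=> L0 x0 M0 ci.
pose r := [seq c k | k <- enum 'I_n & dyadic L (c k) * x <= M].
have -> : \sum_(k < n | dyadic L (c k) * x <= M) dyadic L (c k) * x =
    \sum_(i <- sort leq r) dyadic L i * x.
  rewrite (perm_big r) ?perm_sort//= big_map big_filter.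
  by rewrite big_enum_cond.
apply: dyadic_sum_sorted => //.
  rewrite ltn_sorted_uniq_leq sort_uniq sort_sorted; last exact: leq_total.
  by rewrite andbT map_inj_uniq// filter_uniq// enum_uniq.
by move=> i; rewrite mem_sort => /mapP[k + ->]; rewrite mem_filter => /andP[].
Qed.

Lemma sum_indicator_le1 n (P : pred 'I_n) : (forall k l, P k -> P l -> k = l) ->
  \sum_(k < n) (P k)%:R <= 1 :> R.
Proof.
move=> Pu; have [[k Pk]|nP] := pselect (exists k, P k); last first.
  by rewrite big1// => k _; case: (boolP (P k)) => // Pk; exfalso; apply: nP; exists k.
rewrite (bigD1 k)//= Pk big1 ?addr0// => l lk.
by case: (boolP (P l)) => // Pl; rewrite (Pu l k) ?eqxx in lk.
Qed.

Lemma bigmax_attained n (F : 'I_n -> R) :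
  \big[Num.max/0]_(k < n) F k = 0 \/ exists k, \big[Num.max/0]_(k < n) F k = F k.
Proof.
elim/big_ind: _ => [|x y hx hy|k _]; [by left| |by right; exists k].
by have [_|_] := leP x y.
Qed.

Section Nodes.
Variables (L : R) (n : nat) (c d : 'I_n -> nat).
Hypotheses (L0 : 0 < L) (ci : injective c) (di : injective d).

Definition node (k : 'I_n) s t := Num.min (dyadic L (c k) * s) (dyadic L (d k) * t).

Lemma node_ge0 k s t : 0 <= s -> 0 <= t -> 0 <= node k s t.
Proof.
by move=> s0 t0; rewrite le_min; apply/andP; split; apply: mulr_ge0 => //; apply: ltW; exact: dyadic_gt0.
Qed.

(** A node bounded by M equals one of its two arguments, which is then at most M; the terms of
    either kind belong to a geometric sum of size at most 2 M. *)
Lemma node_sum s t M : 0 <= s -> 0 <= t -> 0 <= M ->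
  (forall k, node k s t <= M) -> \sum_(k < n) node k s t <= 4 * M.
Proof.
move=> s0 t0 M0 hM.
have := lerD (dyadic_sum L0 s0 M0 ci) (dyadic_sum L0 t0 M0 di).
rewrite (_ : 2 * M + 2 * M = 4 * M); last by lra.
apply: le_trans; rewrite !(big_mkcond (fun k => _ <= M)) -big_split/=.
apply: ler_sum => k _; have := hM k; rewrite /node.
have p := mulr_ge0 (ltW (dyadic_gt0 (c k) L0)) s0.
have q := mulr_ge0 (ltW (dyadic_gt0 (d k) L0)) t0.
have [h|h] := leP (dyadic L (c k) * s) (dyadic L (d k) * t) => ->.
  by case: ifP => _; lra.
by case: ifP => _; lra.
Qed.

(* Only terms with [M / 2 < dyadic L (c k) * s <= M] or the same for [d], [t]
   count, and by injectivity there is at most one of each kind. *)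
Lemma node_excess_sum s t M : 0 <= s -> 0 <= t ->
  (forall k, node k s t <= M) ->
  \sum_(k < n) (dyadic L (c k))^-1 * Num.max (2 * node k s t - M) 0 <= 2 * s /\
  \sum_(k < n) (dyadic L (d k))^-1 * Num.max (2 * node k s t - M) 0 <= 2 * t.
Proof.
move=> s0 t0 hM.
pose P (e : 'I_n -> nat) x k := (M / 2 < dyadic L (e k) * x) && (dyadic L (e k) * x <= M).
have P1 e x : injective e -> 0 <= x -> \sum_(k < n) (P e x k)%:R <= 1 :> R.
  move=> ei x0; apply: sum_indicator_le1 => k l /andP[k1 k2] /andP[l1 l2].
  apply: ei; have [kl|lk|//] := ltngtP (e k) (e l).
    by exfalso; have := ler_wpM2r x0 (dyadic_lt L0 kl); lra.
  by exfalso; have := ler_wpM2r x0 (dyadic_lt L0 lk); lra.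
have Pn : \sum_(k < n) ((P c s k)%:R + (P d t k)%:R) <= 2 :> R.
  by rewrite big_split/=; have := P1 _ _ ci s0; have := P1 _ _ di t0; lra.
have bound k : Num.max (2 * node k s t - M) 0 <= node k s t * ((P c s k)%:R + (P d t k)%:R).
  have n0 := node_ge0 k s0 t0.
  have [h|h] := leP (2 * node k s t - M) 0.
    by rewrite mulr_ge0 ?addr_ge0.
  have kM := hM k.
  suff : P c s k || P d t k.
    move=> /orP[->|->]; rewrite mulrDr mulr1 -[leLHS]addr0.
      by apply: lerD; [lra|rewrite mulr_ge0].
    by rewrite addrC; apply: lerD; [rewrite mulr_ge0|lra].
  move: h kM; rewrite /node /P.
  have [h1|h1] := leP (dyadic L (c k) * s) (dyadic L (d k) * t) => h kM; apply/orP.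
    by left; apply/andP; split; lra.
  by right; apply/andP; split; lra.
have fin e x : 0 <= x -> (forall k, node k s t <= dyadic L (e k) * x) ->
    \sum_(k < n) (dyadic L (e k))^-1 * Num.max (2 * node k s t - M) 0 <= 2 * x.
  move=> x0 ex; apply: le_trans (_ : \sum_(k < n) x * ((P c s k)%:R + (P d t k)%:R) <= _).
    apply: ler_sum => k _; rewrite ler_pdivrMl ?dyadic_gt0// mulrA.
    by apply: le_trans (bound k) _; rewrite ler_wpM2r ?addr_ge0.
  by rewrite -mulr_sumr mulrC ler_wpM2r.
by split; apply: fin => // k; rewrite ge_min lexx ?orbT.
Qed.

End Nodes.
End Dyadic.

Section ClassNodes.
Context {R : realType} {phi : R -> R -> R}.
Hypothesis hphi : class_P phi.
Let phibar := quadrant_ext phi.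

(* The truncation at level [L] makes the set of dyadic pairs below the graph of
   [phi] bounded above, so that its Pareto frontier is finite. *)
Lemma class_nodes (L : R) : 0 < L -> exists n (c d : 'I_n -> nat),
  [/\ injective c, injective d,
    forall k s t, 0 <= s -> 0 <= t -> node L c d k s t <= phibar s t &
    forall s t, 0 <= s -> 0 <= t -> exists k,
      Num.min (phibar s t) (Num.min (L * s) (L * t)) <= 2 * node L c d k s t].
Proof.
move=> L0.
(* Both coefficients are tested at one ratio tau. This suffices for min(alpha s, beta t) <= phi(s,
   t) everywhere: if t >= tau s then alpha s <= phi(s, tau s), and otherwise beta t <= phi(t / tau,
   t). *)
pose P a b := exists2 tau : R, 0 < tau & dyadic L a <= phi 1 tau /\ dyadic L b <= phi 1 tau / tau.
have [n [c [d [ci di cdP cov]]]] := dickson_antichain P.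
have covpos s t : 0 < s -> 0 < t -> exists k,
      Num.min (phibar s t) (Num.min (L * s) (L * t)) <= 2 * node L c d k s t.
  move=> s0 t0; pose tau := t / s; have tau0 : 0 < tau by rewrite divr_gt0.
  have st : t = s * tau by rewrite /tau mulrCA divff ?mulr1// gt_eqF.
  have phiE : phibar s t = s * phi 1 tau.
    by rewrite /phibar (quadrant_ext_pos hphi)// -(class_P_homog hphi)// mulr1 -st.
  (* The truncated value at (1, tau). As r <= L and r / tau <= L, both have dyadic approximants of
     level L from below; these satisfy P at tau and are dominated by the coefficients of some
     node. *)
  pose r := Num.min (phi 1 tau) (Num.min L (L * tau)).
  have r0 : 0 < r.
    rewrite !lt_min L0 mulr_gt0// !andbT.
    apply: lt_le_trans (class_P_min hphi ltr01 tau0).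
    by rewrite lt_min ltr01.
  have rL : r <= L by rewrite !ge_min lexx !orbT.
  have rphi : r <= phi 1 tau by rewrite ge_min lexx.
  have rtL : r / tau <= L by rewrite ler_pdivrMr// !ge_min lexx !orbT.
  have minE : Num.min (phibar s t) (Num.min (L * s) (L * t)) = s * r.
    rewrite phiE st /r !minr_pMr ?ltW//; congr Num.min; congr Num.min; first by rewrite mulrC.
    by rewrite mulrCA.
  have [a ar ra] := dyadic_approx r0 rL.
  have [b br rb] := dyadic_approx (divr_gt0 r0 tau0) rtL.
  have [|k [ka kb]] := cov a b.
    exists tau => //; split; first exact: le_trans rphi.
    by apply: le_trans br _; rewrite ler_pM2r ?invr_gt0.
  have h1 : s * r <= 2 * (dyadic L (c k) * s).
    rewrite mulrA mulrC ler_pM2r//; apply: le_trans ra _.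
    by rewrite ler_pM2l//; exact: dyadic_le.
  have h2 : s * r <= 2 * (dyadic L (d k) * t).
    rewrite (_ : s * r = (r / tau) * t); last by rewrite {1}st mulrCA divfK ?gt_eqF// mulrC.
    rewrite mulrA ler_pM2r//; apply: le_trans rb _.
    by rewrite ler_pM2l//; exact: dyadic_le.
  exists k; rewrite minE /node.
  by have [_|_] := leP (dyadic L (c k) * s) (dyadic L (d k) * t).
exists n, c, d; split=> //.
- move=> k s t; rewrite le_eqVlt => /orP[/eqP<- t0|s0].
    by rewrite /node mulr0 ge_min (quadrant_ext_ge0 hphi).
  rewrite le_eqVlt => /orP[/eqP<-|t0].
    rewrite /node mulr0 ge_min; apply/orP; right.
    by apply: (quadrant_ext_ge0 hphi) => //; exact: ltW.
  have [tau tau0 [h1 h2]] := cdP k.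
  rewrite /phibar (quadrant_ext_pos hphi)// /node ge_min; apply/orP.
  have [tle|tgt] := leP (tau * s) t; [left|right].
    rewrite mulrC; apply: le_trans (ler_wpM2l (ltW s0) h1) _.
    rewrite -(class_P_homog hphi)// mulr1.
    by apply: (class_P_ndecr hphi); rewrite ?mulr_gt0// mulrC.
  apply: le_trans (ler_wpM2r (ltW t0) h2) _.
  rewrite mulrAC -mulrA mulrC -(class_P_homog hphi) ?divr_gt0// mulr1 divfK ?gt_eqF//.
  apply: (class_P_ndecr hphi); rewrite ?divr_gt0//.
  by rewrite ler_pdivrMr// mulrC; exact: ltW.
- move=> s t; rewrite le_eqVlt => /orP[/eqP<- t0|s0].
    have [k _] := covpos 1 1 ltr01 ltr01; exists k.
    apply: (@le_trans _ _ 0); first by rewrite mulr0 !ge_min lexx orbT.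
    by rewrite mulr_ge0// node_ge0.
  rewrite le_eqVlt => /orP[/eqP<-|t0]; last exact: covpos.
  have [k _] := covpos 1 1 ltr01 ltr01; exists k.
  apply: (@le_trans _ _ 0); first by rewrite mulr0 !ge_min lexx !orbT.
  by apply: mulr_ge0 => //; apply: node_ge0 => //; exact: ltW.
Qed.

End ClassNodes.

(** * The Calderon-Lozanovskii space *)

Definition triangle_const (R : realType) (E : quasiBanachLatticeType R) (C : R) :=
  forall x y : E, qnorm (x + y) <= C * (qnorm x + qnorm y).

Section QuasiSeries.
Context {R : realType} {E : quasiBanachLatticeType R} {C : R}.
Hypotheses (C1 : 1 <= C) (hC : triangle_const E C).

Lemma qnormN (x : E) : qnorm (- x) = qnorm x.
Proof. by rewrite -scaleN1r qnormZ normrN normr1 mul1r. Qed.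

Let r := (2 * C)^-1.

Let C0 : 0 < C. Proof. exact: lt_le_trans ltr01 C1. Qed.

Let r0 : 0 < r. Proof. by rewrite invr_gt0 mulr_gt0. Qed.

(** A quasi-norm need not be continuous, but it is monotone: the positive part of x - l is dominated
    by |s n - l| and so has arbitrarily small quasi-norm. *)
Lemma qnorm_limit_le (s : nat -> E) (l x : E) (N : nat) :
  (forall d : R, 0 < d -> exists N : nat, forall n, (N <= n)%N -> qnorm (l - s n) < d) ->
  (forall n, (N <= n)%N -> x <= s n) -> x <= l.
Proof.
move=> hl xs; rewrite -vsubr_ge0 -vleN oppr0 opprB.
apply: (le_trans (vjoinl _ 0)); rewrite -/(vpos _).
suff -> : vpos (x - l) = 0 by [].
apply: qnorm_eq0; apply/le_anti; rewrite qnorm_ge0 andbT.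
apply/ler_addgt0Pr => d d0; rewrite add0r.
have [N' hN'] := hl d d0; pose n := maxn N N'.
apply: le_trans (ltW (hN' n (leq_maxr _ _))); rewrite -(qnormN (l - _)) -(qnorm_abs (- _)).
apply: qnorm_le; first exact: vpos_ge0.
rewrite vjoin_le vabs_ge0 andbT opprB (le_trans _ (vabs_ler _))// vleD2r.
by apply: xs; exact: leq_maxl.
Qed.

(** A is the sum of the series of (2 C)^-i a i. The weights absorb the factor C that the
    quasi-triangle inequality costs for each term split off. *)
Lemma weighted_upper_bound (a : nat -> E) :
  (forall n, 0 <= a n) -> (forall n, qnorm (a n) <= 1) ->
  exists A, [/\ 0 <= A, qnorm A <= 3 * C ^+ 2 & forall n, a n <= (2 * C) ^+ n *: A].
Proof.
move=> a0 a1; pose s n := \sum_(0 <= i < n) r ^+ i *: a i.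
have rn n : 0 < r ^+ n by exact: exprn_gt0.
(* The bound reproduces itself: C (r^m + 2 C r^(m+1)) = 2 C r^m, because 2 C r = 1. *)
have tail k : forall m, qnorm (\sum_(m <= i < m + k) r ^+ i *: a i) <= 2 * C * r ^+ m.
  elim: k => [|k IH] m.
    by rewrite addn0 big_geq// qnorm0 mulr_ge0 ?ltW// mulr_gt0.
  rewrite -addSnnS big_ltn ?ltn_addr//; apply: le_trans (hC _ _) _.
  have h1 : qnorm (r ^+ m *: a m) <= r ^+ m.
    by rewrite (qnormZ_ge0 _ (ltW (rn m))) -[leRHS]mulr1 ler_pM2l.
  have h2 : 2 * C * r ^+ m.+1 = r ^+ m.
    by rewrite exprS mulrA /r divff ?mul1r// gt_eqF// mulr_gt0.
  have := IH m.+1; rewrite h2 => h3.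
  rewrite (_ : 2 * C * r ^+ m = C * (r ^+ m + r ^+ m)); last by ring.
  by rewrite ler_pM2l// lerD.
have sE m k : s (m + k)%N - s m = \sum_(m <= i < m + k) r ^+ i *: a i.
  by rewrite /s (@big_cat_nat _ _ _ m 0 (m + k))//= ?leq_addr// [X in X - _]addrC addrK.
have r1 : r < 1 by rewrite invf_lt1 ?mulr_gt0//; apply: lt_le_trans (_ : 2 <= _); rewrite ?ltr1n// ler_peMr.
have cvg0 : (2 * C * r ^+ n) @[n --> \oo] --> (0 : R).
  have -> : 0 = 2 * C * 0 :> R by rewrite mulr0.
  by apply: cvgM; [exact: cvg_cst|apply: cvg_expr; rewrite gtr0_norm].
have [|A hA] := @qnorm_complete R E s.
  move=> d d0; have [N _ hN] := cvgr_lt _ cvg0 d d0.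
  have hs m n : (N <= m)%N -> (m <= n)%N -> qnorm (s n - s m) < d.
    by move=> Nm mn; rewrite -(subnKC mn) sE; exact: le_lt_trans (tail _ _) (hN m Nm).
  exists N => m n Nm Nn; have [mn|/ltnW nm] := leqP m n; last exact: hs.
  by rewrite -qnormN opprB hs.
have hA' d : 0 < d -> exists N : nat, forall n, (N <= n)%N -> qnorm (A - s n) < d.
  move=> d0; have [N _ hN] := cvgr_lt _ hA d d0.
  by exists N => n Nn; rewrite -qnormN opprB; exact: hN.
have sge n m : (n < m)%N -> r ^+ n *: a n <= s m.
  move=> nm; rewrite /s big_mkord; have := @vle_sum1 R E m (fun i => r ^+ i *: a i) (Ordinal nm).
  by apply=> j; apply: vscale_ge0 => //; exact: ltW.
exists A; split.
- apply: (qnorm_limit_le (N := 0%N) hA') => n _.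
  by apply: vsumr_ge0 => i _; apply: vscale_ge0 => //; exact: ltW.
(* A is a remainder of size at most 1 plus a partial sum of size at most 2 C, hence C (1 + 2 C) <= 3
   C^2. *)
- have [N /(_ N (leqnn N)) hN] := hA' 1 ltr01.
  rewrite -(subrK (s N) A); apply: le_trans (hC _ _) _.
  have := tail N 0%N; rewrite add0n expr0 mulr1 => h.
  rewrite (_ : 3 * C ^+ 2 = C * (C + 2 * C)); last by ring.
  by rewrite ler_pM2l//; apply: lerD => //; apply: le_trans C1; exact: ltW.
- move=> n; rewrite -(@vleZ2l _ _ (r ^+ n))// scalerA -exprMn /r mulVf ?expr1n ?scale1r; last by rewrite gt_eqF// mulr_gt0.
  by apply: (qnorm_limit_le (N := n.+1) hA') => m; exact: sge.
Qed.

End QuasiSeries.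

(** The elements phi(a, b) themselves, not what they dominate: norm estimates take the form |x| <= l
    z with z in this set, so that dominating elements can be merged. *)
Definition CL_ball (R : realType) (X0 X1 : quasiBanachLatticeType R)
    (X : locallySolidType R) (j0 : X0 -> X) (j1 : X1 -> X) (phi : R -> R -> R) : set X :=
  [set z | exists a b, [/\ 0 <= a /\ 0 <= b, qnorm a <= 1, qnorm b <= 1
    & krivine (sum_space j0 j1) phi (j0 a) (j1 b) z]].

Section CalderonLozanovskii.
Context {R : realType} {X0 X1 : quasiBanachLatticeType R}
  {X : locallySolidType R} {j0 : {linear X0 -> X}} {j1 : {linear X1 -> X}}.
Hypothesis hc : compatible_pair j0 j1.
Context {phi : R -> R -> R}.
Hypothesis hphi : class_P phi.

Let h0 := compatible_emb0 hc.
Let h1 := compatible_emb1 hc.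
Let arch := pair_archimedean hc.
Notation kriv := (krivine (sum_space j0 j1) phi).
Notation ball := (CL_ball j0 j1 phi).

Lemma pair_char a b z (E : X) w : kriv (j0 a) (j1 b) z -> 0 <= a -> 0 <= b ->
  0 <= E -> ideal E (j0 a) -> ideal E (j1 b) -> character E w ->
  w z = quadrant_ext phi (w (j0 a)) (w (j1 b)).
Proof.
move=> kz a0 b0; apply: (krivine_char hphi (pair_principal hc b a0) kz).
  by rewrite (emb_ge0 h0).
by rewrite (emb_ge0 h1).
Qed.

Lemma pair_ideal a b z (E : X) : kriv (j0 a) (j1 b) z -> 0 <= a -> 0 <= b ->
  ideal E (j0 a) -> ideal E (j1 b) -> ideal E z.
Proof.
move=> kz a0 b0 ia ib.
have e0 : 0 <= vjoin (j0 a) (j1 b) by apply: le_trans (vjoinl _ _); rewrite (emb_ge0 h0).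
by apply: (ideal_trans e0 (ideal_join ia ib)); exact: krivine_ideal (pair_principal hc b a0) kz.
Qed.

(** Provides one ideal containing the arguments of two Krivine elements, so that both are evaluated
    at the same characters. *)
Lemma ideal_sub4 (a b c d : X) : 0 <= a -> 0 <= b -> 0 <= c -> 0 <= d ->
  let E := a + b + c + d in
  [/\ 0 <= E, ideal E a, ideal E b, ideal E c & ideal E d].
Proof.
move=> a0 b0 c0 d0 E; have E0 : 0 <= E by rewrite !vaddr_ge0.
have iE := ideal_self E0; split=> //; apply: (ideal_between _ _ iE) => //.
- by rewrite /E -!addrA -[leLHS]addr0 vleD2l !vaddr_ge0.
- by rewrite /E -addrA -addrA addrCA -[leLHS]addr0 vleD2l !vaddr_ge0.
- by rewrite /E addrAC -[leLHS]add0r vleD2r !vaddr_ge0.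
- by rewrite /E -[leLHS]add0r vleD2r !vaddr_ge0.
Qed.

Lemma kriv_le (c : R) a b z a' b' z' : 0 <= c -> 0 <= a -> 0 <= b ->
  kriv (j0 a) (j1 b) z -> kriv (j0 a') (j1 b') z' ->
  0 <= a' -> 0 <= b' -> a <= c *: a' -> b <= c *: b' -> z <= c *: z'.
Proof.
move=> c0 a0 b0 kz kz' a'0 b'0 aa bb.
have ja : 0 <= j0 a by rewrite (emb_ge0 h0).
have jb : 0 <= j1 b by rewrite (emb_ge0 h1).
have ja' : 0 <= j0 a' by rewrite (emb_ge0 h0).
have jb' : 0 <= j1 b' by rewrite (emb_ge0 h1).
have [E0 ia ib ia' ib'] := ideal_sub4 ja jb ja' jb'.
set E := (_ + _) in E0 ia ib ia' ib'.
have iz := pair_ideal kz a0 b0 ia ib; have iz' := pair_ideal kz' a'0 b'0 ia' ib'.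
apply: (char_leP E0 arch iz (idealZ c iz')) => w cw.
rewrite (charZ cw)// (pair_char kz a0 b0 E0 ia ib cw) (pair_char kz' a'0 b'0 E0 ia' ib' cw).
rewrite -(quadrant_ext_homog hphi) ?(char_ge0 cw)// -!(charZ cw)//.
by apply: (quadrant_ext_ndecr hphi); rewrite ?(char_ge0 cw)//; apply: (char_le cw) => //;
  rewrite -?linearZ ?(emb_le h0) ?(emb_le h1)// linearZ; apply: idealZ.
Qed.

Lemma kriv_bound a b z : 0 <= a -> 0 <= b -> kriv (j0 a) (j1 b) z ->
  0 <= z /\ z <= j0 a + j1 b.
Proof.
move=> a0 b0 kz.
have ja : 0 <= j0 a by rewrite (emb_ge0 h0).
have jb : 0 <= j1 b by rewrite (emb_ge0 h1).
have [E0 ia ib _ _] := ideal_sub4 ja jb ja jb.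
set E := (_ + _) in E0 ia ib.
have iz := pair_ideal kz a0 b0 ia ib.
split.
  apply: (char_leP E0 arch (ideal0 E) iz) => w cw.
  rewrite (char0 cw) (pair_char kz a0 b0 E0 ia ib cw).
  by rewrite (quadrant_ext_ge0 hphi)// (char_ge0 cw).
apply: (char_leP E0 arch iz (idealD ia ib)) => w cw.
rewrite (pair_char kz a0 b0 E0 ia ib cw) (charD cw)//.
have wa := char_ge0 cw ja ia; have wb := char_ge0 cw jb ib.
apply: le_trans (quadrant_ext_max hphi wa wb) _.
by rewrite ge_max; apply/andP; split; lra.
Qed.

Lemma kriv_ball a b z r : 0 < r -> 0 <= a -> 0 <= b -> qnorm a <= r -> qnorm b <= r ->
  kriv (j0 a) (j1 b) z -> exists2 z', ball z' & z <= r *: z'.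
Proof.
move=> r0 a0 b0 ar br kz.
have r'0 : 0 <= r^-1 by rewrite invr_ge0 ltW.
have a'0 := vscale_ge0 r'0 a0; have b'0 := vscale_ge0 r'0 b0.
have [z' kz'] := pair_krivine_exists hc hphi a'0 b'0.
exists z'; first by exists (r^-1 *: a), (r^-1 *: b); split=> //;
  rewrite qnormZ_ge0// ler_pdivrMl// mulr1.
apply: (kriv_le (ltW r0) a0 b0 kz kz' a'0 b'0).
- by rewrite scalerKV// gt_eqF.
- by rewrite scalerKV// gt_eqF.
Qed.

Lemma ball_ge0 z : ball z -> 0 <= z.
Proof. by move=> [a [b [[a0 b0] _ _ kz]]]; have [] := kriv_bound a0 b0 kz. Qed.

Lemma ball_sum_space z x (c : R) : ball z -> vabs x <= c *: z -> sum_space j0 j1 x.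
Proof.
move=> bz xz; have z0 := ball_ge0 bz; have [a [b [[a0 b0] _ _ kz]]] := bz.
have [_ zab] := kriv_bound a0 b0 kz.
apply: (sum_solid hc (y := c *: z)); last exact: le_trans xz (vabs_ler _).
apply: (sumZ); apply: (sum_solid hc (y := j0 a + j1 b)); first by exists a, b.
by rewrite !vabs_pos// (le_trans z0).
Qed.

Context {C : R}.
Hypotheses (C1 : 1 <= C) (hC0 : triangle_const X0 C) (hC1 : triangle_const X1 C).

(** Substitute for convexity of the unit ball: as phi is monotone and homogeneous, upper bounds A of
    the a n and B of the b n yield one element dominating all phi(a n, b n), with the exponential
    loss of [weighted_upper_bound]. *)
Lemma ball_merge (z : nat -> X) : (forall n, ball (z n)) ->
  exists2 z', ball z' & forall n, z n <= (3 * C ^+ 2 * (2 * C) ^+ n) *: z'.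
Proof.
move=> /choice[a /choice[b hz]].
have [|n|A [A0 AC aA]] := weighted_upper_bound C1 hC0 (a := a); try by have [[]] := hz n.
  by move=> n; have [[]] := hz n.
have [|n|B [B0 BC bB]] := weighted_upper_bound C1 hC1 (a := b); try by have [[]] := hz n.
  by move=> n; have [[]] := hz n.
have [z' kz'] := pair_krivine_exists hc hphi A0 B0.
have Cp : 0 < C := lt_le_trans ltr01 C1.
have r0 : 0 < 3 * C ^+ 2 by rewrite mulr_gt0// exprn_gt0.
have [z'' bz'' zz''] := kriv_ball r0 A0 B0 AC BC kz'.
exists z'' => // n; have [[a0 b0] _ _ kz] := hz n.
have cn : 0 <= (2 * C) ^+ n by rewrite exprn_ge0// mulr_ge0// ltW.
apply: le_trans (kriv_le cn a0 b0 kz kz' A0 B0 (aA n) (bB n)) _.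
by rewrite [X in X *: z'']mulrC -scalerA; exact: vleZ.
Qed.

Lemma ball0 : exists z, ball z.
Proof.
have [z kz] := pair_krivine_exists hc hphi (lexx (0 : X0)) (lexx (0 : X1)).
by exists z, 0, 0; split; rewrite ?qnorm0 ?ler01.
Qed.

(** The factor D depends on n but stays out of the final constant: it serves to show that sums are
    bounded and to choose approximations that already compensate for it. *)
Lemma ball_merge_fin n : exists2 D : R, 0 < D & forall z : 'I_n -> X,
  (forall i, ball (z i)) -> exists2 z', ball z' & forall i, z i <= D *: z'.
Proof.
pose g k := 3 * C ^+ 2 * (2 * C) ^+ k.
have Cp : 0 < C := lt_le_trans ltr01 C1.
have g0 k : 0 < g k by rewrite /g !mulr_gt0// exprn_gt0// mulr_gt0.
exists (1 + \sum_(i < n) g i).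
  by apply: ltr_wpDr => //; apply: sumr_ge0 => i _; exact: ltW.
move=> z hz; have [z0 bz0] := ball0.
have [k|z' bz' zz'] := @ball_merge (fun k => if insub k is Some i then z i else z0).
  by case: insubP.
exists z' => // i; have := zz' i; rewrite valK => /le_trans; apply.
apply: vleZr; first exact: ball_ge0.
rewrite -/(g i) (bigD1 i)//= addrCA lerDl addr_ge0//.
by apply: sumr_ge0 => j _; exact: ltW.
Qed.

Definition CL_bounds (x : X) : set R :=
  [set l | 0 < l /\ exists2 z, ball z & vabs x <= l *: z].

Lemma CL_qnormE x : CL_qnorm j0 j1 phi x = inf (CL_bounds x).
Proof.
congr inf; apply/seteqP; split=> l /= [l0].
  by move=> [a [b [z [ab a1 b1 kz xz]]]]; split=> //; exists z => //; exists a, b.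
by move=> [z [a [b [ab a1 b1 kz]]] xz]; split=> //; exists a, b, z.
Qed.

Lemma CL_qnorm_le x l : CL_bounds x l -> CL_qnorm j0 j1 phi x <= l.
Proof.
move=> xl; rewrite CL_qnormE; apply: ge_inf => //.
by exists 0 => l' [/ltW].
Qed.

Lemma CL_spaceP x : CL_space j0 j1 phi x <-> CL_bounds x !=set0.
Proof.
split=> [[_ [a [b [z [a0 b0 kz xz]]]]]|[l [l0 [z bz xz]]]].
  have qa := qnorm_ge0 a; have qb := qnorm_ge0 b.
  have r0 : 0 < 1 + qnorm a + qnorm b by lra.
  have [||z' bz' zz'] := kriv_ball r0 a0 b0 _ _ kz; [lra|lra|].
  by exists (1 + qnorm a + qnorm b); split=> //; exists z' => //; exact: le_trans zz'.
split; first exact: ball_sum_space bz xz.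
have [a [b [[a0 b0] _ _ kz]]] := bz.
have li0 : 0 <= l^-1 by rewrite invr_ge0 ltW.
have la0 := vscale_ge0 (ltW l0) a0; have lb0 := vscale_ge0 (ltW l0) b0.
have [z' kz'] := pair_krivine_exists hc hphi la0 lb0.
exists (l *: a), (l *: b), z'; split=> //; apply: (le_trans xz).
rewrite -[z'](@scalerKV _ _ l) ?gt_eqF//; apply: vleZ; first exact: ltW.
by apply: (kriv_le li0 a0 b0 kz kz' la0 lb0); rewrite scalerK ?gt_eqF.
Qed.

Lemma CL_qnorm_lt x e : CL_space j0 j1 phi x -> CL_qnorm j0 j1 phi x < e ->
  exists2 l, CL_bounds x l & l < e.
Proof.
move=> /CL_spaceP xne; rewrite CL_qnormE => xe.
have e0 : 0 < e - inf (CL_bounds x) by rewrite subr_gt0.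
have [|l xl] := inf_adherent (E := CL_bounds x) e0.
  by split=> //; exists 0 => l' [/ltW].
by rewrite addrC subrK; exists l.
Qed.

(** The normalization of phi gives phi(|x|, |x|) = |x|. *)
Lemma cap_CL x : cap_space j0 j1 x -> CL_space j0 j1 phi x.
Proof.
move=> [[x0 _ xE0] [x1 _ xE1]].
have p0 := vabs_ge0 x0; have p1 := vabs_ge0 x1.
split; first by rewrite -xE0; exact: sum_inl.
have [z kz] := pair_krivine_exists hc hphi p0 p1.
exists (vabs x0), (vabs x1), z; split=> //.
have [y0 y1] : j0 (vabs x0) = vabs x /\ j1 (vabs x1) = vabs x.
  by rewrite (emb_abs h0) (emb_abs h1) xE0 xE1.
have v0 := vabs_ge0 x.
have [E0 ia _ _ _] := ideal_sub4 v0 v0 v0 v0.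
set E := (_ + _) in E0 ia.
have ia0 : ideal E (j0 (vabs x0)) by rewrite y0.
have ia1 : ideal E (j1 (vabs x1)) by rewrite y1.
apply: (char_leP E0 arch ia (pair_ideal kz p0 p1 ia0 ia1)) => w cw.
rewrite (pair_char kz p0 p1 E0 ia0 ia1 cw) y0 y1 (quadrant_ext_diag hphi)//.
exact: (char_ge0 cw).
Qed.

Lemma CL_sum n (x : 'I_n -> X) : (forall i, CL_space j0 j1 phi (x i)) ->
  CL_bounds (\sum_(i < n) vabs (x i)) !=set0.
Proof.
move=> xCL.
have /choice[l /choice[z lz]] : forall i, exists l, exists z,
    [/\ 0 < l, ball z & vabs (x i) <= l *: z].
  by move=> i; have /CL_spaceP[l [l0 [z bz xz]]] := xCL i; exists l, z.
have [D D0 hD] := ball_merge_fin n.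
have [|w bw zw] := hD z; first by move=> i; have [] := lz i.
have s0 : 0 <= \sum_(i < n) l i * D.
  by apply: sumr_ge0 => i _; have [/ltW li _ _] := lz i; rewrite mulr_ge0// ltW.
exists (1 + \sum_(i < n) l i * D); split; first exact: ltr_pwDl.
exists w => //; rewrite vabs_pos; last by apply: vsumr_ge0 => i _; exact: vabs_ge0.
rewrite scalerDl scaler_suml -[leLHS]add0r; apply: vleD.
  by apply: vscale_ge0 => //; exact: ball_ge0.
apply: vler_sum => i _; have [/ltW li _ xz] := lz i; apply: (le_trans xz).
by rewrite -scalerA; apply: vleZ.
Qed.

Lemma CL_sub x y : CL_space j0 j1 phi x -> CL_space j0 j1 phi y ->
  CL_space j0 j1 phi (x - y).
Proof.
move=> cx cy; apply/CL_spaceP.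
have [|l [l0 [z bz xz]]] := @CL_sum 2 (fun i => if i == ord0 then x else y).
  by move=> i; case: ifP.
exists l; split=> //; exists z => //; apply: le_trans xz; rewrite [leRHS]vabs_pos.
  by rewrite !big_ord_recl big_ord0 addr0/=; exact: (vabsB x y).
by apply: vsumr_ge0 => i _; exact: vabs_ge0.
Qed.

Lemma CL0_approx n (x : 'I_n -> X) (d : R) :
  (forall i, CL0_space j0 j1 phi (x i)) -> 0 < d ->
  exists y : 'I_n -> X, (forall i, cap_space j0 j1 (y i)) /\
  exists2 z, ball z & \sum_(i < n) vabs (x i - y i) <= d *: z.
Proof.
move=> x0 d0.
have [D D0 hD] := ball_merge_fin n.
(* Merging multiplies each of the n errors by D, and n * (e * D) <= d; the 1 avoids division by 0
   for the empty family. *)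
pose e := d / ((1 + n%:R) * D).
have n0 : 0 < 1 + n%:R :> R by rewrite ltr_pwDl.
have e0 : 0 < e by rewrite divr_gt0// mulr_gt0.
have /choice[y /choice[z yz]] : forall i, exists y, exists z,
    [/\ cap_space j0 j1 y, ball z & vabs (x i - y) <= e *: z].
  move=> i; have [xCL /(_ e e0)[y cy xy]] := x0 i.
  have [l [l0 [z bz xz]] le] := CL_qnorm_lt (CL_sub xCL (cap_CL cy)) xy.
  exists y, z; split=> //; apply: (le_trans xz); apply: vleZr; last exact: ltW.
  exact: ball_ge0.
have [|w bw zw] := hD z; first by move=> i; have [] := yz i.
exists y; split; first by move=> i; have [] := yz i.
exists w => //; have w0 := ball_ge0 bw.
apply: (@le_trans _ _ (\sum_(i < n) (e * D) *: w)).
  apply: vler_sum => i _; have [_ _ xz] := yz i; apply: (le_trans xz).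
  by rewrite -scalerA; apply: vleZ => //; exact: ltW.
rewrite sumr_const card_ord -scaler_nat scalerA; apply: vleZr => //.
have -> : n%:R * (e * D) = d * (n%:R / (1 + n%:R)).
  by rewrite /e; field; rewrite !gt_eqF.
rewrite ger_pMr//.
by rewrite ler_pdivrMr// mul1r lerDr.
Qed.

End CalderonLozanovskii.

(** * Interpolation of regular operators *)

Lemma regular_bound_fin (R : realType) (V W : vectorLatticeType R)
    (nV : V -> R) (nW : W -> R) (T : V -> W) (K : R) (I : finType) (x : I -> V) :
  regular_bound [set: V] nV nW T K ->
  exists A, [/\ 0 <= A, forall i, vabs (T (x i)) <= A
    & nW A <= K * nV (\sum_i vabs (x i))].
Proof.
move=> hT; exists (\big[@vjoin R W/0]_(i < #|I|) vabs (T (x (enum_val i)))); split.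
- exact: bigjoin_ge0.
- move=> i; rewrite -(enum_rankK i).
  exact: (le_bigjoin (fun k : 'I_#|I| => vabs (T (x (enum_val k)))) (enum_rank i)).
- have -> : \sum_i vabs (x i) = \sum_(i < #|I|) vabs (x (enum_val i)).
    by rewrite (eq_bigl (fun i => i \in I))// big_enum_val.
  exact: (hT #|I| (fun i => x (enum_val i)) (fun=> Logic.I)).
Qed.

Section Decomposition.
Context {R : realType} {X0 X1 : quasiBanachLatticeType R}
  {X : locallySolidType R} {j0 : {linear X0 -> X}} {j1 : {linear X1 -> X}}.
Hypothesis hc : compatible_pair j0 j1.
Context {phi : R -> R -> R}.
Hypothesis hphi : class_P phi.

Let h0 := compatible_emb0 hc.
Let h1 := compatible_emb1 hc.
Notation kriv := (krivine (sum_space j0 j1) phi).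

(* The pieces [x i = \sum_k p i k] are localized where the k-th node dominates:
   with [m_k] the k-th node at [(j0 a, j1 b)] and [M] the join of all of them,
   [v k] is [(2 m_k - M)^+], and [M <= \sum_k v k]. *)
Lemma cap_decomposition n (x : 'I_n -> X) a b z (L : R) : 0 < L ->
  0 <= a -> 0 <= b -> kriv (j0 a) (j1 b) z ->
  \sum_(i < n) vabs (x i) <= z ->
  \sum_(i < n) vabs (x i) <= L *: j0 a ->
  \sum_(i < n) vabs (x i) <= L *: j1 b ->
  exists m (c d : 'I_m -> nat) (p : 'I_n -> 'I_m -> X0) (q : 'I_n -> 'I_m -> X1),
  [/\ injective c /\ injective d,
    forall k s t, 0 <= s -> 0 <= t -> node L c d k s t <= quadrant_ext phi s t,
    forall i, x i = \sum_(k < m) j0 (p i k),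
    forall i k, j0 (p i k) = j1 (q i k) &
    \sum_(i < n) \sum_(k < m) vabs ((dyadic L (c k))^-1 *: p i k) <= 4 *: a /\
    \sum_(i < n) \sum_(k < m) vabs ((dyadic L (d k))^-1 *: q i k) <= 4 *: b].
Proof.
move=> L0 a0 b0 kz uz ua ub.
have [m [c [d [ci di nle ncov]]]] := class_nodes hphi L0.
have ja : 0 <= j0 a by rewrite (emb_ge0 h0).
have jb : 0 <= j1 b by rewrite (emb_ge0 h1).
have [E0 ia ib _ _] := ideal_sub4 ja jb ja jb.
set E := (_ + _) in E0 ia ib.
pose al k := dyadic L (c k); pose be k := dyadic L (d k).
have al0 k : 0 < al k by exact: dyadic_gt0.
have be0 k : 0 < be k by exact: dyadic_gt0.
pose mk k := vmeet (al k *: j0 a) (be k *: j1 b).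
pose M := \big[@vjoin R X/0]_(k < m) mk k.
pose v k := vjoin (2 *: mk k - M) 0.
set u := \sum_(i < n) vabs (x i) in uz ua ub.
have u0 : 0 <= u by apply: vsumr_ge0 => i _; exact: vabs_ge0.
have iz := pair_ideal hc kz a0 b0 ia ib.
have iu : ideal E u by exact: ideal_between iz.
have imk k : ideal E (mk k) by apply: ideal_meet; exact: idealZ.
have iM : ideal E M by apply: ideal_bigjoin.
have iv k : ideal E (v k) by apply: ideal_join (ideal0 E); apply: idealB => //; exact: idealZ.
have v0 k : 0 <= v k by exact: vjoinr.
have wmk w k : character E w -> w (mk k) = node L c d k (w (j0 a)) (w (j1 b)).
  by move=> cw; rewrite (char_meet cw) ?(charZ cw)//; exact: idealZ.
have wM w : character E w -> w M = \big[Num.max/0]_(k < m) node L c d k (w (j0 a)) (w (j1 b)).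
  by move=> cw; rewrite (char_bigjoin cw)//; apply: eq_bigr => k _; exact: wmk.
have wv w k : character E w ->
    w (v k) = Num.max (2 * node L c d k (w (j0 a)) (w (j1 b)) - w M) 0.
  move=> cw; have i2 : ideal E (2 *: mk k) by exact: idealZ.
  rewrite (char_join cw (idealB i2 iM) (ideal0 E)) (char0 cw) (charB cw i2 iM).
  by rewrite (charZ cw 2 (imk k)) wmk.
have wnode w k : character E w -> node L c d k (w (j0 a)) (w (j1 b)) <= w M.
  by move=> cw; rewrite wM//; exact: (le_bigmax 0 (fun k => node L c d k (w (j0 a)) (w (j1 b)))).
have uv : u <= \sum_(k < m) 2 *: v k.
  have iS : ideal E (\sum_(k < m) 2 *: v k) by apply: ideal_sum => k _; exact: (idealZ _ (iv k)).
  apply: (char_leP E0 (pair_archimedean hc) iu iS) => w cw.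
  rewrite [leRHS](char_sum cw) => [|k]; last exact: (idealZ _ (iv k)).
  under eq_bigr do rewrite (charZ cw)//.
  rewrite -mulr_sumr.
  have wa := char_ge0 cw ja ia; have wb := char_ge0 cw jb ib.
  have [k hk] := ncov _ _ wa wb.
  have wu : w u <= 2 * w M.
    apply: (@le_trans _ _ (2 * node L c d k (w (j0 a)) (w (j1 b)))); last first.
      by rewrite ler_pM2l//; exact: wnode.
    apply: le_trans hk; rewrite !le_min -!(charZ cw)//; apply/and3P; split.
    - rewrite -(pair_char hc hphi kz a0 b0 E0 ia ib cw).
      exact: (char_le cw iu iz uz).
    - exact: (char_le cw iu (idealZ L ia) ua).
    - exact: (char_le cw iu (idealZ L ib) ub).
  apply: (le_trans wu); rewrite ler_pM2l//.
  have wv0 l : 0 <= w (v l) by exact: (char_ge0 cw (v0 l) (iv l)).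
  (* At a character M is the value of some node l, where 2 m_l - M = M; the alternative M = 0 comes
     from starting the maximum at 0. *)
  have := bigmax_attained (fun k => node L c d k (w (j0 a)) (w (j1 b))).
  rewrite -wM// => -[->|[l wl]]; first exact: sumr_ge0.
  rewrite (bigD1 l)//= -[leLHS]addr0; apply: lerD; last exact: sumr_ge0.
  by rewrite wv// -wl le_max; apply/orP; left; lra.
have excess w : character E w ->
    \sum_(k < m) (al k)^-1 * w (v k) <= 2 * w (j0 a) /\
    \sum_(k < m) (be k)^-1 * w (v k) <= 2 * w (j1 b).
  move=> cw.
  have wa := char_ge0 cw ja ia; have wb := char_ge0 cw jb ib.
  have [H1 H2] := node_excess_sum L0 ci di wa wb (fun k => wnode w k cw).
  by split; [move: H1|move: H2]; under eq_bigr do rewrite -wv//.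
have va : \sum_(k < m) (al k)^-1 *: v k <= 2 *: j0 a.
  have iS : ideal E (\sum_(k < m) (al k)^-1 *: v k) by apply: ideal_sum => k _; exact: (idealZ _ (iv k)).
  apply: (char_leP E0 (pair_archimedean hc) iS (idealZ 2 ia)) => w cw.
  rewrite (char_sum cw) => [|k]; last exact: (idealZ _ (iv k)).
  under eq_bigr do rewrite (charZ cw)//.
  by rewrite (charZ cw)//; have [] := excess w cw.
have vb : \sum_(k < m) (be k)^-1 *: v k <= 2 *: j1 b.
  have iS : ideal E (\sum_(k < m) (be k)^-1 *: v k) by apply: ideal_sum => k _; exact: (idealZ _ (iv k)).
  apply: (char_leP E0 (pair_archimedean hc) iS (idealZ 2 ib)) => w cw.
  rewrite (char_sum cw) => [|k]; last exact: (idealZ _ (iv k)).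
  under eq_bigr do rewrite (charZ cw)//.
  by rewrite (charZ cw)//; have [] := excess w cw.
have [k|y [xy yv]] := riesz_family (w := fun k => 2 *: v k) _ uv; first exact: vscale_ge0.
(* Serves to place each single piece in both embedded spaces, through [emb_solid]. *)
have yle (e : 'I_m -> R) (g : X) i k : (forall k, 0 < e k) ->
    \sum_(k < m) (e k)^-1 *: v k <= 2 *: g -> vabs (y i k) <= e k *: (4 *: g).
  move=> e0 eg; have ei0 l : 0 <= (e l)^-1 by rewrite invr_ge0 ltW.
  rewrite -(@vleZ2l _ _ (e k)^-1) ?invr_gt0// scalerK ?gt_eqF//.
  rewrite (_ : 4 *: g = 2 *: (2 *: g)); last by rewrite scalerA; congr (_ *: _); ring.
  apply: (@le_trans _ _ (2 *: ((e k)^-1 *: v k))); last first.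
    apply: vleZ => //; apply: le_trans eg.
    by apply: (@vle_sum1 _ _ _ (fun k => (e k)^-1 *: v k)) => l; exact: vscale_ge0.
  rewrite scalerA mulrC -scalerA; apply: vleZ => //.
  apply: le_trans (yv k); apply: (@vle_sum1 _ _ _ (fun i => vabs (y i k))) => l; exact: vabs_ge0.
have /choice[p /choice[q pq]] : forall i, exists pi, exists qi, forall k : 'I_m,
    y i k = j0 (pi k) /\ y i k = j1 (qi k).
  move=> i.
  have /choice[f hf] : forall k, exists p, y i k = j0 p.
    move=> k; have h : vabs (y i k) <= j0 (al k *: (4 *: a)) by rewrite !linearZ; exact: yle.
    by have [p yp _] := emb_solid h0 h; exists p.
  have /choice[g hg] : forall k, exists p, y i k = j1 p.
    move=> k; have h : vabs (y i k) <= j1 (be k *: (4 *: b)) by rewrite !linearZ; exact: yle.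
    by have [p yp _] := emb_solid h1 h; exists p.
  by exists f, g.
(* The factor 4 is 2 from splitting along 2 v_k times 2 from the excess estimate. *)
have sumle (e : 'I_m -> R) (g : X) : (forall k, 0 < e k) ->
    \sum_(k < m) (e k)^-1 *: v k <= 2 *: g ->
    \sum_(i < n) \sum_(k < m) vabs ((e k)^-1 *: y i k) <= 4 *: g.
  move=> e0 eg; have ei0 l : 0 <= (e l)^-1 by rewrite invr_ge0 ltW.
  rewrite exchange_big/= (_ : 4 *: g = 2 *: (2 *: g)); last by rewrite scalerA; congr (_ *: _); ring.
  apply: (@le_trans _ _ (2 *: \sum_(k < m) (e k)^-1 *: v k)); last exact: vleZ.
  rewrite scaler_sumr; apply: vler_sum => k _.
  rewrite scalerA mulrC -scalerA.
  under eq_bigr do rewrite vabsZ ger0_norm//.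
  by rewrite -scaler_sumr; apply: vleZ.
exists m, c, d, p, q; split=> //.
- by move=> i; rewrite xy; apply: eq_bigr => k _; have [] := pq i k.
- by move=> i k; have [<- <-] := pq i k.
- split.
    rewrite -(emb_le h0) linearZ linear_sum; apply: le_trans (sumle al _ al0 va).
    apply: vler_sum => i _; rewrite linear_sum; apply: vler_sum => k _.
    by rewrite (emb_abs h0) linearZ; have [<- _] := pq i k.
  rewrite -(emb_le h1) linearZ linear_sum; apply: le_trans (sumle be _ be0 vb).
  apply: vler_sum => i _; rewrite linear_sum; apply: vler_sum => k _.
  by rewrite (emb_abs h1) linearZ; have [_ <-] := pq i k.
Qed.

End Decomposition.

(** * The estimate on the intersection and on its closure *)

Section Interpolation.
Context {R : realType} {X0 X1 Y0 Y1 : quasiBanachLatticeType R}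
  {X Y : locallySolidType R}
  {j0 : {linear X0 -> X}} {j1 : {linear X1 -> X}}
  {k0 : {linear Y0 -> Y}} {k1 : {linear Y1 -> Y}}.
Hypotheses (hX : compatible_pair j0 j1) (hY : compatible_pair k0 k1).
Context {phi : R -> R -> R}.
Hypothesis hphi : class_P phi.
Context {T : X -> Y} {T0 : X0 -> Y0} {T1 : X1 -> Y1} {C K : R}.
Hypotheses (C1 : 1 <= C) (hCX0 : triangle_const X0 C) (hCX1 : triangle_const X1 C)
  (hCY0 : triangle_const Y0 C) (hCY1 : triangle_const Y1 C).
Hypothesis Tlin : linear_on (sum_space j0 j1) T.
Hypotheses (TT0 : forall x, T (j0 x) = k0 (T0 x)) (TT1 : forall x, T (j1 x) = k1 (T1 x)).
Hypotheses (K0 : 0 < K) (hK0 : regular_bound [set: X0] qnorm qnorm T0 K)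
  (hK1 : regular_bound [set: X1] qnorm qnorm T1 K).

Let hx0 := compatible_emb0 hX.
Let hx1 := compatible_emb1 hX.
Let hy0 := compatible_emb0 hY.
Let hy1 := compatible_emb1 hY.
Let Cp : 0 < C. Proof. exact: lt_le_trans ltr01 C1. Qed.
Notation SX := (sum_space j0 j1).
Notation ballX := (CL_ball j0 j1 phi).
Notation ballY := (CL_ball k0 k1 phi).

Let S0 : SX 0. Proof. by exists 0, 0; rewrite !linear0 addr0. Qed.

Lemma T_0 : T 0 = 0.
Proof.
have := Tlin 1 S0 S0.
by rewrite scaler0 addr0 scale1r => /eqP; rewrite -subr_eq subrr => /eqP.
Qed.

Lemma T_scale (c : R) x : SX x -> T (c *: x) = c *: T x.
Proof. by move=> Sx; rewrite -[c *: x]addr0 Tlin// T_0 addr0. Qed.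

Lemma T_add x y : SX x -> SX y -> T (x + y) = T x + T y.
Proof. by move=> Sx Sy; rewrite -[x]scale1r Tlin ?scale1r. Qed.

Lemma T_sub x y : SX x -> SX y -> T (x - y) = T x - T y.
Proof.
move=> Sx Sy; rewrite T_add//; last exact: sumN.
by rewrite -scaleN1r T_scale// scaleN1r.
Qed.

Lemma T_sum (I : Type) (r : seq I) (F : I -> X) : (forall i, SX (F i)) ->
  T (\sum_(i <- r) F i) = \sum_(i <- r) T (F i).
Proof.
move=> SF; elim: r => [|i r IH]; first by rewrite !big_nil T_0.
rewrite !big_cons T_add ?IH//.
by elim: r {IH} => [|k r IH]; rewrite ?big_nil// big_cons; exact: sumD.
Qed.

(** The factor 32 C is 2 C for the quasi-norms of the enlarged a' and b', times 4 for the sums of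
    rescaled pieces, times 4 for the lacunary sum of nodes at (A, B). *)
Lemma cap_estimate n (x : 'I_n -> X) z (l : R) :
  (forall i, cap_space j0 j1 (x i)) -> ballX z -> 0 < l ->
  \sum_(i < n) vabs (x i) <= l *: z ->
  exists2 z', ballY z' & forall i, vabs (T (x i)) <= (32 * C * K * l) *: z'.
Proof.
move=> xcap [a [b [[a0 b0] a1 b1 kz]]] l0 xz.
have li0 : 0 <= l^-1 by rewrite invr_ge0 ltW.
pose x' i := l^-1 *: x i.
have x'z : \sum_(i < n) vabs (x' i) <= z.
  rewrite (eq_bigr (fun i => l^-1 *: vabs (x i))).
    by rewrite -scaler_sumr -(@vleZ2l _ _ l)// scalerKV ?gt_eqF.
  by move=> i _; rewrite vabsZ ger0_norm.
have /choice[f0 hf0] : forall i, exists p, x' i = j0 p.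
  by move=> i; have [[p _ pE] _] := xcap i; exists (l^-1 *: p); rewrite linearZ pE.
have /choice[f1 hf1] : forall i, exists p, x' i = j1 p.
  by move=> i; have [_ [p _ pE]] := xcap i; exists (l^-1 *: p); rewrite linearZ pE.
pose u0 := \sum_(i < n) vabs (f0 i); pose u1 := \sum_(i < n) vabs (f1 i).
have u00 : 0 <= u0 by apply: vsumr_ge0 => i _; exact: vabs_ge0.
have u10 : 0 <= u1 by apply: vsumr_ge0 => i _; exact: vabs_ge0.
have uE0 : \sum_(i < n) vabs (x' i) = j0 u0.
  by rewrite linear_sum; apply: eq_bigr => i _; rewrite (emb_abs hx0) hf0.
have uE1 : \sum_(i < n) vabs (x' i) = j1 u1.
  by rewrite linear_sum; apply: eq_bigr => i _; rewrite (emb_abs hx1) hf1.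
(* L^-1 u0 and L^-1 u1 then have quasi-norm at most 1, and after the enlargement u0 <= L a' and u1
   <= L b', so truncation at L loses nothing. The resulting bound does not involve L. *)
pose L := 1 + qnorm u0 + qnorm u1.
have q0 := qnorm_ge0 u0; have q1 := qnorm_ge0 u1.
have L0 : 0 < L by rewrite /L; lra.
have Li0 : 0 <= L^-1 by rewrite invr_ge0 ltW.
pose a' := a + L^-1 *: u0; pose b' := b + L^-1 *: u1.
have Lu0 : 0 <= L^-1 *: u0 by exact: vscale_ge0.
have Lu1 : 0 <= L^-1 *: u1 by exact: vscale_ge0.
have a'0 : 0 <= a' by exact: vaddr_ge0.
have b'0 : 0 <= b' by exact: vaddr_ge0.
have small (q : R) : 0 <= q -> q <= L -> L^-1 * q <= 1.
  by move=> _ qL; rewrite ler_pdivrMl// mulr1.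
have a'1 : qnorm a' <= 2 * C.
  apply: (le_trans (hCX0 _ _)); rewrite mulrC ler_pM2r// qnormZ_ge0//.
  by have := small _ q0 (ltac:(rewrite /L; lra)); move: a1; lra.
have b'1 : qnorm b' <= 2 * C.
  apply: (le_trans (hCX1 _ _)); rewrite mulrC ler_pM2r// qnormZ_ge0//.
  by have := small _ q1 (ltac:(rewrite /L; lra)); move: b1; lra.
have [zX kzX] := pair_krivine_exists hX hphi a'0 b'0.
have zzX : z <= zX.
  rewrite -[zX]scale1r; apply: (kriv_le hX hphi ler01 a0 b0 kz kzX a'0 b'0).
    by rewrite scale1r -[leLHS]addr0 vleD2l.
  by rewrite scale1r -[leLHS]addr0 vleD2l.
have [|||m [c [d [p [q [[ci di] nle xp jpq [pa qb]]]]]]] :=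
    cap_decomposition hX hphi (x := x') L0 a'0 b'0 kzX.
- exact: le_trans zzX.
- rewrite uE0 -linearZ (emb_le hx0) scalerDr scalerKV ?gt_eqF//.
  by rewrite -[leLHS]add0r vleD2r vscale_ge0// ltW.
- rewrite uE1 -linearZ (emb_le hx1) scalerDr scalerKV ?gt_eqF//.
  by rewrite -[leLHS]add0r vleD2r vscale_ge0// ltW.
pose al k := dyadic L (c k); pose be k := dyadic L (d k).
have al0 k : 0 < al k by exact: dyadic_gt0.
have be0 k : 0 < be k by exact: dyadic_gt0.
(* One application of regularity covers all pairs (i, k), so A depends on neither i nor k. *)
have [A [A0 TA qA]] := regular_bound_fin
  (fun t : 'I_n * 'I_m => (al t.2)^-1 *: p t.1 t.2) hK0.
have [B [B0 TB qB]] := regular_bound_fin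
  (fun t : 'I_n * 'I_m => (be t.2)^-1 *: q t.1 t.2) hK1.
have r0 : 0 < 8 * C * K by rewrite !mulr_gt0.
have A1 : qnorm A <= 8 * C * K.
  apply: (le_trans qA); rewrite mulrC ler_pM2r//.
  rewrite -(pair_bigA _ (fun i k => vabs ((al k)^-1 *: p i k)))/=.
  apply: le_trans (qnorm_le _ pa) _.
    by apply: vsumr_ge0 => i _; apply: vsumr_ge0 => k _; exact: vabs_ge0.
  by rewrite qnormZ_ge0//; move: a'1; lra.
have B1 : qnorm B <= 8 * C * K.
  apply: (le_trans qB); rewrite mulrC ler_pM2r//.
  rewrite -(pair_bigA _ (fun i k => vabs ((be k)^-1 *: q i k)))/=.
  apply: le_trans (qnorm_le _ qb) _.
    by apply: vsumr_ge0 => i _; apply: vsumr_ge0 => k _; exact: vabs_ge0.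
  by rewrite qnormZ_ge0//; move: b'1; lra.
have [zY kzY] := pair_krivine_exists hY hphi A0 B0.
have [z' bz' zz'] := kriv_ball hY hphi r0 A0 B0 A1 B1 kzY.
exists z' => // i.
have Tp0 k : vabs (T (j0 (p i k))) <= al k *: k0 A.
  have -> : T (j0 (p i k)) = al k *: k0 (T0 ((al k)^-1 *: p i k)).
    rewrite -TT0 -T_scale; last exact: sum_inl.
    by rewrite -linearZ scalerKV// gt_eqF.
  rewrite vabsZ gtr0_norm// -(emb_abs hy0); apply: vleZ; first exact: ltW.
  by rewrite (emb_le hy0); exact: (TA (i, k)).
have Tp1 k : vabs (T (j0 (p i k))) <= be k *: k1 B.
  have -> : T (j0 (p i k)) = be k *: k1 (T1 ((be k)^-1 *: q i k)).
    rewrite jpq -TT1 -T_scale; last exact: sum_inr.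
    by rewrite -linearZ scalerKV// gt_eqF.
  rewrite vabsZ gtr0_norm// -(emb_abs hy1); apply: vleZ; first exact: ltW.
  by rewrite (emb_le hy1); exact: (TB (i, k)).
have Tx' : vabs (T (x' i)) <= \sum_(k < m) vmeet (al k *: k0 A) (be k *: k1 B).
  rewrite xp T_sum; last by move=> k; exact: sum_inl.
  apply: le_trans (vabs_sum _ _ _) _; apply: vler_sum => k _.
  by rewrite le_vmeet Tp0 Tp1.
have jA : 0 <= k0 A by rewrite (emb_ge0 hy0).
have jB : 0 <= k1 B by rewrite (emb_ge0 hy1).
have [E0 iA iB _ _] := ideal_sub4 jA jB jA jB.
set E := (_ + _) in E0 iA iB.
have iz := pair_ideal hY kzY A0 B0 iA iB.
have imk k : ideal E (vmeet (al k *: k0 A) (be k *: k1 B)) by apply: ideal_meet; exact: idealZ.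
have iS : ideal E (\sum_(k < m) vmeet (al k *: k0 A) (be k *: k1 B)).
  by apply: ideal_sum => k _; exact: imk.
have sum_z : \sum_(k < m) vmeet (al k *: k0 A) (be k *: k1 B) <= 4 *: zY.
  apply: (char_leP E0 (pair_archimedean hY) iS (idealZ 4 iz)) => w cw.
  rewrite (char_sum cw)// (charZ cw)// (pair_char hY hphi kzY A0 B0 E0 iA iB cw).
  have wA := char_ge0 cw jA iA; have wB := char_ge0 cw jB iB.
  rewrite (eq_bigr (fun k => node L c d k (w (k0 A)) (w (k1 B)))); last first.
    by move=> k _; rewrite (char_meet cw) ?(charZ cw)//; exact: idealZ.
  apply: node_sum => //; first exact: (quadrant_ext_ge0 hphi).
  by move=> k; exact: nle.
have Sx' : SX (x' i) by rewrite hf0; exact: sum_inl.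
have -> : T (x i) = l *: T (x' i).
  by rewrite -T_scale// scalerKV ?gt_eqF.
rewrite vabsZ gtr0_norm// (_ : 32 * C * K * l = l * (4 * (8 * C * K))); last by ring.
rewrite -scalerA; apply: vleZ; first exact: ltW.
rewrite -scalerA; apply: (le_trans Tx'); apply: (le_trans sum_z); exact: vleZ.
Qed.

Let g := 3 * C ^+ 2.
Let r := 2 * C.
Let g0 : 0 < g. Proof. by rewrite mulr_gt0// exprn_gt0. Qed.
Let r0 : 0 < r. Proof. exact: mulr_gt0. Qed.
Let rge2 : 2 <= r. Proof. by rewrite ler_peMr. Qed.

Lemma T0_bounded p : qnorm (T0 p) <= K * qnorm p.
Proof.
have [A [A0 TA qA]] := regular_bound_fin (fun _ : 'I_1 => p) hK0.
rewrite big_ord_recl big_ord0 addr0 qnorm_abs in qA.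
exact: le_trans (qnorm_abs_le (TA ord0)) qA.
Qed.

Lemma T1_bounded p : qnorm (T1 p) <= K * qnorm p.
Proof.
have [A [A0 TA qA]] := regular_bound_fin (fun _ : 'I_1 => p) hK1.
rewrite big_ord_recl big_ord0 addr0 qnorm_abs in qA.
exact: le_trans (qnorm_abs_le (TA ord0)) qA.
Qed.

(** Controls T on the approximation errors, which need not lie in the intersection: as phi(a, b) <=
    a + b, they split into small parts in X0 and X1, where T0 and T1 are bounded. *)
Lemma T_small (U : set Y) : nbhs (0 : Y) U -> exists2 d : R, 0 < d &
  forall x z (e : R), ballX z -> 0 <= e -> vabs x <= e *: z -> e < d -> U (vabs (T x)).
Proof.
move=> /nbhs0_add[W nW WU].
have [d0 d0p dW0] := emb_small hy0 nW; have [d1 d1p dW1] := emb_small hy1 nW.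
exists (Num.min d0 d1 / K); first by rewrite divr_gt0// lt_min d0p.
move=> x z e [a [b [[a0 b0] a1 b1 kz]]] e0 xz.
rewrite ltr_pdivlMr// lt_min => /andP[ed0 ed1].
have [_ zab] := kriv_bound hX hphi a0 b0 kz.
have [|||p [q [-> pa qb]]] := @sum_decomp _ _ _ _ _ _ hX x (e *: a) (e *: b).
- exact: vscale_ge0.
- exact: vscale_ge0.
- by rewrite !linearZ -scalerDr; apply: (le_trans xz); exact: vleZ.
have small (E : quasiBanachLatticeType R) (v v' : E) (d : R) : e * K < d ->
    qnorm v <= 1 -> vabs v' <= e *: v -> K * qnorm v' < d.
  move=> ed v1 /qnorm_abs_le; rewrite qnormZ_ge0// => v'e.
  apply: le_lt_trans ed; rewrite mulrC ler_pM2r//; apply: (le_trans v'e).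
  by rewrite -[leRHS]mulr1; apply: ler_wpM2l.
rewrite T_add ?TT0 ?TT1; [|exact: sum_inl|exact: sum_inr].
apply: WU; [apply: dW0|apply: dW1].
  by apply: le_lt_trans (T0_bounded p) _; exact: small ed0 a1 pa.
by apply: le_lt_trans (T1_bounded q) _; exact: small ed1 b1 qb.
Qed.

(** 32 C from [cap_estimate], 2 g r from the telescoping increments, g from merging their dominating
    elements in Y, and 2 from the final geometric series. *)
Definition interpolation_const := 128 * C * g ^+ 2 * r.

(** Each increment is estimated by its own element of the ball in Y. Merging these costs r^k at the
    k-th increment, so the increments must shrink like r^(-2 k): half of the decay pays for the
    merging, half makes the series converge. *)
Lemma CL0_estimate n (x : 'I_n -> X) z (l : R) :
  (forall i, CL0_space j0 j1 phi (x i)) -> ballX z -> 0 < l ->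
  \sum_(i < n) vabs (x i) <= l *: z ->
  exists2 z', ballY z' & forall i, vabs (T (x i)) <= (interpolation_const * K * l) *: z'.
Proof.
move=> x0 bz l0 xz.
pose dl := r^-1; have dl0 : 0 < dl by rewrite invr_gt0.
have rdl : r * dl = 1 by rewrite divff// gt_eqF.
have dl2 : dl <= 1 / 2 by rewrite div1r lef_pV2 ?posrE.
(* The extra factor dl in the odd power cancels the r lost on the second element in [merge2]. *)
pose eta k := l * dl ^+ (k.*2.+1).
have eta0 k : 0 < eta k by rewrite mulr_gt0// exprn_gt0.
have /choice[y /choice[w yw]] : forall k, exists y : 'I_n -> X, exists w,
    [/\ forall i, cap_space j0 j1 (y i), ballX w &
      \sum_(i < n) vabs (x i - y i) <= eta k *: w].
  move=> k; have [y [cy [w bw yw]]] := CL0_approx hX hphi C1 hCX0 hCX1 x0 (eta0 k).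
  by exists y, w.
pose d k i := if k is k'.+1 then y k i - y k' i else y 0%N i.
(* z1 sits at index 0 and pays only g; z2 fills the later indices and pays g r, at index 1. *)
have merge2 (z1 z2 : X) : ballX z1 -> ballX z2 ->
    exists2 v, ballX v & z1 <= g *: v /\ z2 <= (g * r) *: v.
  move=> b1 b2; have [[|k]//|v bv vz] := ball_merge hX hphi C1 hCX0 hCX1
    (z := fun k => if k is k'.+1 then z2 else z1).
  exists v => //; split; first by have := vz 0%N; rewrite expr0 mulr1.
  by have := vz 1%N; rewrite expr1.
have capd k i : cap_space j0 j1 (d k i).
  case: k => [|k]; first by have [cy _ _] := yw 0%N; exact: cy.
  have [cy _ _] := yw k; have [cy' _ _] := yw k.+1.
  have [[p _ pE] [q _ qE]] := cy i; have [[p' _ p'E] [q' _ q'E]] := cy' i.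
  split; first by exists (p' - p) => //; rewrite linearB p'E pE.
  by exists (q' - q) => //; rewrite linearB q'E qE.
pose c k := 2 * g * r * l * dl ^+ k.*2.
have c0 k : 0 < c k by rewrite /c !mulr_gt0// exprn_gt0.
have dbound k : exists2 v, ballX v & \sum_(i < n) vabs (d k i) <= c k *: v.
  case: k => [|k].
    have [_ bw0 yw0] := yw 0%N; have [v bv [zv wv]] := merge2 _ _ bz bw0.
    exists v => //; have v0 := ball_ge0 hX hphi bv.
    apply: (@le_trans _ _ (\sum_(i < n) (vabs (x i) + vabs (x i - y 0%N i)))).
      apply: vler_sum => i _; rewrite /d -{1}(subKr (x i) (y 0%N i)); exact: vabsB.
    rewrite big_split/=; apply: le_trans (vleD xz yw0) _.
    apply: le_trans (vleD (vleZ (ltW l0) zv) (vleZ (ltW (eta0 0%N)) wv)) _.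
    rewrite !scalerA -scalerDl; apply: vleZr => //.
    have -> : eta 0%N * (g * r) = l * g.
      rewrite /eta/= expr1 (_ : _ * _ = l * g * (r * dl)); last by ring.
      by rewrite rdl mulr1.
    have -> : c 0%N = 2 * (l * g) * r by rewrite /c/= expr0; ring.
    have lg0 : 0 < l * g by exact: mulr_gt0.
    rewrite (_ : l * g + l * g = 2 * (l * g)); last by ring.
    rewrite ler_peMr//; first by rewrite ltW// mulr_gt0.
    by apply: le_trans rge2; rewrite ler1n.
  have [_ bw yk] := yw k; have [_ bw' yk'] := yw k.+1.
  have [v bv [zv wv]] := merge2 _ _ bw bw'.
  exists v => //; have v0 := ball_ge0 hX hphi bv.
  apply: (@le_trans _ _ (\sum_(i < n) (vabs (x i - y k i) + vabs (x i - y k.+1 i)))).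
    apply: vler_sum => i _; rewrite /d.
    have -> : y k.+1 i - y k i = (x i - y k i) - (x i - y k.+1 i).
      by rewrite opprB [RHS]addrC addrA subrK.
    exact: vabsB.
  rewrite big_split/=; apply: le_trans (vleD yk yk') _.
  apply: le_trans (vleD (vleZ (ltW (eta0 k)) zv) (vleZ (ltW (eta0 k.+1)) wv)) _.
  rewrite !scalerA -scalerDl; apply: vleZr => //.
  rewrite /eta /c doubleS !exprS; set D := dl ^+ k.*2.
  have D0 : 0 < D by rewrite exprn_gt0.
  have -> : l * (dl * (dl * (dl * D))) * (g * r) = l * (dl * (dl * D)) * g * (r * dl) by ring.
  have -> : 2 * g * r * l * (dl * (dl * D)) = 2 * (l * (dl * D) * g * (r * dl)) by ring.
  rewrite rdl !mulr1 mulr_natl mulr2n lerD2l.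
  have -> : l * (dl * (dl * D)) * g = dl * (l * (dl * D) * g) by ring.
  rewrite ger_pMl; first by lra.
  by rewrite !mulr_gt0.
have /choice[z' hz'] : forall k, exists z', ballY z' /\
    forall i, vabs (T (d k i)) <= (32 * C * K * c k) *: z'.
  move=> k; have [v bv dv] := dbound k.
  by have [z' bz' Tz'] := cap_estimate (capd k) bv (c0 k) dv; exists z'.
have [k|zY bzY zzY] := ball_merge hY hphi C1 hCY0 hCY1 (z := z'); first by have [] := hz' k.
have zY0 := ball_ge0 hY hphi bzY.
pose Q := 64 * C * K * g ^+ 2 * r * l.
have Q0 : 0 < Q by rewrite /Q !mulr_gt0// exprn_gt0.
have Td k i : vabs (T (d k i)) <= (Q * dl ^+ k) *: zY.
  have [_ /(_ i) h] := hz' k; apply: (le_trans h).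
  apply: le_trans (vleZ _ (zzY k)) _; first by apply: ltW; rewrite mulr_gt0 ?c0// !mulr_gt0.
  rewrite scalerA (_ : _ * _ = Q * dl ^+ k)// /c -addnn exprD -/g -/r /Q.
  have -> : 32 * C * K * (2 * g * r * l * (dl ^+ k * dl ^+ k)) * (g * r ^+ k) =
    64 * C * K * g ^+ 2 * r * l * ((r ^+ k * dl ^+ k) * dl ^+ k) by ring.
  by rewrite -exprMn rdl expr1n mul1r.
exists zY => // i.
have Sd k : SX (d k i) by have [[p _ <-] _] := capd k i; exact: sum_inl.
have yE m : y m i = \sum_(k < m.+1) d k i.
  elim: m => [|m IH]; first by rewrite big_ord_recl big_ord0 addr0.
  by rewrite big_ord_recr/= -IH addrC subrK.
have Sy m : SX (y m i) by have [/(_ i)[[p _ <-] _] _ _] := yw m; exact: sum_inl.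
have Sx : SX (x i) by have [[]] := x0 i.
have Ty m : vabs (T (y m i)) <= (interpolation_const * K * l) *: zY.
  rewrite yE T_sum//; apply: le_trans (vabs_sum _ _ _) _.
  apply: (@le_trans _ _ (\sum_(k < m.+1) (Q * dl ^+ k) *: zY)); first exact: vler_sum.
  rewrite -scaler_suml; apply: vleZr => //; rewrite -mulr_sumr.
  rewrite (_ : interpolation_const * K * l = Q * 2); last by rewrite /interpolation_const /Q; ring.
  rewrite ler_pM2l//.
  suff : \sum_(k < m.+1) dl ^+ k <= 2 - dl ^+ m.
    by move/le_trans; apply; rewrite gerBl exprn_ge0// ltW.
  elim: m => [|m IH]; first by rewrite big_ord_recl big_ord0 addr0 expr0; lra.
  rewrite big_ord_recr/=; apply: le_trans (lerD IH (lexx _)) _.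
  have Dm : 0 <= dl ^+ m by rewrite exprn_ge0// ltW.
  have : dl * dl ^+ m <= 1 / 2 * dl ^+ m by exact: ler_wpM2r.
  by rewrite exprS; lra.
(* The bound holds for T (y m i) uniformly in m, and T (x i - y m i) is small in the topology of Y;
   closedness of the cone carries the bound over to T (x i). *)
apply: (locally_solid_le (compatible_hausdorff hY)) => U nU.
have [e e0 eU] := T_small nU.
have [m hm] : exists m, eta m < e.
  have cv : (l * dl ^+ n) @[n --> \oo] --> l * 0.
    by apply: cvgM; [exact: cvg_cst|apply: cvg_expr; rewrite gtr0_norm//; lra].
  rewrite mulr0 in cv; have [N _ hN] := cvgr_lt _ cv e e0; exists N.
  by apply: (hN (N.*2.+1)) => /=; rewrite -addnn -addnS leq_addr.
have [_ bw yk] := yw m.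
exists (vabs (T (x i - y m i))).
  apply: (eU _ _ _ bw (ltW (eta0 m)) _ hm); apply: le_trans yk.
  by apply: (@vle_sum1 _ _ _ (fun i => vabs (x i - y m i))) => k; exact: vabs_ge0.
have Sxy : SX (x i - y m i) by apply: (sumD Sx); exact: sumN.
have -> : T (x i) = T (x i - y m i) + T (y m i) by rewrite -T_add// subrK.
by rewrite addrC; apply: le_trans (vabsD _ _) _; rewrite vleD2r.
Qed.

Let Cf_gt0 : 0 < interpolation_const * K.
Proof. by rewrite /interpolation_const !mulr_gt0// exprn_gt0. Qed.

Lemma CL0_bounds n (x : 'I_n -> X) l : (forall i, CL0_space j0 j1 phi (x i)) ->
  CL_bounds (j0 := j0) (j1 := j1) (phi := phi) (\sum_(i < n) vabs (x i)) l ->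
  CL_bounds (j0 := k0) (j1 := k1) (phi := phi)
    (\big[@vjoin R Y/0]_(i < n) vabs (T (x i))) (interpolation_const * K * l).
Proof.
move=> x0 [l0 [z bz xz]].
rewrite vabs_pos in xz; last by apply: vsumr_ge0 => i _; exact: vabs_ge0.
have [z' bz' Tz'] := CL0_estimate x0 bz l0 xz.
split; first exact: mulr_gt0.
exists z' => //; rewrite vabs_pos ?bigjoin_ge0//; apply/vle_bigjoin; split=> //.
by apply: vscale_ge0 (ball_ge0 hY hphi bz'); rewrite ltW// mulr_gt0.
Qed.

Lemma CL0_bounds1 x l : CL0_space j0 j1 phi x ->
  CL_bounds (j0 := j0) (j1 := j1) (phi := phi) x l ->
  CL_bounds (j0 := k0) (j1 := k1) (phi := phi) (T x) (interpolation_const * K * l).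
Proof.
move=> x0 [l0 [z bz xz]]; have [//||z' bz' Tz'] := CL0_estimate (x := fun _ : 'I_1 => x) _ bz l0.
  by rewrite big_ord_recl big_ord0 addr0.
by split; [exact: mulr_gt0|exists z'; [|exact: (Tz' ord0)]].
Qed.

Lemma CL0_map x : CL0_space j0 j1 phi x -> CL0_space k0 k1 phi (T x).
Proof.
move=> x0; have [xCL xapp] := x0; split.
  apply/(CL_spaceP hY hphi); have /(CL_spaceP hX hphi)[l xl] := xCL.
  by exists (interpolation_const * K * l); exact: CL0_bounds1.
move=> e e0; have e'0 : 0 < e / (interpolation_const * K) by rewrite divr_gt0.
have [y cy xy] := xapp _ e'0.
have capB a b : cap_space j0 j1 a -> cap_space j0 j1 b -> cap_space j0 j1 (a - b).
  move=> [[p _ <-] [q _ qE]] [[p' _ <-] [q' _ q'E]]; split.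
    by exists (p - p') => //; rewrite linearB.
  by exists (q - q') => //; rewrite linearB qE q'E.
have yCL := cap_CL hX hphi cy; have xyCL := CL_sub hX hphi C1 hCX0 hCX1 xCL yCL.
(* The estimate for T is available on the closure only, so x - y must be placed there before T (x -
   y) is bounded. *)
have xy0 : CL0_space j0 j1 phi (x - y).
  split=> // d d0; have [v cv xv] := xapp d d0.
  by exists (v - y); [exact: capB|rewrite opprB addrA subrK].
have [l xl le] := CL_qnorm_lt hX hphi xyCL xy.
exists (T y).
  have [[p _ <-] [q _ qE]] := cy; split; first by exists (T0 p); rewrite // TT0.
  by exists (T1 q) => //; rewrite -TT1 qE.
rewrite -T_sub; [|by case: xCL|by case: yCL].
apply: le_lt_trans (CL_qnorm_le (CL0_bounds1 xy0 xl)) _.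
by rewrite mulrC -ltr_pdivlMr.
Qed.

Lemma CL0_regular_bound : regular_bound (CL0_space j0 j1 phi)
  (CL_qnorm j0 j1 phi) (CL_qnorm k0 k1 phi) T (interpolation_const * K).
Proof.
move=> n x x0; rewrite -ler_pdivrMl//.
rewrite [leRHS]CL_qnormE; apply: lb_le_inf.
  by apply: (CL_sum hX hphi C1 hCX0 hCX1) => i; have [] := x0 i.
by move=> l xl; rewrite ler_pdivrMl//; exact: CL_qnorm_le (CL0_bounds x0 xl).
Qed.

End Interpolation.

Lemma triangle_const_exists (R : realType) (E : quasiBanachLatticeType R) :
  exists C : R, forall C', C <= C' -> triangle_const E C'.
Proof.
have [C _ hC] := @qnormD R E; exists C => C' CC x y; apply: le_trans (hC x y) _.
by apply: ler_wpM2r CC; rewrite addr_ge0 ?qnorm_ge0.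
Qed.

Lemma regular_bound_le (R : realType) (E F : quasiBanachLatticeType R)
    (T : E -> F) (K K' : R) : K <= K' ->
  regular_bound [set: E] qnorm qnorm T K -> regular_bound [set: E] qnorm qnorm T K'.
Proof.
by move=> KK hT n x xS; apply: le_trans (hT n x xS) _; apply: ler_wpM2r KK; exact: qnorm_ge0.
Qed.

Lemma rho_adherent (R : realType) (E F : quasiBanachLatticeType R)
    (T : E -> F) (d : R) : 0 < d -> regular [set: E] qnorm qnorm T ->
  exists K, [/\ 0 < K, regular_bound [set: E] qnorm qnorm T K
    & K < rho [set: E] qnorm qnorm T + d].
Proof.
move=> d0 [K0 K00 hK0]; rewrite /rho.
have [|K [K1 hK] Kd] := @inf_adherent R [set K : R | 0 < K /\ regular_bound [set: E] qnorm qnorm T K] d d0.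
  by split; [exists K0|exists 0 => K [/ltW]].
by exists K.
Qed.

Theorem theorem5p5 (R : realType) (X0 X1 Y0 Y1 : quasiBanachLatticeType R)
    (phi : R -> R -> R) (hphi : class_P phi) :
  exists C : R, 0 < C /\
  forall (X Y : locallySolidType R)
    (j0 : {linear X0 -> X}) (j1 : {linear X1 -> X})
    (k0 : {linear Y0 -> Y}) (k1 : {linear Y1 -> Y}),
  compatible_pair j0 j1 -> compatible_pair k0 k1 ->
  forall (T : X -> Y) (T0 : X0 -> Y0) (T1 : X1 -> Y1),
  linear_on (sum_space j0 j1) T ->
  (forall x, sum_space j0 j1 x -> sum_space k0 k1 (T x)) ->
  (forall x, T (j0 x) = k0 (T0 x)) ->
  (forall x, T (j1 x) = k1 (T1 x)) ->
  regular [set: X0] qnorm qnorm T0 ->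
  regular [set: X1] qnorm qnorm T1 ->
  [/\ forall x, CL0_space j0 j1 phi x -> CL0_space k0 k1 phi (T x),
      regular (CL0_space j0 j1 phi)
        (CL_qnorm j0 j1 phi) (CL_qnorm k0 k1 phi) T
    & rho (CL0_space j0 j1 phi)
        (CL_qnorm j0 j1 phi) (CL_qnorm k0 k1 phi) T
      <= C * Num.max (rho [set: X0] qnorm qnorm T0)
                     (rho [set: X1] qnorm qnorm T1)].
Proof.
have [cX0 hX0] := triangle_const_exists X0; have [cX1 hX1] := triangle_const_exists X1.
have [cY0 hY0] := triangle_const_exists Y0; have [cY1 hY1] := triangle_const_exists Y1.
(* One quasi-triangle constant for the four spaces, fixed before the ambient lattices, the
   embeddings and T are introduced. *)
pose C := 1 + (`|cX0| + `|cX1| + `|cY0| + `|cY1|).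
have nX0 := normr_ge0 cX0; have nX1 := normr_ge0 cX1.
have nY0 := normr_ge0 cY0; have nY1 := normr_ge0 cY1.
have lX0 := ler_norm cX0; have lX1 := ler_norm cX1.
have lY0 := ler_norm cY0; have lY1 := ler_norm cY1.
have C1 : 1 <= C by rewrite /C; lra.
have {}hX0 : triangle_const X0 C by apply: hX0; rewrite /C; lra.
have {}hX1 : triangle_const X1 C by apply: hX1; rewrite /C; lra.
have {}hY0 : triangle_const Y0 C by apply: hY0; rewrite /C; lra.
have {}hY1 : triangle_const Y1 C by apply: hY1; rewrite /C; lra.
have Cp : 0 < C by exact: lt_le_trans ltr01 C1.
pose D := interpolation_const (C := C).
have D0 : 0 < D by rewrite /D /interpolation_const !mulr_gt0// exprn_gt0// mulr_gt0// exprn_gt0.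
exists D; split=> // X Y j0 j1 k0 k1 hX hY T T0 T1 Tlin _ TT0 TT1 reg0 reg1.
have bound K : 0 < K -> regular_bound [set: X0] qnorm qnorm T0 K ->
    regular_bound [set: X1] qnorm qnorm T1 K ->
    regular_bound (CL0_space j0 j1 phi) (CL_qnorm j0 j1 phi) (CL_qnorm k0 k1 phi) T (D * K).
  move=> K0 b0 b1.
  exact: (CL0_regular_bound hX hY hphi C1 hX0 hX1 hY0 hY1 Tlin TT0 TT1 K0 b0 b1).
have bounds d : 0 < d -> exists K, [/\ 0 < K, regular_bound [set: X0] qnorm qnorm T0 K,
    regular_bound [set: X1] qnorm qnorm T1 K &
    K <= Num.max (rho [set: X0] qnorm qnorm T0) (rho [set: X1] qnorm qnorm T1) + d].
  move=> d0; have [K0 [K00 b0 r0]] := rho_adherent d0 reg0.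
  have [K1 [K10 b1 r1]] := rho_adherent d0 reg1.
  exists (Num.max K0 K1); split.
  - by rewrite lt_max K00.
  - by apply: regular_bound_le b0; rewrite le_max lexx.
  - by apply: regular_bound_le b1; rewrite le_max lexx orbT.
  - rewrite ge_max; apply/andP; split.
      by apply: (le_trans (ltW r0)); rewrite lerD2r le_max lexx.
    by apply: (le_trans (ltW r1)); rewrite lerD2r le_max lexx orbT.
have [K [K0 b0 b1 _]] := bounds 1 ltr01.
split.
- exact: (CL0_map hX hY hphi C1 hX0 hX1 hY0 hY1 Tlin TT0 TT1 K0 b0 b1).
- by exists (D * K); [exact: mulr_gt0|exact: bound].
(* [rho] is an infimum over K > 0 and may be 0, so it is approached from above; the slack d / D
   becomes d after multiplication by D. *)
- apply/ler_addgt0Pr => d d0; have d'0 : 0 < d / D by rewrite divr_gt0.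
  have [K' [K'0 b0' b1' hK']] := bounds _ d'0.
  apply: (@le_trans _ _ (D * K')).
    apply: ge_inf; first by exists 0 => k [/ltW].
    by split; [exact: mulr_gt0|exact: bound].
  apply: le_trans (ler_wpM2l (ltW D0) hK') _.
  by rewrite mulrDr mulrCA divff ?mulr1// gt_eqF.
Qed.
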